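(* Assume that $f\in L^2(\mathbb{R}^2)$ and that $(t_0,s_0)\in\mathbb{R}^2\times\mathbb{R}$ is an $N$-regular directed point of $f$. Let $\psi\in H_{(0,L)}(\mathbb{R}^2)$ with $\hat\psi\in L^1(\mathbb{R}^2)$ be a shearlet with $M$ vanishing moments in $x_1$-direction which satisfies a decay estimate of the form $$\psi(x)=O\big((1+|x|)^{-P}\big).$$ Then there exist a neighbourhood $U(t_0)$ of $t_0$ and a neighbourhood $V(s_0)$ of $s_0$ such that for any $1/2<\alpha<1$, $t\in U(t_0)$ and $s\in V(s_0)$ we have the decay estimate, as $a\to0$, $$\mathcal{SH}_\psi f(a,s,t)=O\big(a^{-3/4+P/2}+a^{(1-\alpha)M}+a^{-3/4+\alpha N}+a^{(\alpha-1/2)L}\big).$$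
   Context: Fourier transform: $\hat f(\omega)=\int_{\mathbb{R}^2}f(x)e^{-2\pi i x\omega}dx$. For $a>0$, $s\in\mathbb{R}$, $t\in\mathbb{R}^2$ let $\psi_{ast}(x)=a^{-3/4}\psi\big(\frac{x_1-t_1+s(x_2-t_2)}{a},\frac{x_2-t_2}{a^{1/2}}\big)$ and $\mathcal{SH}_\psi f(a,s,t)=\langle f,\psi_{ast}\rangle$ ($L^2$ inner product). A shearlet is an admissible function, i.e. $\psi\in L^2(\mathbb R^2)$ with $C_\psi:=\int_{\mathbb{R}^2}\frac{|\hat\psi(\omega)|^2}{|\omega_1|^2}d\omega=\int_{\mathbb{R}}\int_0^\infty|\hat\psi(a\xi_1,\sqrt a(\xi_2-s\xi_1))|^2a^{-3/2}\,da\,ds<\infty$ for $\xi_1\ne0$. $\psi$ has $n$ vanishing moments in $x_1$-direction if $\int_{\mathbb{R}^2}|\hat\psi(\omega)|^2|\omega_1|^{-2n}d\omega<\infty$. $H_{(n_1,n_2)}(\mathbb{R}^2)$ is the space of $f\in L^2(\mathbb{R}^2)$ with $(\partial/\partial x_1)^{n_1}(\partial/\partial x_2)^{n_2}f\in L^2(\mathbb{R}^2)$. For $N\in\mathbb{R}$, $(x,\lambda)\in\mathbb{R}^2\times\mathbb{R}$ is an $N$-regular directed point of $f$ if there are a neighbourhood $U_x$ of $x$, a smooth cutoff function (compactly supported) $\Phi$ with $\Phi\equiv1$ on $U_x$, and a neighbourhood $V_\lambda$ of $\lambda$ such that $(\Phi f)^\wedge(\eta)=O((1+|\eta|)^{-N})$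 for all $\eta=(\eta_1,\eta_2)$ with $\eta_2/\eta_1\in V_\lambda$. *)

(* Defs.v *)
From HB Require Import structures.
From mathcomp Require Import all_boot all_order all_algebra.
From mathcomp Require Import all_classical all_reals all_analysis.
From mathcomp Require Import complex.
Import Order.TTheory GRing.Theory Num.Theory.
Import numFieldNormedType.Exports.

Set Implicit Arguments.
Unset Strict Implicit.
Unset Printing Implicit Defensive.

Local Open Scope classical_set_scope.
Local Open Scope ring_scope.
Local Open Scope complex_scope.

Notation cabs := ComplexField.Normc.normc.

Section Plane.
Context {R : realType}.
Implicit Types (x w t : R * R) (f g psi : R * R -> R[i]) (phi : R * R -> R).

Definition mu2 :
    {measure set (measurableTypeR R * measurableTypeR R)%type -> \bar R} :=
  (lebesgue_measure \x lebesgue_measure)%E.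

(* The library norm on [R * R] is the max norm. *)
Definition enorm x : R := Num.sqrt (x.1 ^+ 2 + x.2 ^+ 2).

Definition dot x w : R := x.1 * w.1 + x.2 * w.2.

Definition cintegral f : R[i] :=
  Rintegral mu2 setT (fun x => complex.Re (f x)) +i*
  Rintegral mu2 setT (fun x => complex.Im (f x)).

Definition LpC (p : \bar R) f : Prop :=
  ((fun x => complex.Re (f x)) \in Lfun mu2 p) /\ ((fun x => complex.Im (f x)) \in Lfun mu2 p).

Definition innerC f g : R[i] := cintegral (fun x => f x * conjc (g x)).

Definition fourier f w : R[i] :=
  cintegral (fun x => f x *
    (cos (2 * pi * dot x w) -i* sin (2 * pi * dot x w))).

Definition truncate (n : nat) f x : R[i] :=
  if enorm x <= n%:R then f x else 0.

(* On L^2 the defining integral need not converge: the transform is the limit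
   in L^2 of the transforms of the (integrable) truncations of [f] to balls. *)
Definition is_fourierL2 f g : Prop :=
  LpC 2%:E g /\
  (fun n : nat => \int[mu2]_w
     ((cabs (fourier (truncate n f) w - g w)) ^+ 2)%:E)%E @ \oo --> 0%E.

(* Determined up to a null set, for [f] in L^2; hence to be used only in
   statements that do not depend on the representative. *)
Definition fourierL2 f : R * R -> R[i] :=
  xget (fun=> 0) [set g | is_fourierL2 f g].

Definition partial1 phi x : R := 'D_((1, 0) : R * R) phi x.
Definition partial2 phi x : R := 'D_((0, 1) : R * R) phi x.

Fixpoint Cn (n : nat) phi : Prop :=
  continuous phi /\
  (if n is m.+1 then
    [/\ forall x, derivable phi x ((1, 0) : R * R),
        forall x, derivable phi x ((0, 1) : R * R),
        Cn m (partial1 phi) & Cn m (partial2 phi)]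
  else True).

Definition smooth phi : Prop := forall n, Cn n phi.

Definition compactly_supported phi : Prop :=
  compact (closure [set x | phi x != 0]).

Definition weak_partial (n1 n2 : nat) f g : Prop :=
  forall phi, smooth phi -> compactly_supported phi ->
  cintegral (fun x => f x * (iter n1 partial1 (iter n2 partial2 phi) x)%:C) =
  (-1) ^+ (n1 + n2) * cintegral (fun x => g x * (phi x)%:C).

Definition sobolevH (n1 n2 : nat) f : Prop :=
  LpC 2%:E f /\ exists2 g, LpC 2%:E g & weak_partial n1 n2 f g.

(* [C_psi]; division by zero on the null set [w.1 = 0] is harmless. *)
Definition admissibility_constant psi : \bar R :=
  (\int[mu2]_w ((cabs (fourierL2 psi w)) ^+ 2 / `|w.1| ^+ 2)%:E)%E.

Definition shearlet psi : Prop :=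
  LpC 2%:E psi /\ (admissibility_constant psi < +oo)%E.

Definition vanishing_moments_x1 (n : nat) psi : Prop :=
  (\int[mu2]_w ((cabs (fourierL2 psi w)) ^+ 2 / `|w.1| ^+ (2 * n))%:E < +oo)%E.

Definition shearlet_atom psi (a s : R) t x : R[i] :=
  (a `^ (- (3 / 4)))%:C *
  psi ((x.1 - t.1 + s * (x.2 - t.2)) / a, (x.2 - t.2) / a `^ (1 / 2)).

Definition shearlet_transform psi f (a s : R) t : R[i] :=
  innerC f (shearlet_atom psi a s t).

(* The product of [f] in L^2 with a cutoff is integrable, so that the integral
   [fourier], and with it the pointwise bound, makes sense. The quotient of the
   frequency coordinates requires the first one to be nonzero. *)
Definition regular_directed_point (N : R) f x (lambda : R) : Prop :=
  exists (U : set (R * R)) (phi : R * R -> R) (V : set R) (C : R),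
    [/\ nbhs x U, nbhs lambda V, smooth phi /\ compactly_supported phi,
        forall y, U y -> phi y = 1 &
        forall w, w.1 != 0 -> V (w.2 / w.1) ->
          cabs (fourier (fun y => (phi y)%:C * f y) w)
            <= C * (1 + enorm w) `^ (- N)].

(* Elements of L^2 are classes modulo null sets, so the bound is required
   almost everywhere. *)
Definition decay (P : R) psi : Prop :=
  exists C : R,
    {ae mu2, forall x, cabs (psi x) <= C * (1 + enorm x) `^ (- P)}.

End Plane.

(* Main.v *)
(* Write [f = phi f + (1 - phi) f], where [phi] is the cutoff of the directed
   point, and substitute the affine map [z |-> x] that turns the atom into a
   multiple of [psi]. The function [(1 - phi) f] vanishes near [t], so that only
   [|z| >= c a^(-1/2)] contributes: Cauchy-Schwarz and the decay of [psi] give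
   [a^(P/2 - 3/4)]. For [G = phi f], Parseval turns the coefficient into an
   integral of the dilated and sheared transform of [G] against that of [psi].
   On [|w_1| <= a^(1 - alpha)] the vanishing moments are used, on
   [|w_2| >= d a^(1/2 - alpha)] the Sobolev regularity, both with Cauchy-Schwarz;
   the remaining frequencies are sent to slopes near [s0] and to size at least
   [a^(-alpha)], where the transform of [G] decays, and the transform of [psi]
   is integrable.

   Plancherel: damping the energy of the transform of [u] by [exp(-e|w|_1)]
   turns it into an average of [u] against a Poisson kernel, so the transform is
   a contraction of [L^2]; the defect is then a nonnegative quadratic form, which
   vanishes on boxes by an explicit computation, hence everywhere by a monotone
   class argument.

   Sobolev regularity: if [g] is the weak derivative, testing against all
   translates of a bump [eta] shows that
   [eta^ ((2 pi i w_2)^L psi^ - (-1)^L g^)], up to conjugations, has a vanishing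
   Fourier transform; dilating [eta] makes [eta^ w <> 0] at any given [w]. *)
From HB Require Import structures.
Require Import Defs.
From mathcomp Require Import all_boot all_order all_algebra.
From mathcomp Require Import all_classical all_reals all_analysis.
From mathcomp Require Import measurable_realfun complex ring lra.
Import Order.TTheory GRing.Theory Num.Theory.
Import numFieldNormedType.Exports.
Set Implicit Arguments.
Unset Strict Implicit.
Unset Printing Implicit Defensive.
Local Open Scope classical_set_scope.
Local Open Scope ring_scope.
Local Open Scope complex_scope.
Set SsrOldRewriteGoalsOrder.
Import numFieldTopology.Exports.
Import HBNNSimple.

(** * Real-valued square-integrable functions *)

(** Powers of [a]: the change of variables has Jacobian [a^(3/2)] and the atom carries [a^(-3/4)],
    which leaves [a^(3/4)]. Exactly this factor restores the norm of the dilated function, so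
    Cauchy-Schwarz costs nothing; a pointwise bound on the dilated transform pays the full
    [a^(-3/2)] instead, whence [a^(-3/4 + alpha N)]. The decay of [psi] is split as
    [3/2 + (P - 3/2)]: the exponent [3/2] gives a square-integrable weight on the plane, and
    [(a^(1/2))^(P - 3/2)] is the stated power. For [P <= 3/2] or [N < 0] the claimed bound is at
    least a constant, and a uniform Cauchy-Schwarz bound is enough.

    The obstacle is that [fourierL2] is chosen modulo null sets. It enters through integrals, paired
    by Parseval with a function whose transform is an absolutely convergent integral, or through
    almost-everywhere identities. The smooth test function for the weak derivative is not built by
    hand: it is the square of the cutoff supplied by the regular directed point. *)

Lemma cvg_dist_le (R : realType) (a b : nat -> R) (l : R) :
  (forall n, `|a n - l| <= b n) -> b @ \oo --> (0:R) -> a @ \oo --> l.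
Proof.
move=> ab b0.
apply: (@squeeze_cvgr _ _ _ _ (fun n => l - b n) (fun n => l + b n)).
- by apply: nearW => n; have := ab n; rewrite ler_norml; lra.
- by rewrite -[X in _ --> X]subr0; apply: cvgB => //; exact: cvg_cst.
- by rewrite -[X in _ --> X]addr0; apply: cvgD => //; exact: cvg_cst.
Qed.

Section L2.
Context d (T : measurableType d) (R : realType).
Variable mu : {measure set T -> \bar R}.
Implicit Types u v w : T -> R.
Local Notation L2 := (Lfun mu 2%:E).

Let le12 : (1 <= 2%:E :> \bar R)%E.
Proof. by rewrite lee_fin ler1n. Qed.

Definition l2inner u v : R := \int[mu]_x (u x * v x).
Local Notation ip := l2inner.

Lemma L2_measurable u : u \in L2 -> measurable_fun setT u.
Proof. by rewrite inE => /andP[/[!inE]]. Qed.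

Lemma L2P u : measurable_fun setT u ->
  (\int[mu]_x (u x * u x)%:E < +oo)%E -> u \in L2.
Proof.
move=> mu_ ufin; rewrite inE; apply/andP; split; rewrite inE //= /finite_norm.
rewrite unlock; apply: poweR_lty; apply: le_lt_trans ufin.
rewrite le_eqVlt; apply/orP; left; apply/eqP; apply: eq_integral => x _ /=.
by rewrite powR_mulrn// -normrX expr2 ger0_norm// -expr2 sqr_ge0.
Qed.

Lemma L2_int u v : u \in L2 -> v \in L2 ->
  mu.-integrable setT (EFin \o (fun x => u x * v x)).
Proof. by move=> hu hv; apply/Lfun1_integrable; exact: Lfun2_mul_Lfun1. Qed.

Lemma L2D u v : u \in L2 -> v \in L2 -> (fun x => u x + v x) \in L2.
Proof. exact: (Lfun_addr_closed mu le12).2. Qed.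

Lemma L2Z c u : u \in L2 -> (fun x => c * u x) \in L2.
Proof.
move=> hu; have le12R : 1 <= 2 :> R by rewrite ler1n.
have := Lfun_scale c le12R hu.
by under eq_fun do rewrite /= mulrC.
Qed.

Lemma L2N u : u \in L2 -> (fun x => - u x) \in L2.
Proof.
move=> hu; have := L2Z (-1) hu.
by under eq_fun do rewrite mulN1r.
Qed.

Lemma L2B u v : u \in L2 -> v \in L2 -> (fun x => u x - v x) \in L2.
Proof. by move=> hu hv; apply: (L2D hu); exact: L2N. Qed.

Lemma L2_0 : (fun _ : T => 0 : R) \in L2.
Proof. exact: (Lfun_addr_closed mu le12).1. Qed.

Lemma ip_ge0 u : 0 <= ip u u.
Proof. by apply: Rintegral_ge0 => x _; rewrite -expr2 sqr_ge0. Qed.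

Lemma ipC u v : ip u v = ip v u.
Proof. by apply: eq_Rintegral => x _; rewrite mulrC. Qed.

Lemma ipDl u v w : u \in L2 -> v \in L2 -> w \in L2 ->
  ip (fun x => u x + v x) w = ip u w + ip v w.
Proof.
move=> hu hv hw; rewrite -RintegralD//; try exact: L2_int.
by apply: eq_Rintegral => x _; rewrite mulrDl.
Qed.

Lemma ipZl c u w : u \in L2 -> w \in L2 ->
  ip (fun x => c * u x) w = c * ip u w.
Proof.
move=> hu hw; rewrite -RintegralZl//; try exact: L2_int.
by apply: eq_Rintegral => x _; rewrite mulrA.
Qed.

Lemma ipBl u v w : u \in L2 -> v \in L2 -> w \in L2 ->
  ip (fun x => u x - v x) w = ip u w - ip v w.
Proof.
move=> hu hv hw; rewrite -RintegralB//; try exact: L2_int.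
by apply: eq_Rintegral => x _; rewrite mulrBl.
Qed.

Lemma ip_sqrD u v : u \in L2 -> v \in L2 ->
  ip (fun x => u x + v x) (fun x => u x + v x) = ip u u + 2 * ip u v + ip v v.
Proof.
move=> hu hv; rewrite ipDl//; last exact: L2D.
rewrite ipC ipDl//.
rewrite [X in _ + X]ipC ipDl// (ipC v u); ring.
Qed.

Lemma ip_sqrB u v : u \in L2 -> v \in L2 ->
  ip (fun x => u x - v x) (fun x => u x - v x) = ip u u - 2 * ip u v + ip v v.
Proof.
move=> hu hv; rewrite ipBl//; last exact: L2B.
rewrite ipC ipBl//.
rewrite [X in _ - X]ipC ipBl// (ipC v u); ring.
Qed.

Lemma ip_sqrD_le u v : u \in L2 -> v \in L2 ->
  ip (fun x => u x + v x) (fun x => u x + v x) <= 2 * ip u u + 2 * ip v v.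
Proof.
move=> hu hv; have := ip_ge0 (fun x => u x - v x).
by rewrite ip_sqrB// ip_sqrD//; lra.
Qed.

Lemma cauchy_schwarz u v : u \in L2 -> v \in L2 ->
  `|ip u v| <= Num.sqrt (ip u u) * Num.sqrt (ip v v).
Proof.
move=> hu hv; rewrite -sqrtrM ?ip_ge0// -sqrtr_sqr ler_wsqrtr//.
have H t : 0 <= ip u u - 2 * t * ip u v + t ^+ 2 * ip v v.
  have := ip_ge0 (fun x => u x - t * v x).
  rewrite ip_sqrB//; last exact: L2Z.
  have E w : w \in L2 -> ip w (fun x => t * v x) = t * ip w v.
    by move=> hw; rewrite ipC ipZl// (ipC v).
  rewrite !E//; last exact: L2Z.
  by rewrite ipZl// expr2 !mulrA.
have [v0|v0] := eqVneq (ip v v) 0.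
  have [->|uv0] := eqVneq (ip u v) 0; first by rewrite expr0n/= v0 mulr0.
  (* At this parameter the polynomial, affine since [ip v v = 0], takes the value [-1]. *)
  have := H ((ip u u + 1) / (2 * ip u v)); rewrite v0 mulr0 addr0.
  have -> : 2 * ((ip u u + 1) / (2 * ip u v)) * ip u v = ip u u + 1.
    by field.
  by lra.
have {}v0 : 0 < ip v v by rewrite lt_def v0 ip_ge0.
have := H (ip u v / ip v v).
have -> : ip u u - 2 * (ip u v / ip v v) * ip u v
    + (ip u v / ip v v) ^+ 2 * ip v v = ip u u - ip u v ^+ 2 / ip v v.
  by field; rewrite gt_eqF.
by rewrite subr_ge0 ler_pdivrMr.
Qed.

Lemma ipE u : u \in L2 -> (ip u u)%:E = (\int[mu]_x (u x * u x)%:E)%E.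
Proof.
move=> hu; rewrite /ip /Rintegral fineK//.
by apply: integrable_fin_num => //; exact: L2_int.
Qed.

Lemma L2_le u v : measurable_fun setT u -> v \in L2 ->
  (forall x, `|u x| <= `|v x|) -> u \in L2.
Proof.
move=> mu_ hv uv; have mv := L2_measurable hv; apply: L2P => //.
apply: le_lt_trans (ltry (ip v v)); rewrite ipE//.
apply: ge0_le_integral => //.
- by move=> x _; rewrite lee_fin -expr2 sqr_ge0.
- by apply/measurable_EFinP; exact: measurable_funM.
- by apply/measurable_EFinP; exact: measurable_funM.
- by move=> x _; rewrite lee_fin -[leLHS]ger0_norm -?expr2 ?sqr_ge0// -[leRHS]ger0_norm
    ?sqr_ge0// !normrX ler_sqr ?nnegrE.
Qed.

Lemma L2_mul_bounded u v (c : R) : u \in L2 -> measurable_fun setT v ->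
  (forall x, `|v x| <= c) -> (fun x => v x * u x) \in L2.
Proof.
move=> hu mv vc; apply: (L2_le _ (L2Z c hu)).
  by apply: measurable_funM => //; exact: L2_measurable.
by move=> x; rewrite !normrM ler_wpM2r// (le_trans (vc x))// ler_norm.
Qed.

Definition L2cvg (un : nat -> T -> R) u :=
  (fun n => ip (fun x => un n x - u x) (fun x => un n x - u x)) @ \oo --> (0:R).

Lemma L2cvg_ip un u v : (forall n, un n \in L2) -> u \in L2 -> v \in L2 ->
  L2cvg un u -> (fun n => ip (un n) v) @ \oo --> ip u v.
Proof.
move=> hun hu hv h; apply: (@cvg_dist_le _ _ (fun n =>
  Num.sqrt (ip (fun x => un n x - u x) (fun x => un n x - u x)) *
  Num.sqrt (ip v v))).
  by move=> n; rewrite -ipBl// cauchy_schwarz//; exact: L2B.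
rewrite -[X in _ --> X](mul0r (Num.sqrt (ip v v))); apply: cvgMr_tmp.
rewrite -[X in _ --> X]sqrtr0.
by apply: (continuous_cvg _ _ h); exact: sqrt_continuous.
Qed.

(** Dropping the first [N] terms changes no pointwise limit, so Fatou's lemma needs its bound only
    eventually. *)
Lemma fatou_le (fn : nat -> T -> R) (f : T -> R) (c : \bar R) :
    (forall n, measurable_fun setT (fn n)) -> (forall n x, 0 <= fn n x) ->
    (forall x, (fun n => fn n x) @ \oo --> f x) ->
    (\forall n \near \oo, (\int[mu]_x (fn n x)%:E <= c)%E) ->
  (\int[mu]_x (f x)%:E <= c)%E.
Proof.
move=> mfn fn0 fnf [N _ fnc].
have fnf' x : (fun n => fn (n + N)%N x) @ \oo --> f x.
  by rewrite (cvg_shiftn N (fun n => fn n x)); exact: fnf.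
have -> : (\int[mu]_x (f x)%:E =
    \int[mu]_x limn_einf (fun n => (fn (n + N)%N x)%:E))%E.
  apply: eq_integral => x _; apply/esym.
  have h : (fun n => (fn (n + N)%N x)%:E) @ \oo --> (f x)%:E.
    by apply: cvg_EFin; [exact: nearW|exact: fnf'].
  by have [-> _] := cvg_limn_einf_sup h.
apply: (le_trans (fatou _ measurableT _ _)).
- by move=> n; apply/measurable_EFinP.
- by move=> n x _; rewrite lee_fin.
rewrite limn_einf_lim; apply: lime_le; first exact: is_cvg_einfs.
apply: nearW => n; apply: le_trans (fnc (n + N)%N _); last exact: leq_addl.
by apply: ereal_inf_lbound; exists n => /=.
Qed.

(** Riesz-Fischer: along a fast subsequence the squared increments, weighted by [4^k], have an
    integrable sum, which forces geometric pointwise convergence almost everywhere. Fatou's lemma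
    then bounds the distance of the whole sequence to that limit. *)
Lemma L2_complete (un : nat -> T -> R) : (forall n, un n \in L2) ->
    (forall e, 0 < e -> exists N, forall n m, (N <= n)%N -> (N <= m)%N ->
      ip (fun x => un n x - un m x) (fun x => un n x - un m x) <= e) ->
  exists2 u, u \in L2 & L2cvg un u.
Proof.
move=> hun cau.
(* The rate [16^-k] beats the weight [4^k] and leaves the summable [4^-k]. *)
have /choice[N HN] : forall k, exists N, forall n m,
    (N <= n)%N -> (N <= m)%N ->
    ip (fun x => un n x - un m x) (fun x => un n x - un m x) <= 16^-1 ^+ k.
  by move=> k; apply: cau; rewrite exprn_gt0// invr_gt0.
(* Being at least [k] sends the indices to infinity; dominating every [N i] with [i <= k] makes
   consecutive terms of the subsequence close. *)
pose p k := maxn k (\max_(i < k.+1) N i)%N.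
have Np i k : (i <= k)%N -> (N i <= p k)%N.
  rewrite -ltnS => ik; apply: leq_trans (leq_maxr _ _).
  exact: (leq_bigmax (Ordinal ik)).
pose w k := un (p k).
pose dd k x := w k.+1 x - w k x.
have hdd k : dd k \in L2 by exact: (L2B (hun (p k.+1)) (hun (p k))).
have ipdd k : ip (dd k) (dd k) <= 16^-1 ^+ k.
  by apply: HN; [apply: Np; exact: ltnW|exact: Np].
pose S x := (\sum_(0 <= k <oo) (4 ^+ k * (dd k x * dd k x))%:E)%E.
have mdd k : measurable_fun setT (fun x => (4 ^+ k * (dd k x * dd k x))%:E).
  apply/measurable_EFinP; apply: measurable_funM => //.
  by apply: measurable_funM; exact: L2_measurable.
have dd0 k x : (0 <= (4 ^+ k * (dd k x * dd k x))%:E)%E.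
  by rewrite lee_fin mulr_ge0 ?exprn_ge0// -expr2 sqr_ge0.
have mS : measurable_fun setT S by apply: ge0_emeasurable_sum.
have S0 x : (0 <= S x)%E by apply: nneseries_ge0 => n _ _; exact: dd0.
have intS : mu.-integrable setT S.
  apply/integrableP; split => //.
  under eq_integral do rewrite gee0_abs//.
  rewrite integral_nneseries//.
  apply: (@le_lt_trans _ _ 2%:E); last exact: ltry.
  apply: lime_le.
    by apply: is_cvg_nneseries => n _ _; exact: integral_ge0.
  apply: nearW => n.
  (* Not the exact geometric sum, but a majorant that survives the induction step. *)
  apply: (@le_trans _ _ (2 - 2 * 4^-1 ^+ n)%:E); last first.
    by rewrite lee_fin gerBl mulr_ge0// exprn_ge0// invr_ge0.
  elim: n => [|n IH]; first by rewrite big_geq// expr0 mulr1 subrr.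
  rewrite big_nat_recr//=.
  have -> : (\int[mu]_x (4 ^+ n * (dd n x * dd n x))%:E =
      (4 ^+ n * ip (dd n) (dd n))%:E)%E.
    rewrite EFinM ipE// -ge0_integralZl//.
    - by apply/measurable_EFinP/measurable_funM; exact: L2_measurable.
    - by move=> x _; rewrite lee_fin -expr2 sqr_ge0.
  apply: (le_trans (leeD IH (lexx _))); rewrite -EFinD lee_fin.
  have : 4 ^+ n * ip (dd n) (dd n) <= 4^-1 ^+ n.
    apply: (le_trans (ler_wpM2l _ (ipdd n))); first exact: exprn_ge0.
    rewrite -exprMn_comm; last exact: mulrC.
    by rewrite (_ : 4 / 16 = 4^-1)//; field.
  have : 0 <= 4^-1 ^+ n :> R by rewrite exprn_ge0// invr_ge0.
  rewrite exprS; set q := _ ^+ n; lra.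
pose E := [set x | S x < +oo]%E.
have mE : measurable E.
  rewrite (_ : E = setT `&` [set x | S x < +oo]%E); last by rewrite setTI.
  exact: emeasurable_fun_infty_o.
(* Cutting off outside [E] makes the subsequence converge at every point, so that its limit is
   measurable. *)
pose v k x := w k x * \1_E x.
have mv k : measurable_fun setT (v k).
  by apply: measurable_funM; [exact: (L2_measurable (hun (p k)))|exact: measurable_indic].
have cv x : cvgn (fun k => v k x).
  rewrite /v indicE; case: (boolP (x \in E)) => [xE|_]; last first.
    by under eq_fun do rewrite mulr0; exact: is_cvg_cst.
  under eq_fun do rewrite mulr1.
  have -> : (fun k => w k x) = (fun k => w 0%N x + series (telescope (w ^~ x)) k).
    by apply/funext => k; rewrite -eq_sum_telescope.
  apply: is_cvgD; first exact: is_cvg_cst.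
  apply: normed_cvg.
  move: xE; rewrite inE /E/= => Soo.
  have {Soo} : S x \is a fin_num by rewrite ge0_fin_numE.
  move=> /fineK SE.
  (* [4^k dd_k^2 <= S] gives the ratio [1/2]; the constant [1 + S] avoids the square root of [S]. *)
  have hd k : `|dd k x| <= (1 + fine (S x)) * 2^-1 ^+ k.
    have h : 4 ^+ k * dd k x ^+ 2 <= fine (S x).
      rewrite -lee_fin SE expr2.
      apply: (le_trans _ (nneseries_lim_ge k.+1 _)) => //.
      rewrite big_nat_recr//= leeDr//.
      by apply: sume_ge0.
    have s0 : 0 <= fine (S x) by rewrite fine_ge0.
    have c0 : 0 <= (1 + fine (S x)) * 2^-1 ^+ k.
      by rewrite mulr_ge0// ?addr_ge0// exprn_ge0// invr_ge0.
    rewrite -(@ler_pXn2r _ 2)// ?nnegrE//.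
    rewrite real_normK ?num_real// exprMn -exprM mulnC exprM.
    rewrite (_ : 2^-1 ^+ 2 = 4^-1); last by field.
    rewrite exprVn -[leLHS](mulrK (_ : 4 ^+ k \is a GRing.unit)); last first.
      by rewrite unitfE expf_neq0.
    rewrite ler_pM2r ?invr_gt0 ?exprn_gt0// mulrC (le_trans h)//.
    by rewrite expr2; nra.
  apply: (@series_le_cvg _ _ (geometric (1 + fine (S x)) 2^-1)) => //.
  - by move=> k /=; exact: normr_ge0.
  - by move=> k; rewrite /geometric/= mulr_ge0// ?addr_ge0 ?fine_ge0.
  - apply: is_cvg_geometric_series.
    by rewrite ger0_norm// ?invr_ge0// invf_lt1// ltr1n.
pose u x := limn (fun k => v k x).
have vu x : (fun k => v k x) @ \oo --> u x by exact: cv.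
have mu_u : measurable_fun setT u.
  by apply: (measurable_fun_cvg mv) => x _; exact: vu.
have aeE : {ae mu, forall x, E x}.
  have := integrable_ae measurableT intS; apply: filterS => x /(_ I).
  by rewrite ge0_fin_numE.
have ub e : 0 < e -> \forall n \near \oo,
    (\int[mu]_x ((un n x - u x) * (un n x - u x))%:E <= e%:E)%E.
  move=> e0; have [N0 HN0] := cau _ e0.
  exists N0 => // n /= Nn.
  apply: (@fatou_le (fun k x => (un n x - v k x) * (un n x - v k x))).
  - move=> k; have h : measurable_fun setT (fun x => un n x - v k x).
      by apply: measurable_funB => //; exact: (L2_measurable (hun _)).
    exact: measurable_funM.
  - by move=> k x; rewrite -expr2 sqr_ge0.
  - move=> x; have h : (fun k => un n x - v k x) @ \oo --> un n x - u x.
      by apply: cvgB => //; exact: cvg_cst.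
    exact: cvgM.
  exists N0 => // k /= Nk.
  have -> : (\int[mu]_x ((un n x - v k x) * (un n x - v k x))%:E =
      \int[mu]_x ((un n x - w k x) * (un n x - w k x))%:E)%E.
    apply: ae_eq_integral => //.
    - have h : measurable_fun setT (fun x => un n x - v k x).
        by apply: measurable_funB => //; exact: (L2_measurable (hun _)).
      by apply/measurable_EFinP; exact: measurable_funM.
    - have h : measurable_fun setT (fun x => un n x - w k x).
        by apply: measurable_funB => //; exact: (L2_measurable (hun _)).
      by apply/measurable_EFinP; exact: measurable_funM.
    - move: aeE; apply: filterS => x xE _.
      by rewrite /v indicE mem_set// mulr1.
  rewrite -ipE; last exact: (L2B (hun n) (hun (p k))).
  rewrite lee_fin.
  by apply: HN0 => //; apply: leq_trans Nk _; exact: leq_maxl.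
have [n _ hn] := ub 1 ltr01.
have hu : u \in L2.
  have hB : (fun x => un n x - u x) \in L2.
    apply: L2P; last by apply: le_lt_trans (hn n (leqnn n)) _; exact: ltry.
    by apply: measurable_funB => //; exact: (L2_measurable (hun _)).
  have := L2B (hun n) hB.
  by under eq_fun do rewrite subKr.
exists u => //.
apply/cvgr0Pnorm_le => e e0; have := ub e e0; apply: filterS => k.
rewrite -ipE; last exact: L2B.
by rewrite lee_fin ger0_norm// ip_ge0.
Qed.

End L2.

(** * Lebesgue measure on the plane *)

Section ProductSigmaFinite.
Context d1 d2 (T1 : measurableType d1) (T2 : measurableType d2) (R : realType).
Variables (m1 : {sigma_finite_measure set T1 -> \bar R})
  (m2 : {sigma_finite_measure set T2 -> \bar R}).

Let m12 : {measure set (T1 * T2)%type -> \bar R} := (m1 \x m2)%E.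

Lemma product_sigma_finite : sigma_finite setT m12.
Proof.
have /sigma_finiteP[F [TF ndF Foo]] := sigma_finiteT m1.
have /sigma_finiteP[G [TG ndG Goo]] := sigma_finiteT m2.
exists (fun n => F n `*` G n).
  rewrite -setXTT TF TG predeqE => -[x y]; split.
    move=> [/= [n _ Fnx] [k _ Gky]]; exists (maxn n k) => //; split.
    - by move: x Fnx; exact/subsetPset/ndF/leq_maxl.
    - by move: y Gky; exact/subsetPset/ndG/leq_maxr.
  by move=> [n _ []/= ? ?]; split; exists n.
move=> k; have [? ?] := Foo k; have [? ?] := Goo k.
split; first exact: measurableX.
rewrite -[m12 _]/((m1 \x m2)%E (F k `*` G k)).
by rewrite product_measure1E// lte_mul_pinfty// ge0_fin_numE.
Qed.

(** Packing the product as a sigma-finite measure allows products of planes, on which the damped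
    energy becomes a double integral. *)
Definition sigma_finite_product :
    {sigma_finite_measure set (T1 * T2)%type -> \bar R} :=
  HB.pack (Measure.sort m12)
    (@Measure_isSigmaFinite.Build _ (T1 * T2)%type R m12 product_sigma_finite).
End ProductSigmaFinite.

Local Notation PL R := (measurableTypeR R * measurableTypeR R)%type.
Local Notation leb := (@lebesgue_measure _).
Local Notation L1 u := (mu2.-integrable setT (EFin \o (u : PL _ -> _))).
Local Notation L2 := (Lfun (@mu2 _) 2%:E).
Local Notation ip := (l2inner mu2).
Local Notation cabsM := ComplexField.Normc.normcM.

Section Plane.
Context {R : realType}.

Definition smu2 : {sigma_finite_measure set (PL R) -> \bar R} :=
  sigma_finite_product leb leb.

(** The image measure, rescaled by [|c|], agrees with Lebesgue measure on half-open intervals, hence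
    everywhere by uniqueness. *)
Lemma ge0_lebesgue_affine (c d : R) (F : R -> \bar R) : c != 0 ->
    measurable_fun setT F -> (forall x, 0 <= F x)%E ->
  (\int[leb]_x F x = `|c|%:E * \int[leb]_x F (c * x + d)%R)%E.
Proof.
move=> c0 mF F0.
pose phi (x : measurableTypeR R) : measurableTypeR R := c * x + d.
have mphi : measurable_fun setT phi.
  by apply: measurable_funD => //; exact: measurable_funM.
pose Phi : {mfun _ >-> _} := HB.pack phi (isMeasurableFun.Build _ _ _ _ _ mphi).
have key A : measurable A ->
    leb A = mscale (NngNum (normr_ge0 c)) (pushforward leb Phi) A.
  apply: lebesgue_measure_unique => //= _ [[a b]] _ <-.
  rewrite /mscale/= /pushforward/=.
  have [cgt0|clt0|] := ltrgtP 0 c; last by move/eqP: c0 => /[swap] <-.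
  - have -> : phi @^-1` [set` `]a, b]] = [set` `](a - d) / c, (b - d) / c]].
      apply/seteqP; split => x/=; rewrite !in_itv/= /phi.
        by rewrite ltr_pdivrMr// ler_pdivlMr// (mulrC x) ltrBlDr lerBrDr.
      by rewrite ltr_pdivrMr// ler_pdivlMr// (mulrC x) ltrBlDr lerBrDr.
    rewrite !lebesgue_measure_itv/= !lte_fin ltr_pM2r ?invr_gt0// ltrD2r.
    case: ifPn => _; last by rewrite mule0.
    by rewrite gtr0_norm// -!EFinB -EFinM; congr EFin; field; rewrite gt_eqF.
  (* A negative factor exchanges the open and the closed end, which does not affect the length. *)
  - have -> : phi @^-1` [set` `]a, b]] = [set` `[(b - d) / c, (a - d) / c[].
      apply/seteqP; split => x/=; rewrite !in_itv/= /phi.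
        by rewrite ltr_ndivlMr// ler_ndivrMr// (mulrC x) ltrBlDr lerBrDr andbC.
      by rewrite ltr_ndivlMr// ler_ndivrMr// (mulrC x) ltrBlDr lerBrDr andbC.
    rewrite !lebesgue_measure_itv/= !lte_fin ltr_nM2r ?invr_lt0// ltrD2r.
    case: ifPn => _; last by rewrite mule0.
    by rewrite ltr0_norm// -!EFinB -EFinM; congr EFin; field; rewrite lt_eqF.
rewrite [LHS](eq_measure_integral
    (mscale (NngNum (normr_ge0 c)) (pushforward leb Phi))); last first.
  by move=> A mA _; exact: key.
rewrite ge0_integral_mscale//.
by rewrite ge0_integral_pushforward//.
Qed.

(** The upper triangular shape covers shears, anisotropic dilations, reflections and translations by
    a single change of variables. *)
Definition affine (c1 s d1 c2 d2 : R) (x : R * R) : R * R :=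
  (c1 * x.1 + s * x.2 + d1, c2 * x.2 + d2).

Lemma measurable_affine c1 s d1 c2 d2 :
  measurable_fun setT (affine c1 s d1 c2 d2 : PL R -> PL R).
Proof.
apply: measurable_fun_pair.
  apply: measurable_funD => //; apply: measurable_funD.
    by apply: measurable_funM => //; exact: measurable_fst.
  by apply: measurable_funM => //; exact: measurable_snd.
apply: measurable_funD => //.
by apply: measurable_funM => //; exact: measurable_snd.
Qed.

(** With the first coordinate integrated innermost, the shear is a mere translation by
    [s * y + d1]. *)
Lemma ge0_integral_affine c1 s d1 c2 d2 (F : PL R -> \bar R) :
    c1 != 0 -> c2 != 0 -> measurable_fun setT F -> (forall x, 0 <= F x)%E ->
  (\int[mu2]_x F x =
   `|c1 * c2|%:E * \int[mu2]_x F (affine c1 s d1 c2 d2 x))%E.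
Proof.
move=> c10 c20 mF F0.
rewrite [LHS](fubini_tonelli2 F)//.
pose Fa : PL R -> \bar R := fun x => F (affine c1 s d1 c2 d2 x).
have mFa : measurable_fun setT Fa.
  by apply: measurableT_comp => //; exact: measurable_affine.
have -> : (\int[mu2]_x Fa x = \int[leb]_y \int[leb]_x Fa (x, y))%E.
  exact: (@fubini_tonelli2 _ _ _ _ R leb leb Fa mFa (fun x => F0 _)).
rewrite /fubini_G.
rewrite (@ge0_lebesgue_affine c2 d2 (fun y => \int[leb]_x F (x, y))%E)//; last 2 first.
- exact: (@measurable_fun_fubini_tonelli_G _ _ _ _ R leb F mF F0).
- by move=> x; exact: integral_ge0.
rewrite normrM mulrC EFinM -muleA; congr (_ * _)%E.
rewrite -ge0_integralZl//; last 2 first.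
- exact: (@measurable_fun_fubini_tonelli_G _ _ _ _ R leb Fa mFa (fun x => F0 _)).
- by move=> x _; apply: integral_ge0 => z _; exact: F0.
apply: eq_integral => y _.
rewrite (@ge0_lebesgue_affine c1 (s * y + d1) (fun x => F (x, c2 * y + d2)))//; last first.
  exact: (measurableT_comp mF (pair2_measurable _)).
by congr (_ * _)%E; apply: eq_integral => x _; rewrite /= /affine/= addrA.
Qed.

Lemma integrable_affine c1 s d1 c2 d2 (F : PL R -> \bar R) :
    c1 != 0 -> c2 != 0 -> mu2.-integrable setT F ->
  mu2.-integrable setT (F \o affine c1 s d1 c2 d2).
Proof.
move=> c10 c20 /integrableP[mF Foo]; apply/integrableP; split.
  by apply: measurableT_comp => //; exact: measurable_affine.
move: Foo; rewrite (ge0_integral_affine s d1 d2 c10 c20)//; last first.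
  exact: measurableT_comp.
have cc0 : (0 < `|c1 * c2|%:E)%E by rewrite lte_fin normr_gt0 mulf_neq0.
move=> Foo; have [//|] := ltP (\int[mu2]_x `|(F \o affine c1 s d1 c2 d2) x|)%E +oo%E.
by rewrite leye_eq => /eqP E; move: Foo; rewrite E gt0_muley// ltxx.
Qed.

Lemma integral_affine c1 s d1 c2 d2 (F : PL R -> \bar R) :
    c1 != 0 -> c2 != 0 -> mu2.-integrable setT F ->
  (\int[mu2]_x F x =
   `|c1 * c2|%:E * \int[mu2]_x F (affine c1 s d1 c2 d2 x))%E.
Proof.
move=> c10 c20 iF; have mF := measurable_int _ iF.
have iFa := integrable_affine s d1 d2 c10 c20 iF.
rewrite integralE [in RHS]integralE muleBr//; last first.
  exact: (integrable_add_def measurableT iFa).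
congr (_ - _)%E.
- rewrite (ge0_integral_affine s d1 d2 c10 c20)//; last exact: measurable_funepos.
  by congr (_ * _)%E; apply: eq_integral => x _; rewrite !funeposE.
- rewrite (ge0_integral_affine s d1 d2 c10 c20)//; last exact: measurable_funeneg.
  by congr (_ * _)%E; apply: eq_integral => x _; rewrite !funenegE.
Qed.

Lemma Rintegral_affine c1 s d1 c2 d2 (F : PL R -> R) :
    c1 != 0 -> c2 != 0 -> mu2.-integrable setT (EFin \o F) ->
  \int[mu2]_x F x = `|c1 * c2| * \int[mu2]_x F (affine c1 s d1 c2 d2 x).
Proof.
move=> c10 c20 iF; have iFa := integrable_affine s d1 d2 c10 c20 iF.
rewrite /Rintegral (integral_affine s d1 d2 c10 c20 iF) fineM//.
exact: integrable_fin_num.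
Qed.
End Plane.

(** * The Poisson kernel *)

Section OneDim.
Context {R : realType}.
Implicit Types (e b x y z w : R) (f g : R -> R).

Lemma is_derive_mul f g x (df dg : R) :
  is_derive x 1 f df -> is_derive x 1 g dg ->
  is_derive x 1 (fun y => f y * g y) (df * g x + f x * dg).
Proof.
move=> hf hg; apply: (is_derive_eq (is_deriveM hf hg)).
by rewrite /GRing.scale/= addrC (mulrC df).
Qed.

Lemma is_derive_add f g x (df dg : R) :
  is_derive x 1 f df -> is_derive x 1 g dg ->
  is_derive x 1 (fun y => f y + g y) (df + dg).
Proof. exact: is_deriveD. Qed.

Lemma is_derive_const x (c : R) : is_derive x 1 (fun=> c) (0 : R).
Proof. exact: is_derive_cst. Qed.

Lemma is_derive_aff f x (c d df : R) : is_derive (c * x + d) 1 f df ->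
  is_derive x 1 (fun y => f (c * y + d)) (c * df).
Proof.
move=> hf.
have hg : is_derive x 1 (fun y => c * y + d) c.
  apply: (is_derive_eq (is_derive_add (is_derive_mul (is_derive_const x c)
    (is_derive_id x 1)) (is_derive_const x d))).
  by rewrite mul0r mulr1 add0r addr0.
have h := @is_derive1_comp R f (fun y => c * y + d) x df c hf hg.
by rewrite mulrC; exact: h.
Qed.

Lemma is_derive_scale f x (c df : R) : is_derive (c * x) 1 f df ->
  is_derive x 1 (fun y => f (c * y)) (c * df).
Proof.
rewrite -[c * x]addr0 => /is_derive_aff.
by under eq_fun do rewrite addr0.
Qed.

Lemma is_derive_scalel f x (c df : R) : is_derive x 1 f df ->
  is_derive x 1 (fun y => c * f y) (c * df).
Proof.
move=> h; apply: (is_derive_eq (is_derive_mul (is_derive_const x c) h)).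
by rewrite mul0r add0r.
Qed.

Lemma is_derive_continuous f g : (forall x, is_derive x 1 f (g x)) ->
  continuous f.
Proof.
move=> h x; apply/differentiable_continuous/derivable1_diffP.
by have [] := h x.
Qed.

(** [f] and [g] are kept apart because an integrand in [|x|] has a differentiable closed form only
    on the half-line; agreement there suffices by evenness. *)
Lemma integral_even_FTC f g F (l : R) : continuous f ->
    (forall x, 0 <= f x) -> (forall x, f (- x) = f x) ->
    (forall x, 0 <= x -> f x = g x) ->
    (forall x, 0 <= x -> is_derive x 1 F (g x)) -> F x @[x --> +oo] --> l ->
  (\int[leb]_x (f x)%:E = (2 * (l - F 0))%:E)%E.
Proof.
move=> cf f0 fN fg dF Fl.
rewrite ge0_symfun_integralT//; last by move=> x /=; rewrite fN.
rewrite EFinM; congr (_ * _)%E.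
rewrite (_ : [set x | _] = `[0, +oo[%classic); last first.
  by apply/seteqP; split => x/=; rewrite in_itv/= andbT.
rewrite (@ge0_continuous_FTC2y _ f F 0 l)//.
- exact: continuous_subspaceT.
- by move=> x /ltW x0; have [] := dF x x0.
- apply: cvg_at_right_filter; apply/differentiable_continuous/derivable1_diffP.
  by have [] := dF 0 (lexx 0).
- move=> x; rewrite in_itv/= andbT => /ltW x0.
  by rewrite derive1E fg//; have [_ ->] := dF x x0.
Qed.

Lemma continuous_expRM (c : R) : continuous (fun x : R => expR (c * x)).
Proof.
move=> x; apply: continuous_comp; last exact: continuous_expR.
by apply: cvgMl_tmp; exact: cvg_id.
Qed.

Lemma continuous_expR_norm (c : R) : continuous (fun x : R => expR (c * `|x|)).
Proof.
move=> x.
exact: (@continuous_comp _ _ _ (Num.norm : R -> R) _ x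
  (@norm_continuous R R x) (@continuous_expRM c `|x|)).
Qed.

Lemma continuous_cosM (c : R) : continuous (fun x : R => cos (c * x)).
Proof.
move=> x; apply: continuous_comp; last exact: continuous_cos.
by apply: cvgMl_tmp; exact: cvg_id.
Qed.

Lemma cvg_expRNM e : 0 < e -> expR (- e * x) @[x --> +oo] --> (0 : R).
Proof.
move=> e0.
have h1 : e * x @[x --> +oo] --> +oo by apply: gt0_cvgMry => //; exact: cvg_id.
have h2 := cvg_comp _ _ h1 (@cvgr_expR R).
by under eq_cvg => x do rewrite mulNr; exact: h2.
Qed.

Lemma integral_expRN_abs e : 0 < e ->
  (\int[leb]_w (expR (- e * `|w|))%:E = (2 / e)%:E)%E.
Proof.
move=> e0.
pose F w := - e^-1 * expR (- e * w).
have -> : 2 / e = 2 * (0 - F 0).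
  by rewrite /F mulr0 expR0 mulr1 sub0r opprK.
apply: (@integral_even_FTC _ (fun w => expR (- e * w))).
- exact: continuous_expR_norm.
- by move=> w; exact: expR_ge0.
- by move=> w; rewrite normrN.
- by move=> w w0; rewrite ger0_norm.
- move=> w _; apply: (is_derive_eq (is_derive_scalel _
    (is_derive_scale (@is_derive_expR R (- e * w))))).
  by rewrite mulrA mulrNN mulVf ?mul1r// gt_eqF.
- by rewrite -[X in _ --> X](mulr0 (- e^-1)); apply: cvgMl_tmp; exact: cvg_expRNM.
Qed.

(** Adding [1] to the cosine keeps the integrand nonnegative, as the improper fundamental theorem
    requires; the integral of the exponential is subtracted afterwards. *)
Lemma integral_expRN_abs_cos1 e b : 0 < e ->
  (\int[leb]_w (expR (- e * `|w|) * (1 + cos (b * w)))%:E =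
   (2 / e + 2 * e / (e ^+ 2 + b ^+ 2))%:E)%E.
Proof.
move=> e0.
have D0 : 0 < e ^+ 2 + b ^+ 2 by rewrite ltr_pwDl ?sqr_ge0// exprn_gt0.
pose F w := - e^-1 * expR (- e * w) + (e ^+ 2 + b ^+ 2)^-1 *
  (expR (- e * w) * (b * sin (b * w) + (- e) * cos (b * w))).
have -> : 2 / e + 2 * e / (e ^+ 2 + b ^+ 2) = 2 * (0 - F 0).
  by rewrite /F !mulr0 expR0 sin0 cos0; field; rewrite !gt_eqF.
apply: (@integral_even_FTC _ (fun w => expR (- e * w) * (1 + cos (b * w)))).
- move=> w; apply: cvgM; first exact: continuous_expR_norm.
  by apply: cvgD; [exact: cvg_cst|exact: continuous_cosM].
- by move=> w; rewrite mulr_ge0 ?expR_ge0//; have := cos_geN1 (b * w); lra.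
- by move=> w; rewrite normrN mulrN cosN.
- by move=> w w0; rewrite ger0_norm.
- move=> w _; apply: (is_derive_eq (is_derive_add
    (is_derive_scalel _ (is_derive_scale (@is_derive_expR R (- e * w))))
    (is_derive_scalel _ (is_derive_mul
      (is_derive_scale (@is_derive_expR R (- e * w)))
      (is_derive_add
        (is_derive_scalel b (is_derive_scale (@is_derive_sin R (b * w))))
        (is_derive_scalel (- e) (is_derive_scale (@is_derive_cos R (b * w))))))))).
  by field; rewrite !gt_eqF.
- rewrite (_ : 0 = - e^-1 * 0 + (e ^+ 2 + b ^+ 2)^-1 * 0 :> R); last by ring.
  apply: cvgD; apply: cvgMl_tmp; first exact: cvg_expRNM.
  apply/norm_cvg0P; apply: (@squeeze_cvgr _ _ _ _ (fun=> 0)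
    (fun w => expR (- e * w) * (`|b| + e))).
  - apply: nearW => w; rewrite normr_ge0/= normrM ger0_norm ?expR_ge0//.
    rewrite ler_wpM2l ?expR_ge0// (le_trans (ler_normD _ _))//.
    rewrite !normrM normrN (gtr0_norm e0) lerD// ler_piMr ?(ltW e0)//.
    + by rewrite ler_norml sin_geN1 sin_le1.
    + by rewrite ler_norml cos_geN1 cos_le1.
  - exact: cvg_cst.
  - rewrite -[X in _ --> X](mul0r (`|b| + e)); apply: cvgMr_tmp.
    exact: cvg_expRNM.
Qed.

(** The Fourier transform of [exp(-e |w|)], which is the Cauchy density of scale [e / (2 pi)]. *)
Definition poisson e z : R := 2 * e / (e ^+ 2 + (2 * pi * z) ^+ 2).

Lemma poisson_ge0 e z : 0 < e -> 0 <= poisson e z.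
Proof.
by move=> e0; rewrite divr_ge0 ?mulr_ge0 ?(ltW e0)// addr_ge0// sqr_ge0.
Qed.

Lemma integrable_expRN_abs e : 0 < e ->
  leb.-integrable setT (fun w => (expR (- e * `|w|))%:E).
Proof.
move=> e0; apply/integrableP; split.
  apply/measurable_EFinP; apply: continuous_measurable_fun.
  exact: continuous_expR_norm.
under eq_integral do rewrite gee0_abs ?lee_fin ?expR_ge0//.
by rewrite integral_expRN_abs// ltry.
Qed.

Lemma integrable_expRN_abs_cos e b : 0 < e ->
  leb.-integrable setT (fun w => (expR (- e * `|w|) * cos (b * w))%:E).
Proof.
move=> e0; apply: le_integrable (integrable_expRN_abs e0) => //.
  apply/measurable_EFinP; apply: continuous_measurable_fun => w.
  by apply: cvgM; [exact: continuous_expR_norm|exact: continuous_cosM].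
move=> w _; rewrite /= lee_fin normrM ler_piMr//.
by rewrite ler_norml cos_geN1 cos_le1.
Qed.

Lemma integral_expRN_abs_cos e z : 0 < e ->
  (\int[leb]_w (expR (- e * `|w|) * cos (2 * pi * z * w))%:E =
   (poisson e z)%:E)%E.
Proof.
move=> e0.
have := integrable_fin_num measurableT (integrable_expRN_abs_cos (2 * pi * z) e0).
have := integral_expRN_abs_cos1 (2 * pi * z) e0.
have -> : (\int[leb]_w (expR (- e * `|w|) * (1 + cos (2 * pi * z * w)))%:E =
   \int[leb]_w ((expR (- e * `|w|))%:E +
     (expR (- e * `|w|) * cos (2 * pi * z * w))%:E))%E.
  by apply: eq_integral => w _; rewrite mulrDr mulr1 EFinD.
rewrite integralD//; last 2 first.
- exact: integrable_expRN_abs.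
- exact: integrable_expRN_abs_cos.
rewrite integral_expRN_abs// EFinD.
case: (\int[leb]_w _)%E => [r|//|//] /eqP.
by rewrite -!EFinD eqe => /eqP/addrI -> _.
Qed.

Lemma is_derive_poisson e z : 0 < e ->
  is_derive z 1 (fun z => pi^-1 * atan (2 * pi / e * z)) (poisson e z).
Proof.
move=> e0; apply: (is_derive_eq (is_derive_scalel _
  (is_derive_scale (@is_derive1_atan R (2 * pi / e * z))))).
rewrite /poisson; have := pi_gt0 R; move: (@pi R) => p p0.
have h : 0 < e ^+ 2 + (2 * p * z) ^+ 2 by rewrite ltr_pwDl ?sqr_ge0// exprn_gt0.
have -> : 1 + (2 * p / e * z) ^+ 2 = (e ^+ 2 + (2 * p * z) ^+ 2) / e ^+ 2.
  by field; rewrite gt_eqF.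
move: h; set D := e ^+ 2 + _ => h.
by field; rewrite !gt_eqF.
Qed.

Lemma continuous_poisson e : 0 < e -> continuous (poisson e).
Proof.
move=> e0 z; apply: cvgM; first exact: cvg_cst.
apply: cvgV; first by rewrite gt_eqF// ltr_pwDl ?sqr_ge0// exprn_gt0.
apply: cvgD; first exact: cvg_cst.
by apply: cvgM; apply: cvgMl_tmp; exact: cvg_id.
Qed.

Lemma integral_poisson e : 0 < e -> (\int[leb]_z (poisson e z)%:E = 1)%E.
Proof.
move=> e0; have pi0 := pi_gt0 R.
pose F z := pi^-1 * atan (2 * pi / e * z) : R.
have -> : 1%E = (2 * (2^-1 - F 0))%:E :> \bar R.
  by rewrite /F mulr0 atan0 mulr0 subr0 divff.
apply: (@integral_even_FTC _ (poisson e)) => //.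
- exact: continuous_poisson.
- by move=> z; exact: poisson_ge0.
- by move=> z; rewrite /poisson mulrN sqrrN.
- by move=> z _; exact: is_derive_poisson.
- rewrite (_ : 2^-1 = pi^-1 * (pi / 2)); last by rewrite mulKf// gt_eqF.
  apply: cvgMl_tmp.
  have h1 : 2 * pi / e * x @[x --> +oo] --> +oo.
    by apply: gt0_cvgMry; [rewrite divr_gt0// mulr_gt0|exact: cvg_id].
  exact: (cvg_comp _ _ h1 (@cvgy_atan R)).
Qed.

Lemma integral_poissonB e x : 0 < e ->
  (\int[leb]_y (poisson e (x - y))%:E = 1)%E.
Proof.
move=> e0; rewrite -(integral_poisson e0).
rewrite (@ge0_lebesgue_affine R (-1) x (fun z => (poisson e z)%:E)).
- by rewrite normrN1 mul1e; apply: eq_integral => y _; rewrite mulN1r addrC.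
- by rewrite oppr_eq0 oner_eq0.
- apply/measurable_EFinP; apply: continuous_measurable_fun.
  exact: continuous_poisson.
- by move=> z; rewrite lee_fin poisson_ge0.
Qed.

Lemma integral_poisson_itv e x a b : 0 < e -> a < b ->
  (\int[leb]_(y in `[a, b]) (poisson e (x - y))%:E =
   (pi^-1 * (atan (2 * pi / e * (x - a)) - atan (2 * pi / e * (x - b))))%:E)%E.
Proof.
move=> e0 ab.
pose F y := - 1 * (pi^-1 * atan (2 * pi / e * (- 1 * y + x))) : R.
have dF y : is_derive y 1 F (poisson e (x - y)).
  apply: (is_derive_eq (is_derive_scalel _ (is_derive_aff
    (is_derive_poisson (- 1 * y + x) e0)))).
  by rewrite mulrA mulrNN !mul1r mulN1r addrC.
rewrite (@continuous_FTC2 _ _ F)//.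
- by rewrite -EFinB; congr EFin; rewrite /F !mulN1r !(addrC _ x); ring.
- apply: continuous_subspaceT => y.
  apply: (@continuous_comp _ _ _ (fun y => x - y) (poisson e)).
    by apply: cvgB; [exact: cvg_cst|exact: cvg_id].
  exact: continuous_poisson.
- split.
  + by move=> y _; have [] := dF y.
  + by apply: cvg_at_right_filter; exact: (is_derive_continuous dF).
  + by apply: cvg_at_left_filter; exact: (is_derive_continuous dF).
- by move=> y _; rewrite derive1E; have [_ ->] := dF y.
Qed.

End OneDim.

(** * Product measures and Fubini for real-valued integrals *)

Section Tensor.
Context d1 d2 (T1 : measurableType d1) (T2 : measurableType d2) (R : realType).
Variables (m1 : {sigma_finite_measure set T1 -> \bar R})
  (m2 : {sigma_finite_measure set T2 -> \bar R}).

Lemma measurable_tensor (f : T1 -> R) (g : T2 -> R) :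
  measurable_fun setT f -> measurable_fun setT g ->
  measurable_fun setT (fun z : T1 * T2 => f z.1 * g z.2).
Proof.
move=> mf mg; apply: measurable_funM.
  by apply: (measurableT_comp mf); exact: measurable_fst.
by apply: (measurableT_comp mg); exact: measurable_snd.
Qed.

Lemma integrable_tensor (f : T1 -> R) (g : T2 -> R) :
    m1.-integrable setT (EFin \o f) -> m2.-integrable setT (EFin \o g) ->
  (m1 \x m2)%E.-integrable setT (EFin \o (fun z => f z.1 * g z.2)).
Proof.
move=> /[dup] f1 /integrableP[mf foo] /[dup] g1 /integrableP[mg goo].
have mf0 : measurable_fun setT f by apply/measurable_EFinP.
have mg0 : measurable_fun setT g by apply/measurable_EFinP.
have mfg : measurable_fun setT (fun z : T1 * T2 => (f z.1 * g z.2)%:E).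
  by apply/measurable_EFinP; exact: measurable_tensor.
apply/(integrable12ltyP _ _ mfg).
under eq_integral => x _.
  under eq_integral do rewrite /= normrM EFinM.
  rewrite ge0_integralZl//; last first.
    by apply/measurable_EFinP; exact: measurableT_comp.
  over.
rewrite ge0_integralZr//.
- apply: lte_mul_pinfty; [exact: integral_ge0| |exact: goo].
  by rewrite ge0_fin_numE; [exact: foo|exact: integral_ge0].
- by apply/measurable_EFinP; exact: measurableT_comp.
- by rewrite integral_ge0.
Qed.

(** The inner integral is finite only almost everywhere; elsewhere [fine] substitutes a default
    value, which the outer integral does not see. *)
Lemma Rintegral_fubini (f : T1 * T2 -> R) :
    (m1 \x m2)%E.-integrable setT (EFin \o f) ->
  \int[(m1 \x m2)%E]_z f z = \int[m1]_x \int[m2]_y f (x, y).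
Proof.
move=> hf; rewrite /Rintegral -(integral12_prod_meas1 hf).
congr fine; apply: ae_eq_integral => //.
- exact: measurable_int (integrable_fubini_F hf).
- have := measurable_int _ (integrable_fubini_F hf).
  move=> h; apply/measurable_EFinP.
  by apply: measurableT_comp h.
- have := ae_integrable1 hf; apply: filterS => x hx _ /=.
  by rewrite fineK//; apply: integrable_fin_num.
Qed.

Lemma Rintegral_fubini_swap (f : T1 * T2 -> R) :
    (m1 \x m2)%E.-integrable setT (EFin \o f) ->
  \int[m1]_x \int[m2]_y f (x, y) = \int[m2]_y \int[m1]_x f (x, y).
Proof.
move=> hf; rewrite -Rintegral_fubini//.
rewrite /Rintegral -(integral21_prod_meas1 hf).
congr fine; apply: ae_eq_integral => //.
- exact: (measurable_fubini_G hf).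
- apply/measurable_EFinP.
  by apply: measurableT_comp (measurable_fubini_G hf).
- have := ae_integrable2 hf; apply: filterS => x hx _ /=.
  by rewrite fineK//; apply: integrable_fin_num.
Qed.

Lemma Rintegral_tensor (f : T1 -> R) (g : T2 -> R) :
    m1.-integrable setT (EFin \o f) -> m2.-integrable setT (EFin \o g) ->
  \int[(m1 \x m2)%E]_z (f z.1 * g z.2) = \int[m1]_x f x * \int[m2]_y g y.
Proof.
move=> hf hg; rewrite Rintegral_fubini; last exact: integrable_tensor.
rewrite -RintegralZr//; apply: eq_Rintegral => x _.
by rewrite -RintegralZl.
Qed.

Lemma measurable_integral2 (f : T1 * T2 -> R) : measurable_fun setT f ->
  measurable_fun setT (fun x => \int[m2]_y f (x, y)).
Proof.
move=> mf; rewrite /Rintegral; apply: measurableT_comp => //.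
under eq_fun do rewrite integralE.
have mf' : measurable_fun setT (EFin \o f) by exact/measurable_EFinP.
apply: emeasurable_funB.
- have h := @measurable_fun_fubini_tonelli_F _ _ _ _ R m2 ((EFin \o f)^\+)%E
    (measurable_funepos mf') (@funepos_ge0 _ _ _).
  rewrite (_ : (fun _ => _) = fubini_F m2 ((EFin \o f)^\+)%E); first exact: h.
  by apply/funext => x; apply: eq_integral => y _; rewrite !funeposE.
- have h := @measurable_fun_fubini_tonelli_F _ _ _ _ R m2 ((EFin \o f)^\-)%E
    (measurable_funeneg mf') (@funeneg_ge0 _ _ _).
  rewrite (_ : (fun _ => _) = fubini_F m2 ((EFin \o f)^\-)%E); first exact: h.
  by apply/funext => x; apply: eq_integral => y _; rewrite !funenegE.
Qed.
End Tensor.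

Lemma integrable_mul_bounded d (T : measurableType d) (R : realType)
    (mu : {measure set T -> \bar R}) (u v : T -> R) (c : R) :
    mu.-integrable setT (EFin \o u) -> measurable_fun setT v ->
    (forall x, `|v x| <= c) ->
  mu.-integrable setT (EFin \o (fun x => u x * v x)).
Proof.
move=> hu mv vc.
have hcu : mu.-integrable setT (EFin \o (fun x => c * u x)).
  have := integrableZl measurableT c hu; apply: eq_integrable => //.
have mu0 : measurable_fun setT u.
  by apply/measurable_EFinP; exact: measurable_int hu.
apply: le_integrable hcu => //.
  by apply/measurable_EFinP; exact: measurable_funM.
move=> x _; rewrite /= lee_fin !normrM mulrC ler_wpM2r//.
by rewrite (le_trans (vc x))// ler_norm.
Qed.

(** * Exponential damping in the plane *)

Section Damping.
Context {R : realType}.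
Local Notation mm := (@smu2 R \x @smu2 R)%E.
Implicit Types (e : R) (x y z w : PL R) (u v : PL R -> R).

(** The [l^1] norm in the exponent makes the damping a product over the coordinates, and its
    transform a product of one-dimensional kernels. *)
Definition damp e w : R := expR (- e * `|w.1|) * expR (- e * `|w.2|).

Lemma damp_ge0 e w : 0 <= damp e w.
Proof. by rewrite mulr_ge0// expR_ge0. Qed.

Lemma damp_le1 e w : 0 < e -> damp e w <= 1.
Proof.
move=> e0; rewrite -[leRHS]mulr1 ler_pM ?expR_ge0// -expR0 ler_expR.
  by rewrite mulNr oppr_le0 mulr_ge0// ltW.
by rewrite mulNr oppr_le0 mulr_ge0// ltW.
Qed.

Lemma measurable_damp e : measurable_fun setT (damp e).
Proof.
have mE := continuous_measurable_fun (@continuous_expR_norm R (- e)).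
exact: (@measurable_tensor _ _ _ _ R _ _ mE mE).
Qed.

Lemma integrable_damp e : 0 < e -> mu2.-integrable setT (EFin \o damp e).
Proof.
move=> e0; have h := integrable_expRN_abs e0.
exact: (@integrable_tensor _ _ _ _ R leb leb _ _ h h).
Qed.

Lemma measurable_dotl x : measurable_fun setT (fun w => dot x w).
Proof.
by apply: measurable_funD; apply: measurable_funM => //.
Qed.

Lemma measurable_dot : measurable_fun setT (fun z : PL R * PL R => dot z.1 z.2).
Proof.
apply: measurable_funD; apply: measurable_funM => //.
- by apply: measurableT_comp measurable_fst; exact: measurable_fst.
- by apply: measurableT_comp measurable_snd; exact: measurable_fst.
- by apply: measurableT_comp measurable_fst; exact: measurable_snd.
- by apply: measurableT_comp measurable_snd; exact: measurable_snd.
Qed.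

Lemma measurable_cos : measurable_fun setT (@cos R).
Proof. by apply: continuous_measurable_fun; exact: continuous_cos. Qed.

Lemma measurable_sin : measurable_fun setT (@sin R).
Proof. by apply: continuous_measurable_fun; exact: continuous_sin. Qed.

Lemma norm_cos_le1 (t : R) : `|cos t| <= 1.
Proof. by rewrite ler_norml cos_geN1 cos_le1. Qed.

Lemma norm_sin_le1 (t : R) : `|sin t| <= 1.
Proof. by rewrite ler_norml sin_geN1 sin_le1. Qed.

Lemma measurable_cos_dot z :
  measurable_fun setT (fun w => cos (2 * pi * dot z w)).
Proof.
apply: (measurableT_comp measurable_cos); apply: measurable_funM => //.
exact: measurable_dotl.
Qed.

Definition poisson2 e z : R := poisson e z.1 * poisson e z.2.

(* The reflection [w.2 |-> - w.2] removes the product of sines from the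
   expansion of the cosine of the sum. *)
Lemma integral_damp_cos e z : 0 < e ->
  \int[mu2]_w (damp e w * cos (2 * pi * dot z w)) = poisson2 e z.
Proof.
move=> e0.
have hc w : mu2.-integrable setT
    (EFin \o (fun x => damp e x * cos (2 * pi * dot w x))).
  apply: (@integrable_mul_bounded _ _ _ _ _ _ 1); first exact: integrable_damp.
    exact: measurable_cos_dot.
  by move=> x; exact: norm_cos_le1.
have n1 : -1 != 0 :> R by rewrite oppr_eq0 oner_eq0.
have E1 : \int[mu2]_w (damp e w * cos (2 * pi * dot z w)) =
    \int[mu2]_w (damp e w * cos (2 * pi * dot (z.1, - z.2) w)).
  rewrite (Rintegral_affine 0 0 0 (oner_neq0 R) n1 (hc z)).
  rewrite mul1r normrN1 mul1r; apply: eq_Rintegral => w _.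
  by rewrite /affine /damp /dot/= !mul1r mul0r !addr0 mulN1r normrN !mulNr !mulrN.
have hA (t : R) : leb.-integrable setT
  (EFin \o (fun r : R => expR (- e * `|r|) * cos (2 * pi * t * r))).
  exact: integrable_expRN_abs_cos.
have := @Rintegral_tensor _ _ _ _ R leb leb _ _ (hA z.1) (hA z.2).
have pE (t : R) :
    \int[leb]_r (expR (- e * `|r|) * cos (2 * pi * t * r)) = poisson e t.
  by rewrite /Rintegral integral_expRN_abs_cos.
rewrite !pE /poisson2 => <-.
suff : 2 * \int[mu2]_w (damp e w * cos (2 * pi * dot z w)) =
    2 * \int[mu2]_w (expR (- e * `|w.1|) * cos (2 * pi * z.1 * w.1) *
     (expR (- e * `|w.2|) * cos (2 * pi * z.2 * w.2))).
  by move=> /(mulfI _) ->.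
rewrite mulr_natl mulr2n {2}E1 -RintegralD//.
rewrite -RintegralZl//; last first.
  exact: (@integrable_tensor _ _ _ _ R leb leb _ _ (hA z.1) (hA z.2)).
apply: eq_Rintegral => w _; rewrite /damp /dot/=.
rewrite !mulrDr !mulNr !mulrN cosB cosD !mulrA; ring.
Qed.

Lemma measurable_poisson2B e : 0 < e ->
  measurable_fun setT (fun z : PL R * PL R =>
    poisson2 e (z.1.1 - z.2.1, z.1.2 - z.2.2)).
Proof.
move=> e0; have mp : measurable_fun setT (poisson e).
  by apply: continuous_measurable_fun; exact: continuous_poisson.
apply: measurable_funM; apply: (measurableT_comp mp); apply: measurable_funB.
- by apply: measurableT_comp measurable_fst; exact: measurable_fst.
- by apply: measurableT_comp measurable_snd; exact: measurable_fst.
- by apply: measurableT_comp measurable_fst; exact: measurable_snd.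
- by apply: measurableT_comp measurable_snd; exact: measurable_snd.
Qed.

Lemma poisson2_ge0 e z : 0 < e -> 0 <= poisson2 e z.
Proof. by move=> e0; rewrite mulr_ge0// poisson_ge0. Qed.

Lemma integral_poisson2B e x : 0 < e ->
  (\int[mu2]_y (poisson2 e (x.1 - y.1, x.2 - y.2))%:E = 1)%E.
Proof.
move=> e0.
have mp (t : R) : measurable_fun setT (fun r : measurableTypeR R => poisson e (t - r)).
  apply: continuous_measurable_fun => r.
  apply: (@continuous_comp _ _ _ (fun r : R => t - r) (poisson e)).
    by apply: cvgB; [exact: cvg_cst|exact: cvg_id].
  exact: continuous_poisson.
rewrite (@fubini_tonelli1 _ _ _ _ R leb leb (fun y => (poisson2 e (x.1 - y.1, x.2 - y.2))%:E)).
- rewrite -(integral_poissonB x.1 e0); apply: eq_integral => r _.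
  rewrite /fubini_F/= /poisson2/=; under eq_integral do rewrite EFinM.
  rewrite ge0_integralZl//; first by rewrite integral_poissonB// mule1.
  - by apply/measurable_EFinP; exact: mp.
  - by move=> t _; rewrite lee_fin poisson_ge0.
  - by rewrite lee_fin poisson_ge0.
- apply/measurable_EFinP.
  exact: (@measurable_tensor _ _ _ _ R _ _ (mp x.1) (mp x.2)).
- by move=> y; rewrite lee_fin poisson2_ge0.
Qed.
End Damping.

(** * The Plancherel theorem *)

Section Contraction.
Context {R : realType}.
Local Notation mm := (sigma_finite_product (@smu2 R) (@smu2 R)).
Implicit Types (e : R) (x y w : PL R) (z : PL R * PL R) (u v : PL R -> R).

Lemma dotC x w : dot x w = dot w x.
Proof. by rewrite /dot (mulrC x.1) (mulrC x.2). Qed.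

Lemma L1_measurable u : L1 u -> measurable_fun setT u.
Proof. by move=> hu; apply/measurable_EFinP; exact: measurable_int hu. Qed.

Lemma L1D u v : L1 u -> L1 v -> L1 (fun x => u x + v x).
Proof. by move=> hu hv; have := integrableD measurableT hu hv; apply: eq_integrable. Qed.

Lemma L1Z c u : L1 u -> L1 (fun x => c * u x).
Proof. by move=> hu; have := integrableZl measurableT c hu; apply: eq_integrable. Qed.

Lemma L1B u v : L1 u -> L1 v -> L1 (fun x => u x - v x).
Proof. by move=> hu hv; have := integrableB measurableT hu hv; apply: eq_integrable. Qed.

Section Kernel.
Variable k : R -> R.
Hypotheses (mk : measurable_fun setT k) (k1 : forall t, `|k t| <= 1).
(** An abstract bounded kernel [k] lets the cosine and the sine transform share measurability,
    bounds and linearity. *)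
Definition kernelT u w : R := \int[mu2]_x (u x * k (2 * pi * dot x w)).

Lemma kernelT_int u w : L1 u -> L1 (fun x => u x * k (2 * pi * dot x w)).
Proof.
move=> hu; apply: (integrable_mul_bounded (c := 1)) => //.
apply: (measurableT_comp mk); apply: measurable_funM => //.
by under eq_fun do rewrite dotC; exact: measurable_dotl.
Qed.

Lemma kernelT_measurable u : measurable_fun setT u -> measurable_fun setT (kernelT u).
Proof.
move=> mu_; apply: (@measurable_integral2 _ _ _ _ R smu2
  (fun z => u z.2 * k (2 * pi * dot z.2 z.1))).
apply: measurable_funM; first by apply: (measurableT_comp mu_); exact: measurable_snd.
apply: (measurableT_comp mk); apply: measurable_funM => //.
by under eq_fun do rewrite dotC; exact: measurable_dot.
Qed.

Lemma kernelT_bound u w : L1 u -> `|kernelT u w| <= \int[mu2]_x `|u x|.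
Proof.
move=> hu; have hc := kernelT_int w hu.
apply: (le_trans (le_normr_Rintegral _ hc)) => //; apply: le_Rintegral => //.
- exact: integrable_norm hc.
- exact: integrable_norm hu.
- by move=> x _; rewrite normrM ler_piMr.
Qed.

Lemma kernelTD u v : L1 u -> L1 v -> kernelT (fun x => u x + v x) = (fun w => kernelT u w + kernelT v w).
Proof.
move=> hu hv; apply/funext => w; rewrite -RintegralD//; try exact: kernelT_int.
by apply: eq_Rintegral => x _; rewrite mulrDl.
Qed.

Lemma kernelTB u v : L1 u -> L1 v -> kernelT (fun x => u x - v x) = (fun w => kernelT u w - kernelT v w).
Proof.
move=> hu hv; apply/funext => w; rewrite -RintegralB//; try exact: kernelT_int.
by apply: eq_Rintegral => x _; rewrite mulrBl.
Qed.

Lemma kernelTZ c u : L1 u -> kernelT (fun x => c * u x) = (fun w => c * kernelT u w).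
Proof.
move=> hu; apply/funext => w; rewrite -RintegralZl//; last exact: kernelT_int.
by apply: eq_Rintegral => x _; rewrite mulrA.
Qed.

End Kernel.

(** For real [u] the transform is [cosT u - i sinT u]; the whole Plancherel argument runs on these
    two real functions. *)
Definition cosT u w : R := \int[mu2]_x (u x * cos (2 * pi * dot x w)).
Definition sinT u w : R := \int[mu2]_x (u x * sin (2 * pi * dot x w)).

Lemma integrable_cosT u w : L1 u -> L1 (fun x => u x * cos (2 * pi * dot x w)).
Proof. exact: (kernelT_int (@measurable_cos R) (@norm_cos_le1 R)). Qed.

Lemma measurable_cosT u : measurable_fun setT u -> measurable_fun setT (cosT u).
Proof. exact: (kernelT_measurable (@measurable_cos R)). Qed.

Lemma cosT_bound u w : L1 u -> `|cosT u w| <= \int[mu2]_x `|u x|.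
Proof. exact: (kernelT_bound (@measurable_cos R) (@norm_cos_le1 R)). Qed.

Lemma cosTD u v : L1 u -> L1 v ->
  cosT (fun x => u x + v x) = (fun w => cosT u w + cosT v w).
Proof. exact: (kernelTD (@measurable_cos R) (@norm_cos_le1 R)). Qed.

Lemma cosTB u v : L1 u -> L1 v ->
  cosT (fun x => u x - v x) = (fun w => cosT u w - cosT v w).
Proof. exact: (kernelTB (@measurable_cos R) (@norm_cos_le1 R)). Qed.

Lemma cosTZ c u : L1 u -> cosT (fun x => c * u x) = (fun w => c * cosT u w).
Proof. exact: (kernelTZ (@measurable_cos R) (@norm_cos_le1 R)). Qed.

Lemma integrable_sinT u w : L1 u -> L1 (fun x => u x * sin (2 * pi * dot x w)).
Proof. exact: (kernelT_int (@measurable_sin R) (@norm_sin_le1 R)). Qed.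

Lemma measurable_sinT u : measurable_fun setT u -> measurable_fun setT (sinT u).
Proof. exact: (kernelT_measurable (@measurable_sin R)). Qed.

Lemma sinT_bound u w : L1 u -> `|sinT u w| <= \int[mu2]_x `|u x|.
Proof. exact: (kernelT_bound (@measurable_sin R) (@norm_sin_le1 R)). Qed.

Lemma sinTD u v : L1 u -> L1 v ->
  sinT (fun x => u x + v x) = (fun w => sinT u w + sinT v w).
Proof. exact: (kernelTD (@measurable_sin R) (@norm_sin_le1 R)). Qed.

Lemma sinTB u v : L1 u -> L1 v ->
  sinT (fun x => u x - v x) = (fun w => sinT u w - sinT v w).
Proof. exact: (kernelTB (@measurable_sin R) (@norm_sin_le1 R)). Qed.

Lemma sinTZ c u : L1 u -> sinT (fun x => c * u x) = (fun w => c * sinT u w).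
Proof. exact: (kernelTZ (@measurable_sin R) (@norm_sin_le1 R)). Qed.

Definition sub2 z : R * R := (z.1.1 - z.2.1, z.1.2 - z.2.2).

(** A squared integral is an integral over pairs, and [cos a cos b + sin a sin b = cos (a - b)]. *)
Lemma sqr_cosT_sinT u w : L1 u -> cosT u w ^+ 2 + sinT u w ^+ 2 =
  \int[mm]_z (u z.1 * u z.2 * cos (2 * pi * dot (sub2 z) w)).
Proof.
move=> hu; have hc := integrable_cosT w hu; have hs := integrable_sinT w hu.
have := @Rintegral_tensor _ _ _ _ R smu2 smu2 _ _ hc hc.
have := @Rintegral_tensor _ _ _ _ R smu2 smu2 _ _ hs hs.
rewrite !expr2 /cosT /sinT => <- <-; rewrite -RintegralD//; last 2 first.
- exact: (@integrable_tensor _ _ _ _ R smu2 smu2 _ _ hc hc).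
- exact: (@integrable_tensor _ _ _ _ R smu2 smu2 _ _ hs hs).
apply: eq_Rintegral => z _.
rewrite (_ : 2 * pi * dot (sub2 z) w = 2 * pi * dot z.1 w - 2 * pi * dot z.2 w).
  by rewrite cosB; ring.
by rewrite /dot/=; move: (@pi R) => p; ring.
Qed.

Lemma measurable_cos_sub2 : measurable_fun setT
  (fun t : PL R * (PL R * PL R) => cos (2 * pi * dot (sub2 t.2) t.1)).
Proof.
apply: (measurableT_comp (@measurable_cos R)); apply: measurable_funM => //.
have -> : (fun t : PL R * (PL R * PL R) => dot (sub2 t.2) t.1) =
    (fun t => dot t.2.1 t.1 - dot t.2.2 t.1).
  by apply/funext => t; rewrite /dot/=; ring.
have m1 : measurable_fun setT (fun t : PL R * (PL R * PL R) => (t.2.1, t.1)).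
  apply: measurable_fun_pair; last exact: measurable_fst.
  by apply: (measurableT_comp measurable_fst); exact: measurable_snd.
have m2 : measurable_fun setT (fun t : PL R * (PL R * PL R) => (t.2.2, t.1)).
  apply: measurable_fun_pair; last exact: measurable_fst.
  by apply: (measurableT_comp measurable_snd); exact: measurable_snd.
apply: measurable_funB.
- exact: (measurableT_comp (@measurable_dot R) m1).
- exact: (measurableT_comp (@measurable_dot R) m2).
Qed.

(** The damping makes the integrand integrable on the product of the frequency plane with pairs of
    points, so the frequency may be integrated first, which produces the Poisson kernel. *)
Lemma damped_energy e u : 0 < e -> L1 u ->
  \int[mu2]_w (damp e w * (cosT u w ^+ 2 + sinT u w ^+ 2)) =
  \int[mm]_z (u z.1 * u z.2 * poisson2 e (sub2 z)).
Proof.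
move=> e0 hu.
have huu := @integrable_tensor _ _ _ _ R smu2 smu2 _ _ hu hu.
have hd := integrable_damp e0.
have hduu := @integrable_tensor _ _ _ _ R smu2 mm _ _ hd huu.
have hf := integrable_mul_bounded hduu measurable_cos_sub2
  (fun t => norm_cos_le1 _).
transitivity (\int[mu2]_w \int[mm]_z
    (damp e w * (u z.1 * u z.2) * cos (2 * pi * dot (sub2 z) w))).
  apply: eq_Rintegral => w _; rewrite sqr_cosT_sinT// -RintegralZl//.
    by apply: eq_Rintegral => z _; rewrite mulrA.
  apply: (integrable_mul_bounded huu (c := 1)); last by move=> z; exact: norm_cos_le1.
  exact: (measurableT_comp measurable_cos_sub2 (pair1_measurable w)).
rewrite (@Rintegral_fubini_swap _ _ _ _ R smu2 mm _ hf).
apply: eq_Rintegral => z _ /=.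
rewrite -(integral_damp_cos (sub2 z) e0) -RintegralZl//.
  by apply: eq_Rintegral => w _; rewrite mulrAC mulrC.
apply: (integrable_mul_bounded hd (c := 1)); last by move=> w; exact: norm_cos_le1.
exact: measurable_cos_dot.
Qed.

(** Schur's test: [2 |u(x) u(y)| <= u(x)^2 + u(y)^2], and the kernel has mass one in each of its two
    variables. *)
Lemma damped_energy_le e u : 0 < e -> L1 u -> u \in L2 ->
  mm.-integrable setT (EFin \o (fun z => u z.1 * u z.2 * poisson2 e (sub2 z))) /\
  \int[mm]_z (u z.1 * u z.2 * poisson2 e (sub2 z)) <= ip u u.
Proof.
move=> e0 hu hu2.
have mu_ := L1_measurable hu.
have mp := measurable_poisson2B e0.
have m1 : measurable_fun setT (fun z => u z.1 * u z.1 * poisson2 e (sub2 z)).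
  apply: measurable_funM => //.
  by apply: measurable_funM; apply: (measurableT_comp mu_); exact: measurable_fst.
have m2 : measurable_fun setT (fun z => u z.2 * u z.2 * poisson2 e (sub2 z)).
  apply: measurable_funM => //.
  by apply: measurable_funM; apply: (measurableT_comp mu_); exact: measurable_snd.
have u0 x : 0 <= u x * u x by rewrite -expr2 sqr_ge0.
have m1E : (\int[mm]_z (u z.1 * u z.1 * poisson2 e (sub2 z))%:E = (ip u u)%:E)%E.
  rewrite ipE// (@fubini_tonelli1 _ _ _ _ R smu2 smu2).
  - apply: eq_integral => x _; rewrite /fubini_F/=.
    under eq_integral do rewrite EFinM.
    rewrite ge0_integralZl//.
    + by rewrite (integral_poisson2B x e0) mule1.
    + apply/measurable_EFinP.
      exact: (measurableT_comp mp (pair1_measurable x)).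
    + by move=> y _; rewrite lee_fin poisson2_ge0.
    + by rewrite lee_fin.
  - exact/measurable_EFinP.
  - by move=> z; rewrite lee_fin mulr_ge0// poisson2_ge0.
have m2E : (\int[mm]_z (u z.2 * u z.2 * poisson2 e (sub2 z))%:E = (ip u u)%:E)%E.
  rewrite ipE// (@fubini_tonelli2 _ _ _ _ R smu2 smu2).
  - apply: eq_integral => y _; rewrite /fubini_G/=.
    under eq_integral do rewrite EFinM.
    rewrite ge0_integralZl//.
    (* The kernel is even in each coordinate, so it has mass one in [x] as well as in [y]. *)
    + rewrite -[RHS]mule1 -(integral_poisson2B y e0); congr (_ * _)%E.
      apply: eq_integral => x _; congr EFin.
      by rewrite /poisson2 /poisson/= -(sqrrN (2 * pi * (_ - x.1)))
        -(sqrrN (2 * pi * (_ - x.2))) -!mulrN !opprB.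
    + apply/measurable_EFinP.
      exact: (measurableT_comp mp (pair2_measurable y)).
    + by move=> x _; rewrite lee_fin poisson2_ge0.
    + by rewrite lee_fin.
  - exact/measurable_EFinP.
  - by move=> z; rewrite lee_fin mulr_ge0// poisson2_ge0.
have i1 : mm.-integrable setT (EFin \o (fun z => u z.1 * u z.1 * poisson2 e (sub2 z))).
  apply/integrableP; split; first exact/measurable_EFinP.
  apply: (@le_lt_trans _ _ (ip u u)%:E); last exact: ltry.
  rewrite -m1E le_eqVlt; apply/orP; left; apply/eqP; apply: eq_integral => z _.
  by rewrite gee0_abs//= lee_fin mulr_ge0// poisson2_ge0.
have i2 : mm.-integrable setT (EFin \o (fun z => u z.2 * u z.2 * poisson2 e (sub2 z))).
  apply/integrableP; split; first exact/measurable_EFinP.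
  apply: (@le_lt_trans _ _ (ip u u)%:E); last exact: ltry.
  rewrite -m2E le_eqVlt; apply/orP; left; apply/eqP; apply: eq_integral => z _.
  by rewrite gee0_abs//= lee_fin mulr_ge0// poisson2_ge0.
rewrite (_ : ip u u = 2^-1 * (\int[mm]_z (u z.1 * u z.1 * poisson2 e (sub2 z))
    + \int[mm]_z (u z.2 * u z.2 * poisson2 e (sub2 z)))); last first.
  by rewrite /Rintegral m1E m2E/=; field.
rewrite -RintegralD// -RintegralZl//; last first.
  by have := integrableD measurableT i1 i2; apply: eq_integrable.
have i12 : mm.-integrable setT (EFin \o (fun z => 2^-1 *
   (u z.1 * u z.1 * poisson2 e (sub2 z) + u z.2 * u z.2 * poisson2 e (sub2 z)))).
  have := integrableZl measurableT 2^-1 (integrableD measurableT i1 i2).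
  by apply: eq_integrable.
have hle z : `|u z.1 * u z.2 * poisson2 e (sub2 z)| <= 2^-1 *
   (u z.1 * u z.1 * poisson2 e (sub2 z) + u z.2 * u z.2 * poisson2 e (sub2 z)).
  have := poisson2_ge0 (sub2 z) e0; set K := poisson2 _ _ => K0.
  rewrite normrM (ger0_norm K0).
  have -> : 2^-1 * (u z.1 * u z.1 * K + u z.2 * u z.2 * K) =
    2^-1 * (u z.1 * u z.1 + u z.2 * u z.2) * K by ring.
  rewrite ler_wpM2r//.
  rewrite ler_norml; have := sqr_ge0 (u z.1 - u z.2).
  by have := sqr_ge0 (u z.1 + u z.2); rewrite !expr2; nra.
have i0 : mm.-integrable setT
    (EFin \o (fun z => u z.1 * u z.2 * poisson2 e (sub2 z))).
  apply: le_integrable i12 => //.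
    apply/measurable_EFinP; apply: measurable_funM => //.
    exact: (@measurable_tensor _ _ _ _ R _ _ mu_ mu_).
  by move=> z _ /=; rewrite lee_fin (le_trans (hle z))// ler_norm.
split; first exact: i0.
apply: le_Rintegral; [exact: measurableT|exact: i0|exact: i12|].
by move=> z _; rewrite (le_trans _ (hle z))// ler_norm.
Qed.
End Contraction.

(** * The Plancherel defect as a quadratic form *)

Section Defect.
Context {R : realType}.
Implicit Types (e : R) (x y w : PL R) (u v : PL R -> R).

Definition spectrum u w : R := cosT u w ^+ 2 + sinT u w ^+ 2.

Lemma spectrum_ge0 u w : 0 <= spectrum u w.
Proof. by rewrite addr_ge0// sqr_ge0. Qed.

Lemma measurable_spectrum u : L1 u -> measurable_fun setT (spectrum u).
Proof.
move=> /L1_measurable hu.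
by apply: measurable_funD; apply: measurable_funX;
  [exact: measurable_cosT|exact: measurable_sinT].
Qed.

Lemma integrable_damp_spectrum e u : 0 < e -> L1 u ->
  L1 (fun w => damp e w * spectrum u w).
Proof.
move=> e0 hu; set C := \int[mu2]_x `|u x|.
apply: (integrable_mul_bounded (c := C ^+ 2 + C ^+ 2)).
- exact: integrable_damp.
- exact: measurable_spectrum.
- move=> w; rewrite ger0_norm ?spectrum_ge0//.
  have sq t : `|t| <= C -> t ^+ 2 <= C ^+ 2.
    by move=> tC; rewrite -real_normK ?num_real// ler_pXn2r ?nnegrE// (le_trans _ tC).
  by apply: lerD; apply: sq; [exact: cosT_bound|exact: sinT_bound].
Qed.

Lemma integral_damp_spectrum e u : 0 < e -> L1 u ->
  (\int[mu2]_w (damp e w * spectrum u w)%:E =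
   (\int[sigma_finite_product smu2 smu2]_z
      (u z.1 * u z.2 * poisson2 e (sub2 z)))%:E)%E.
Proof.
move=> e0 hu; rewrite -damped_energy// /Rintegral fineK//.
by apply: integrable_fin_num => //; exact: integrable_damp_spectrum.
Qed.

Lemma cvg_damp w : (fun n => damp n.+1%:R^-1 w) @ \oo --> (1 : R).
Proof.
have h (t : R) : (fun n => expR (- n.+1%:R^-1 * t)) @ \oo --> (1 : R).
  rewrite -[X in _ --> X]expR0.
  apply: continuous_cvg; first exact: continuous_expR.
  have h1 : (fun n => - n.+1%:R^-1 * t) @ \oo --> - 0 * t.
    by apply: cvgMr_tmp; apply: cvgN; exact: cvg_harmonic.
  by move: h1; rewrite oppr0 mul0r.
by rewrite -[X in _ --> X]mulr1; apply: cvgM.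
Qed.

(** Removing the damping by Fatou's lemma yields only an inequality; equality has to come from the
    defect argument. *)
Lemma integral_spectrum_le u : L1 u -> u \in L2 ->
  (\int[mu2]_w (spectrum u w)%:E <= (ip u u)%:E)%E.
Proof.
move=> hu hu2.
apply: (@fatou_le _ _ _ _ (fun n w => damp n.+1%:R^-1 w * spectrum u w)).
- move=> n; apply: measurable_funM; first exact: measurable_damp.
  exact: measurable_spectrum.
- by move=> n w; rewrite mulr_ge0 ?damp_ge0 ?spectrum_ge0.
- move=> w; rewrite -[X in _ --> X]mul1r; apply: cvgMr_tmp; exact: cvg_damp.
- apply: nearW => n; rewrite integral_damp_spectrum//.
  have n0 : 0 < n.+1%:R^-1 :> R by rewrite invr_gt0.
  have [_ h] := damped_energy_le n0 hu hu2.
  by rewrite lee_fin.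
Qed.

Lemma cosT_L2 u : L1 u -> u \in L2 -> cosT u \in L2.
Proof.
move=> hu hu2; apply: L2P; first by apply: measurable_cosT; exact: L1_measurable.
apply: le_lt_trans (ltry (ip u u)); apply: le_trans (integral_spectrum_le hu hu2).
have mc := measurable_cosT (L1_measurable hu).
apply: ge0_le_integral => //.
- by move=> w _; rewrite lee_fin -expr2 sqr_ge0.
- by apply/measurable_EFinP; exact: measurable_funM.
- by apply/measurable_EFinP; exact: measurable_spectrum.
- by move=> w _; rewrite lee_fin -expr2 lerDl sqr_ge0.
Qed.

Lemma sinT_L2 u : L1 u -> u \in L2 -> sinT u \in L2.
Proof.
move=> hu hu2; apply: L2P; first by apply: measurable_sinT; exact: L1_measurable.
apply: le_lt_trans (ltry (ip u u)); apply: le_trans (integral_spectrum_le hu hu2).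
have mc := measurable_sinT (L1_measurable hu).
apply: ge0_le_integral => //.
- by move=> w _; rewrite lee_fin -expr2 sqr_ge0.
- by apply/measurable_EFinP; exact: measurable_funM.
- by apply/measurable_EFinP; exact: measurable_spectrum.
- by move=> w _; rewrite lee_fin -expr2 lerDr sqr_ge0.
Qed.

Definition energy u : R := ip (cosT u) (cosT u) + ip (sinT u) (sinT u).

Lemma energyE u : L1 u -> u \in L2 ->
  (energy u)%:E = (\int[mu2]_w (spectrum u w)%:E)%E.
Proof.
move=> hu hu2; have hc := cosT_L2 hu hu2; have hs := sinT_L2 hu hu2.
rewrite EFinD (ipE hc) (ipE hs) -ge0_integralD//.
- by move=> w _; rewrite lee_fin -expr2 sqr_ge0.
- by apply/measurable_EFinP; apply: measurable_funM; exact: (L2_measurable hc).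
- by move=> w _; rewrite lee_fin -expr2 sqr_ge0.
- by apply/measurable_EFinP; apply: measurable_funM; exact: (L2_measurable hs).
Qed.

Lemma energy_le u : L1 u -> u \in L2 -> energy u <= ip u u.
Proof.
by move=> hu hu2; rewrite -lee_fin energyE//; exact: integral_spectrum_le.
Qed.

(* A nonnegative quadratic form (by contraction), whose vanishing is the
   Plancherel identity. *)
Definition isometric u : Prop := [/\ L1 u, u \in L2 & energy u = ip u u].

(** The defect [q(u) = ip u u - energy u] obeys the parallelogram law
    [q(u+v) + q(u-v) = 2 q(u) + 2 q(v)], and [q(u-v) >= 0] by contraction. Its zeros are therefore
    stable under sums. *)
Lemma defect_le u v : L1 u -> L1 v -> u \in L2 -> v \in L2 ->
  ip (fun x => u x + v x) (fun x => u x + v x) - energy (fun x => u x + v x) <=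
  2 * (ip u u - energy u) + 2 * (ip v v - energy v).
Proof.
move=> hu hv hu2 hv2.
have := energy_le (L1B hu hv) (L2B hu2 hv2).
have cu := cosT_L2 hu hu2; have su := sinT_L2 hu hu2.
have cv := cosT_L2 hv hv2; have sv := sinT_L2 hv hv2.
rewrite /energy (cosTD hu hv) (sinTD hu hv) (cosTB hu hv) (sinTB hu hv).
rewrite (ip_sqrD hu2 hv2) (ip_sqrD cu cv) (ip_sqrD su sv).
rewrite (ip_sqrB hu2 hv2) (ip_sqrB cu cv) (ip_sqrB su sv).
move: (ip u u) (ip u v) (ip v v) => a1 a2 a3.
move: (ip (cosT u) (cosT u)) (ip (cosT u) (cosT v)) (ip (cosT v) (cosT v)).
move: (ip (sinT u) (sinT u)) (ip (sinT u) (sinT v)) (ip (sinT v) (sinT v)).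
by move=> s1 s2 s3 c1 c2 c3; lra.
Qed.

Lemma isometricD u v : isometric u -> isometric v ->
  isometric (fun x => u x + v x).
Proof.
move=> [hu hu2 Eu] [hv hv2 Ev].
have hl := L1D hu hv; have hl2 := L2D hu2 hv2; split => //.
apply/eqP; rewrite eq_le energy_le//=.
by have := defect_le hu hv hu2 hv2; rewrite Eu Ev !subrr mulr0 addr0 subr_le0.
Qed.

Lemma isometricZ c u : isometric u -> isometric (fun x => c * u x).
Proof.
move=> [hu hu2 Eu]; split; [exact: L1Z|exact: L2Z|].
have cu := cosT_L2 hu hu2; have su := sinT_L2 hu hu2.
have Z v : v \in L2 -> ip (fun x => c * v x) (fun x => c * v x) = c ^+ 2 * ip v v.
  move=> hv; rewrite ipZl//; last exact: L2Z.
  by rewrite ipC ipZl// mulrA expr2.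
by rewrite /energy cosTZ// sinTZ// !Z// -mulrDr -Eu.
Qed.

Lemma isometricB u v : isometric u -> isometric v ->
  isometric (fun x => u x - v x).
Proof.
move=> hu /(isometricZ (-1)) hv; have := isometricD hu hv.
by under eq_fun do rewrite mulN1r.
Qed.

(** In the splitting [u = (u - un) + un] the second part has no defect, and the defect of the first
    is at most its squared norm, which tends to zero. *)
Lemma isometric_lim un u : (forall n, isometric (un n)) -> L1 u -> u \in L2 ->
  L2cvg mu2 un u -> isometric u.
Proof.
move=> hun hu hu2 h; split => //; apply/eqP; rewrite eq_le energy_le//=.
rewrite -subr_le0.
have ub n : ip u u - energy u <=
    2 * ip (fun x => un n x - u x) (fun x => un n x - u x).
  have [hn hn2 En] := hun n.
  have hB := L1B hu hn; have hB2 := L2B hu2 hn2.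
  have := defect_le hB hn hB2 hn2.
  have -> : (fun x => u x - un n x + un n x) = u by apply/funext => x; rewrite subrK.
  rewrite En subrr mulr0 addr0 => /le_trans; apply.
  rewrite ler_wpM2l// lerBlDr (_ : ip _ _ = ip (fun x => un n x - u x) (fun x => un n x - u x)).
    by rewrite lerDl addr_ge0// ip_ge0.
  by apply: eq_Rintegral => x _; rewrite -mulrNN !opprB.
have h0 : (fun n => 2 * ip (fun x => un n x - u x) (fun x => un n x - u x)) @ \oo
    --> (0 : R).
  by rewrite -[X in _ --> X](mulr0 2); apply: cvgMl_tmp.
rewrite -(cvg_lim _ h0)//; apply: limr_ge; first by apply/cvg_ex; exists 0.
by apply: nearW => n; exact: ub.
Qed.
End Defect.

(** * The Plancherel identity on boxes *)

Section Boxes.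
Context {R : realType}.
Implicit Types (e : R) (x y w : PL R) (u v : PL R -> R).

(** Half-open sides match the intervals that generate the Borel sets and are stable under
    intersection. *)
Definition box (a b c d : R) : set (PL R) :=
  `]a, b]%classic `*` `]c, d]%classic.

Lemma measurable_box a b c d : measurable (box a b c d).
Proof. by apply: measurableX; exact: measurable_itv. Qed.

Lemma mu2_setX (A B : set (measurableTypeR R)) : measurable A -> measurable B ->
  mu2 (A `*` B) = (leb A * leb B)%E.
Proof. by move=> mA mB; exact: (@product_measure1E _ _ _ _ R leb leb). Qed.

Lemma mu2_box a b c d : a < b -> c < d -> mu2 (box a b c d) = ((b - a) * (d - c))%:E.
Proof.
move=> ab cd; rewrite mu2_setX; [|exact: measurable_itv..].
by rewrite !lebesgue_measure_itv/= !lte_fin ab cd -!EFinB -EFinM.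
Qed.

Lemma mu2_box_fin a b c d : (mu2 (box a b c d) < +oo)%E.
Proof.
rewrite mu2_setX; [|exact: measurable_itv..].
rewrite !lebesgue_measure_itv/=.
by case: ifPn => _; case: ifPn => _; rewrite ?mul0e ?mule0 -?EFinB -?EFinM ltry.
Qed.

Lemma indic_L1 (A : set (PL R)) : measurable A -> (mu2 A < +oo)%E -> L1 (\1_A).
Proof.
move=> mA Aoo; apply/integrableP; split.
  by apply/measurable_EFinP; exact: measurable_indic.
under eq_integral do rewrite gee0_abs ?lee_fin//.
by rewrite integral_indic// setIT.
Qed.

Lemma indic_L2 (A : set (PL R)) : measurable A -> (mu2 A < +oo)%E ->
  (\1_A : PL R -> R) \in L2.
Proof.
move=> mA Aoo; apply: L2P; first exact: measurable_indic.
have -> : (\int[mu2]_x (\1_A x * \1_A x)%:E = \int[mu2]_x (\1_A x)%:E)%E.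
  by apply: eq_integral => x _; rewrite indicE; case: (_ \in _); rewrite ?mulr0 ?mulr1.
by rewrite integral_indic// setIT.
Qed.

Lemma ip_indic (A : set (PL R)) : measurable A -> ip \1_A \1_A = fine (mu2 A).
Proof.
move=> mA; rewrite /ip /Rintegral; congr fine.
have -> : (\int[mu2]_x (\1_A x * \1_A x)%:E = \int[mu2]_x (\1_A x)%:E)%E.
  by apply: eq_integral => x _; rewrite indicE; case: (_ \in _); rewrite ?mulr0 ?mulr1.
by rewrite integral_indic// setIT.
Qed.

(** The mass that the Poisson kernel centred at [t] gives to []a, b]]. *)
Definition itv_mass e (a b t : R) : R :=
  pi^-1 * (atan (2 * pi / e * (t - a)) - atan (2 * pi / e * (t - b))).

Lemma itv_mass_ge0 e (a b t : R) : 0 < e -> a < b -> 0 <= itv_mass e a b t.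
Proof.
move=> e0 ab; rewrite mulr_ge0 ?invr_ge0 ?pi_ge0// subr_ge0 le_atan//.
rewrite ler_wpM2l ?lerD2l ?lerN2 ?(ltW ab)//.
by rewrite divr_ge0 ?mulr_ge0 ?pi_ge0// ltW.
Qed.

Lemma measurable_itv_mass e (a b : R) : measurable_fun setT (itv_mass e a b).
Proof.
apply: measurable_funM => //; apply: measurable_funB.
  apply: (@measurableT_comp _ _ _ _ _ _ (@atan R)).
    by apply: continuous_measurable_fun => t; exact: continuous_atan.
  by apply: measurable_funM => //; exact: measurable_funB.
apply: (@measurableT_comp _ _ _ _ _ _ (@atan R)).
  by apply: continuous_measurable_fun => t; exact: continuous_atan.
by apply: measurable_funM => //; exact: measurable_funB.
Qed.

(** At an interior point the two arctangents tend to opposite limits [pi / 2] and [- pi / 2]. At an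
    endpoint the limit would be [1/2], which is why open boxes appear below. *)
Lemma cvg_itv_mass (a b t : R) : a < t -> t < b ->
  (fun n => itv_mass n.+1%:R^-1 a b t) @ \oo --> (1 : R).
Proof.
move=> at_ tb; have p0 := pi_gt0 R.
have h (k : R) : 0 < k ->
    (fun n => atan (2 * pi / n.+1%:R^-1 * k)) @ \oo --> (pi / 2 : R).
  move=> k0; have h1 : (fun n => 2 * pi * k * n.+1%:R : R) @ \oo --> +oo.
    have C0 : 0 < 2 * pi * k by rewrite !mulr_gt0.
    apply/cvgryPge => A; near=> n; rewrite mulrC -ler_pdivrMr//.
    apply: (@le_trans _ _ n%:R); last by rewrite ler_nat.
    by near: n; exact: nbhs_infty_ger.
  have h2 := cvg_comp _ _ h1 (@cvgy_atan R).
  under eq_cvg => n do rewrite invrK mulrAC.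
  exact: h2.
rewrite /itv_mass.
rewrite -[X in _ --> X](mulVf (_ : pi != 0 :> R)) ?gt_eqF//.
apply: cvgMl_tmp.
have E : pi / 2 - - (pi / 2) = pi :> R by rewrite opprK -splitr.
rewrite -[X in _ --> X]E.
apply: cvgB; first by apply: h; rewrite subr_gt0.
have h2 : (fun n => - atan (2 * pi / n.+1%:R^-1 * (b - t))) @ \oo --> - (pi / 2 : R).
  by apply: cvgN; apply: h; rewrite subr_gt0.
under eq_cvg => n do rewrite -opprB mulrN atanN.
exact: h2.
Unshelve. all: by end_near. Qed.

Lemma integral_indic_poisson e (a b t : R) : 0 < e -> a < b ->
  (\int[leb]_r (\1_(`]a, b]%classic) r * poisson e (t - r))%:E =
   (itv_mass e a b t)%:E)%E.
Proof.
move=> e0 ab; rewrite -integral_poisson_itv//.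
rewrite -integral_itv_obnd_cbnd; last first.
  apply/measurable_EFinP/measurable_funTS; apply: continuous_measurable_fun => r.
  apply: (@continuous_comp _ _ _ (fun r : R => t - r) (poisson e)).
    by apply: cvgB; [exact: cvg_cst|exact: cvg_id].
  exact: continuous_poisson.
rewrite [RHS]integral_mkcond; apply: eq_integral => r _.
by rewrite epatch_indic/= -EFinM mulrC.
Qed.

(** Contraction leaves only the lower bound on the energy. The damped energy of an indicator is the
    integral over the box of explicit interval masses, which tend to [1] inside it, so Fatou's lemma
    gives the full area. *)
Lemma isometric_box_lt a b c d : a < b -> c < d -> isometric (\1_(box a b c d) : PL R -> R).
Proof.
move=> ab cd; set B := box a b c d; have mB : measurable B := measurable_box a b c d.
have Boo : (mu2 B < +oo)%E := mu2_box_fin a b c d.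
have h1 := indic_L1 mB Boo; have h2 := indic_L2 mB Boo.
split => //; apply/eqP; rewrite eq_le energy_le//=.
rewrite ip_indic// mu2_box//= -lee_fin energyE//.
(* The open box has the same area, and the masses converge to [1] at each of its points. *)
pose B0 : set (PL R) := `]a, b[%classic `*` `]c, d[%classic.
have mB0 : measurable B0 by apply: measurableX; exact: measurable_itv.
have -> : ((b - a) * (d - c))%:E = (\int[mu2]_x (\1_B0 x)%:E)%E.
  rewrite integral_indic// setIT mu2_setX; [|exact: measurable_itv..].
  by rewrite !lebesgue_measure_itv/= !lte_fin ab cd -!EFinB -EFinM.
apply: (@fatou_le _ _ _ _ (fun n x => \1_B0 x *
  (itv_mass n.+1%:R^-1 a b x.1 * itv_mass n.+1%:R^-1 c d x.2))).
- move=> n; apply: measurable_funM; first exact: measurable_indic.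
  exact: (@measurable_tensor _ _ _ _ R _ _ (measurable_itv_mass _ a b)
    (measurable_itv_mass _ c d)).
- by move=> n x; apply: mulr_ge0 => //; apply: mulr_ge0; apply: itv_mass_ge0.
- move=> x; rewrite indicE; case: (boolP (x \in B0)) => xB; last first.
    by under eq_fun do rewrite mul0r; exact: cvg_cst.
  under eq_fun do rewrite mul1r.
  move: xB; rewrite inE => -[] /=; rewrite !in_itv/= => /andP[ax xb] /andP[cx xd].
  have h := cvgM (cvg_itv_mass ax xb) (cvg_itv_mass cx xd).
  by rewrite mulr1 in h; exact: h.
apply: nearW => n.
have e0 : 0 < n.+1%:R^-1 :> R by rewrite invr_gt0.
move: (n.+1%:R^-1) e0 => e e0.
(* Damping only lowers the energy, so a lower bound may be sought for the damped one, where the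
   Poisson formula is available. *)
apply: (@le_trans _ _ (\int[mu2]_w (damp e w * spectrum \1_B w)%:E)%E); last first.
  apply: ge0_le_integral => //.
  - by move=> w _; rewrite lee_fin mulr_ge0 ?damp_ge0 ?spectrum_ge0.
  - apply/measurable_EFinP; apply: measurable_funM; first exact: measurable_damp.
    exact: measurable_spectrum.
  - by apply/measurable_EFinP; exact: measurable_spectrum.
  - by move=> w _; rewrite lee_fin ler_piMl ?spectrum_ge0// damp_le1.
rewrite integral_damp_spectrum//.
have [i0 _] := damped_energy_le e0 h1 h2.
have K0 z : 0 <= (\1_B z.1 * \1_B z.2 * poisson2 e (sub2 z) : R).
  by apply: mulr_ge0; [exact: mulr_ge0|exact: poisson2_ge0].
have -> : (\int[sigma_finite_product smu2 smu2]_z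
    (\1_B z.1 * \1_B z.2 * poisson2 e (sub2 z)))%:E =
    (\int[sigma_finite_product smu2 smu2]_z
    (\1_B z.1 * \1_B z.2 * poisson2 e (sub2 z))%:E)%E.
  by rewrite /Rintegral fineK//; exact: integrable_fin_num i0.
rewrite (@fubini_tonelli1 _ _ _ _ R smu2 smu2 _ (measurable_int _ i0)); last first.
  by move=> z; rewrite lee_fin.
apply: (@le_trans _ _ (\int[mu2]_x (\1_B x *
  (itv_mass e a b x.1 * itv_mass e c d x.2))%:E)%E).
  have mm : measurable_fun setT (fun x : PL R => itv_mass e a b x.1 * itv_mass e c d x.2).
    exact: (@measurable_tensor _ _ _ _ R _ _ (measurable_itv_mass e a b)
      (measurable_itv_mass e c d)).
  apply: ge0_le_integral => //.
  - move=> x _; rewrite lee_fin; apply: mulr_ge0 => //.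
    by apply: mulr_ge0; apply: itv_mass_ge0.
  - by apply/measurable_EFinP; apply: measurable_funM => //; exact: measurable_indic.
  - by apply/measurable_EFinP; apply: measurable_funM => //; exact: measurable_indic.
  - move=> x _; rewrite lee_fin; apply: ler_wpM2r.
      by apply: mulr_ge0; apply: itv_mass_ge0.
    rewrite !indicE ler_nat; case: (boolP (x \in B0)) => // xB0.
    rewrite (_ : x \in B)//; move: xB0; rewrite !inE => -[] /=.
    rewrite /B /box !in_itv/= => /andP[ax xb] /andP[cx xd]; split => /=.
      by rewrite in_itv/= ax ltW.
    by rewrite in_itv/= cx ltW.
rewrite le_eqVlt; apply/orP; left; apply/eqP; apply: eq_integral => x _.
rewrite /fubini_F/=.
have -> : (\int[mu2]_y (\1_B x * \1_B y * poisson2 e (sub2 (x, y)))%:E =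
    \int[mu2]_y ((\1_B x)%:E * (\1_B y * poisson2 e (sub2 (x, y)))%:E))%E.
  apply: eq_integral => y _; rewrite -EFinM; congr EFin.
  exact: (esym (mulrA _ _ _)).
have mp : measurable_fun setT (fun y : PL R => \1_B y * poisson2 e (sub2 (x, y))).
  apply: measurable_funM; first exact: measurable_indic.
  exact: (measurableT_comp (measurable_poisson2B e0) (pair1_measurable x)).
rewrite ge0_integralZl//; last 2 first.
- exact/measurable_EFinP.
- by move=> y _; rewrite lee_fin mulr_ge0// poisson2_ge0.
rewrite EFinM; congr (_ * _)%E.
rewrite (@fubini_tonelli1 _ _ _ _ R leb leb
  (fun y => (\1_B y * poisson2 e (sub2 (x, y)))%:E)); last 2 first.
- exact/measurable_EFinP.
- by move=> y; rewrite lee_fin mulr_ge0// poisson2_ge0.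
rewrite EFinM -(integral_indic_poisson x.1 e0 ab).
have mI (k1 k2 t : R) : measurable_fun setT
    (fun r : measurableTypeR R => \1_(`]k1, k2]%classic) r * poisson e (t - r)).
  apply: measurable_funM; first exact: measurable_indic.
  apply: continuous_measurable_fun => r.
  apply: (@continuous_comp _ _ _ (fun r : R => t - r) (poisson e)).
    by apply: cvgB; [exact: cvg_cst|exact: cvg_id].
  exact: continuous_poisson.
rewrite -(integral_indic_poisson x.2 e0 cd) -ge0_integralZr//; last 3 first.
- by apply/measurable_EFinP; exact: mI.
- by move=> r _; rewrite lee_fin mulr_ge0// poisson_ge0.
- by apply: integral_ge0 => r _; rewrite lee_fin mulr_ge0// poisson_ge0.
apply: eq_integral => r _; rewrite /fubini_F/=.
rewrite -ge0_integralZl//; last 3 first.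
- by apply/measurable_EFinP; exact: mI.
- by move=> q _; rewrite lee_fin mulr_ge0// poisson_ge0.
- by rewrite lee_fin mulr_ge0// poisson_ge0.
apply: eq_integral => q _; rewrite -EFinM; congr EFin.
have -> : \1_B (r, q) = \1_(`]a, b]%classic) r * \1_(`]c, d]%classic) q :> R.
  by rewrite !indicE -natrM mulnb /B /box in_setX.
by rewrite /poisson2/=; ring.
Qed.
End Boxes.

(** * From boxes to general functions *)

Lemma L2cvg_dominated d (T : measurableType d) (R : realType)
    (mu : {measure set T -> \bar R}) (un : nat -> T -> R) (u g : T -> R) :
    (forall n, measurable_fun setT (un n)) -> measurable_fun setT u ->
    (forall x, (fun n => un n x) @ \oo --> u x) ->
    (forall n x, (un n x - u x) * (un n x - u x) <= g x) ->
    mu.-integrable setT (EFin \o g) ->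
  L2cvg mu un u.
Proof.
move=> mun mu_ unu ug hg.
have h : (fun n => (\int[mu]_x ((un n x - u x) * (un n x - u x))%:E)%E) @ \oo
    --> (\int[mu]_x (cst 0 x))%E.
  apply: (@dominated_cvg _ _ _ _ _ measurableT _ _ (EFin \o g)) => //.
  - move=> n; apply/measurable_EFinP.
    by apply: measurable_funM; exact: measurable_funB.
  - move=> x _; apply: cvg_EFin; first exact: nearW.
    rewrite -(mul0r (0 : R)); apply: cvgM.
      by rewrite -(subrr (u x)); apply: cvgB => //; exact: cvg_cst.
    by rewrite -(subrr (u x)); apply: cvgB => //; exact: cvg_cst.
  - by move=> n x _; rewrite lee_fin ger0_norm -?expr2 ?sqr_ge0// expr2.
rewrite integral0 in h.
exact: (fine_cvg h).
Qed.

Section Isometry.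
Context {R : realType}.
Implicit Types (e : R) (x y w : PL R) (u v : PL R -> R).

Lemma isometric0 : isometric (fun _ : PL R => 0 : R).
Proof.
have := isometricZ 0 (isometric_box_lt (@ltr01 R) (@ltr01 R)).
by under eq_fun do rewrite mul0r.
Qed.

Lemma isometric_box a b c d : isometric (\1_(box a b c d) : PL R -> R).
Proof.
have E (p q : R) : q <= p -> `]p, q]%classic = set0 :> set (measurableTypeR R).
  by move=> qp; rewrite set_itv_ge// bnd_simp -leNgt.
have [ab|ba] := ltP a b; have [cd|dc] := ltP c d.
- exact: isometric_box_lt.
- by rewrite /box (E c)// setX0 indic0; exact: isometric0.
- by rewrite /box (E a)// set0X indic0; exact: isometric0.
- by rewrite /box (E a)// set0X indic0; exact: isometric0.
Qed.

Lemma isometric_setD (A B : set (PL R)) : B `<=` A ->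
  isometric (\1_A : PL R -> R) -> isometric (\1_B : PL R -> R) ->
  isometric (\1_(A `\` B) : PL R -> R).
Proof.
move=> BA hA hB; have := isometricB hA hB.
rewrite (_ : (fun x => \1_A x - \1_B x) = \1_(A `\` B))//.
apply/funext => x; rewrite !indicE in_setD.
have [xB|xB] := boolP (x \in B); last by rewrite andbT subr0.
by rewrite andbF mem_set ?subrr//; apply: BA; exact: set_mem.
Qed.

(** Finite sums of the indicators are isometric, and converge in [L^2] by domination; the common
    bound [B] of finite measure supplies the dominating function. *)
Lemma isometric_bigcup (F : nat -> set (PL R)) (B : set (PL R)) :
    measurable B -> (mu2 B < +oo)%E -> (forall n, measurable (F n)) ->
    (forall n, F n `<=` B) -> trivIset setT F ->
    (forall n, isometric (\1_(F n) : PL R -> R)) ->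
  isometric (\1_(\bigcup_n F n) : PL R -> R).
Proof.
move=> mB Boo mF FB tF hF; set U := \bigcup_n F n.
have mU : measurable U by exact: bigcupT_measurable.
have UB : U `<=` B by move=> x [n _]; exact: FB.
have Uoo : (mu2 U < +oo)%E.
  by apply: le_lt_trans Boo; apply: le_measure; rewrite ?inE.
pose un n x : R := \sum_(k < n) \1_(F k) x.
(* Disjointness keeps the partial sums in [{0, 1}], which bounds their squared distance to the
   indicator of [U] by the indicator of [B]. *)
have unE n x : un n x = 0 \/ (un n x = 1 /\ U x).
  elim: n => [|n [IH|[IH Ux]]]; first by left; rewrite /un big_ord0.
    rewrite /un big_ord_recr/= -/(un n x) IH add0r indicE.
    have [xF|_] := boolP (x \in F n); [right|by left].
    by split => //; exists n => //; exact: set_mem.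
  right; split => //; rewrite /un big_ord_recr/= -/(un n x) IH indicE.
  have [/set_mem xF|_] := boolP (x \in F n); last by rewrite addr0.
  have [k kn Fk] : exists2 k, (k < n)%N & F k x.
    apply: contrapT => h; move: IH; rewrite /un big1 => [/eqP|k _].
      by rewrite eq_sym oner_eq0.
    rewrite indicE memNset// => Fk; apply: h; by exists k.
  have /trivIsetP/(_ k n I I) := tF; rewrite (ltn_eqF kn) => /(_ isT) h.
  by have : (F k `&` F n) x by []; rewrite h.
apply: (@isometric_lim _ un).
- elim=> [|n IH]; first by rewrite /un; under eq_fun do rewrite big_ord0; exact: isometric0.
  have := isometricD IH (hF n).
  by rewrite /un; under [in X in _ -> X]eq_fun do rewrite big_ord_recr/=.
- exact: indic_L1.
- exact: indic_L2.
- apply: (@L2cvg_dominated _ _ _ _ _ _ (\1_B)).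
  + move=> n; apply: measurable_sum => k; exact: measurable_indic.
  + exact: measurable_indic.
  + move=> x; rewrite indicE; have [/set_mem[j _ Fj]|/negP xU] := boolP (x \in U).
      apply: cvg_near_cst; exists j.+1 => // n /= jn.
      have [un0|[//]] := unE n x.
      exfalso; move: un0; rewrite /un (bigD1 (Ordinal jn))//= indicE mem_set//.
      apply/eqP; rewrite gt_eqF// ltr_pwDl// sumr_ge0//.
    apply: cvg_near_cst; apply: nearW => n.
    have [//|[_ Ux]] := unE n x.
    by exfalso; apply: xU; exact: mem_set.
  + move=> n x; rewrite [in leRHS]indicE.
    have [->|[-> Ux]] := unE n x; rewrite indicE.
    * have [/set_mem/UB xB|_] := boolP (x \in U); last by rewrite subr0 mulr0.
      by rewrite (mem_set xB) sub0r mulrNN mulr1.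
    * by rewrite mem_set// subrr mulr0.
  + exact: indic_L1.
Qed.

(** Dynkin's theorem relative to a fixed [B]: complements are taken inside [B], since an indicator
    of infinite mass is not square-integrable. The map [p] is general so that both projections and
    the identity can be used. *)
Lemma isometric_preimage d (T : measurableType d) (G : set (set T)) (p : PL R -> T)
    (B : set (PL R)) : measurable_fun setT p -> @measurable d T = <<s G >> ->
    setI_closed G -> measurable B -> (mu2 B < +oo)%E -> isometric (\1_B : PL R -> R) ->
    (forall X, G X -> isometric (\1_(p @^-1` X `&` B) : PL R -> R)) ->
  forall X, measurable X -> isometric (\1_(p @^-1` X `&` B) : PL R -> R).
Proof.
move=> mp GE GI mB Boo hB hG X mX.
apply: (@dynkin_induction _ T G
  (fun X => isometric (\1_(p @^-1` X `&` B) : PL R -> R))) => //.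
- by rewrite preimage_setT setTI.
- move=> Y mY hY; rewrite preimage_setC (_ : _ `&` B = B `\` (p @^-1` Y `&` B)).
    by apply: isometric_setD.
  by rewrite setDIr setDv setU0 setDE setIC.
- move=> F mF tF hF; rewrite preimage_bigcup setI_bigcupl.
  apply: (isometric_bigcup mB Boo) => //.
  + by move=> n; apply: measurableI => //; rewrite -[X in measurable X]setTI; exact: mp.
  + apply/trivIsetP => i j _ _ ij; apply/seteqP; split => // z [[Fi _] [Fj _]].
    have /trivIsetP/(_ i j I I ij)/seteqP[h _] := tF.
    exact: (h (p z) (conj Fi Fj)).
- by rewrite -GE.
Qed.

Let isometric_preimage_itv (p : PL R -> measurableTypeR R) (B : set (PL R)) :
    measurable_fun setT p -> measurable B -> (mu2 B < +oo)%E ->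
    isometric (\1_B : PL R -> R) ->
    (forall a b, isometric (\1_(p @^-1` `]a, b]%classic `&` B) : PL R -> R)) ->
  forall X, measurable X -> isometric (\1_(p @^-1` X `&` B) : PL R -> R).
Proof.
move=> mp mB Boo hB h; apply: (@isometric_preimage _ _ (@ocitv R)) => //.
  exact: ocitvI.
by move=> _ [[a b] _ <-]; exact: h.
Qed.

Let itvI (a b r : R) : exists a' b',
  `]a, b]%classic `&` `]- r, r]%classic = `]a', b']%classic :> set R.
Proof.
have [[a' b'] _ /= <-] := @ocitvI R _ _ (is_ocitv a b) (is_ocitv (- r) r).
by exists a', b'.
Qed.

(** The product sigma-algebra is generated by rectangles with measurable sides, while boxes have
    intervals as sides. Hence three applications of Dynkin's theorem: first coordinate, second
    coordinate, then the plane. *)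
Lemma isometric_setI (r : R) (A : set (PL R)) : measurable A ->
  isometric (\1_(A `&` box (- r) r (- r) r) : PL R -> R).
Proof.
set B := box _ _ _ _.
have mB : measurable B by exact: measurable_box.
have Boo : (mu2 B < +oo)%E by exact: mu2_box_fin.
have hfst c d (X : set (measurableTypeR R)) : measurable X ->
    isometric (\1_(fst @^-1` X `&` box (- r) r c d) : PL R -> R).
  apply: isometric_preimage_itv.
  - exact: measurable_fst.
  - exact: measurable_box.
  - exact: mu2_box_fin.
  - exact: isometric_box.
  move=> a b; have [a' [b' E]] := itvI a b r.
  rewrite (_ : _ `&` _ = box a' b' c d); first exact: isometric_box.
  rewrite /box -E; apply/seteqP; split => z.
    by move=> [? [? ?]].
  by move=> [[? ?] ?].
have hsnd (X Y : set (measurableTypeR R)) : measurable X -> measurable Y ->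
    isometric (\1_(snd @^-1` Y `&` (fst @^-1` X `&` B)) : PL R -> R).
  move=> mX; have mXB : measurable (fst @^-1` X `&` B).
    apply: measurableI => //; rewrite -[fst @^-1` X]setTI.
    exact (measurable_fst measurableT X mX).
  apply: isometric_preimage_itv => //.
  - by apply: le_lt_trans Boo; apply: le_measure; rewrite ?inE.
  - exact: hfst.
  move=> c d; have [c' [d' E]] := itvI c d r.
  rewrite (_ : _ `&` _ = fst @^-1` X `&` box (- r) r c' d'); first exact: hfst.
  rewrite /B /box -E; apply/seteqP; split => z.
    by move=> [? [? [? ?]]].
  by move=> [? [? [? ?]]].
apply: (@isometric_preimage _ _
  [set X `*` Y | X in measurable & Y in measurable] id) => //.
- exact: measurable_prod_measurableType.
- move=> _ _ [X mX [Y mY <-]] [X' mX' [Y' mY' <-]].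
  exists (X `&` X'); first exact: measurableI.
  by exists (Y `&` Y'); [exact: measurableI|rewrite setXI].
- exact: isometric_box.
move=> _ [X mX [Y mY <-]]; rewrite (_ : _ `&` B = snd @^-1` Y `&` (fst @^-1` X `&` B)).
  exact: hsnd.
by apply/seteqP; split => z; [move=> [[? ?] ?]|move=> [? [? ?]]].
Qed.

Lemma isometric_sum (I : Type) (s : seq I) (h : I -> PL R -> R) :
  (forall i, isometric (h i)) -> isometric (fun x => \sum_(i <- s) h i x).
Proof.
move=> hh; elim: s => [|i s IH].
  by under eq_fun do rewrite big_nil; exact: isometric0.
by under eq_fun do rewrite big_cons; exact: isometricD.
Qed.

(** Simple functions increase to [u]; the extra factor [\1_(B n)] is there because their level sets,
    that of [0] above all, may have infinite measure. *)
Lemma isometric_ge0 u : L1 u -> u \in L2 -> (forall x, 0 <= u x) -> isometric u.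
Proof.
move=> hu hu2 u0.
have mu_ : measurable_fun setT (EFin \o u).
  by apply/measurable_EFinP; exact: L1_measurable.
pose s n := nnsfun_approx measurableT mu_ n.
pose B n : set (PL R) := box (- n%:R) n%:R (- n%:R) n%:R.
pose un n x : R := s n x * \1_(B n) x.
have cs x : (fun n => s n x) @ \oo --> u x.
  have u0' y : setT y -> (0 <= (EFin \o u) y)%E by move=> _; rewrite lee_fin.
  have h := @cvg_nnsfun_approx _ _ _ _ measurableT _ mu_ u0' x I.
  exact: (fine_cvg h).
have su n x : s n x <= u x.
  rewrite -(cvg_lim _ (cs x))//; apply: nondecreasing_cvgn_le.
    by move=> p q pq; have /lefP := nd_nnsfun_approx measurableT mu_ pq; exact.
  by apply/cvg_ex; exists (u x).
apply: (@isometric_lim _ un) => //.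
- move=> n.
  rewrite (_ : un n = (fun x => \sum_(y <- finmap.enum_fset (fset_set (range (s n))))
      y * \1_((s n @^-1` [set y]) `&` B n) x)).
    apply: isometric_sum => y; apply: isometricZ; apply: isometric_setI.
    exact: measurable_sfunP.
  apply/funext => x; rewrite /un [in LHS]fimfunE fsbig_finite//= mulr_suml.
  by apply: eq_bigr => y _; rewrite -mulrA indicI.
- apply: (@L2cvg_dominated _ _ _ _ _ _ (fun x => u x * u x)).
  + move=> n; apply: measurable_funM; first exact: measurable_funP.
    by apply: measurable_indic; exact: measurable_box.
  + exact: L1_measurable.
  + move=> x; rewrite -[X in _ --> X]mulr1; apply: cvgM; first exact: cs.
    apply: cvg_near_cst.
    exists (Num.bound (Num.max `|x.1| `|x.2|)).+1 => // n /= hn.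
    rewrite indicE mem_set//.
    have h : Num.max `|x.1| `|x.2| < n%:R.
      apply: lt_le_trans (archi_boundP _) _; first by rewrite le_max normr_ge0.
      by rewrite ler_nat ltnW.
    move: h; rewrite gt_max !ltr_norml => /andP[/andP[h1 h2] /andP[h3 h4]].
    by split; rewrite /= in_itv/= ?h1 ?h3 ltW.
  + move=> n x; rewrite -mulrNN !opprB.
    have h : 0 <= u x - un n x <= u x.
      have sn0 : 0 <= s n x by exact: fun_ge0.
      rewrite /un indicE; case: (_ \in _); rewrite ?mulr1 ?mulr0 ?subr0 ?lexx ?u0//.
      by rewrite subr_ge0 su gerBl sn0.
    by move: h => /andP[h1 h2]; apply: ler_pM.
  + exact: L2_int.
Qed.

Theorem plancherel_real u : L1 u -> u \in L2 -> energy u = ip u u.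
Proof.
move=> hu hu2.
suff [] : isometric u by [].
have mu_ := L1_measurable hu.
pose up x := Num.max (u x) 0; pose un x := Num.max (- u x) 0.
have E x : up x - un x = u x.
  by rewrite /up /un; case: (leP (u x) 0) => h1; case: (leP (- u x) 0) => h2; lra.
have pL v : measurable_fun setT v -> (forall x, 0 <= v x) ->
    (forall x, v x <= `|u x|) -> isometric v.
  move=> mv v0 vu; apply: isometric_ge0 => //.
    apply: le_integrable hu => //; first exact/measurable_EFinP.
    by move=> x _; rewrite /= lee_fin ger0_norm.
  by apply: (L2_le mv hu2) => x; rewrite ger0_norm.
rewrite (_ : u = (fun x => up x - un x)); last by apply/funext => x; rewrite E.
apply: isometricB; apply: pL.
- exact: measurable_maxr.
- by move=> x; rewrite le_max lexx orbT.
- by move=> x; rewrite ge_max ler_norm normr_ge0.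
- by apply: measurable_maxr => //; exact: measurableT_comp.
- by move=> x; rewrite le_max lexx orbT.
- by move=> x; rewrite ge_max normr_ge0 -normrN ler_norm.
Qed.
End Isometry.

(** * Parseval's identity for complex functions *)

Section ComplexFourier.
Context {R : realType}.
Implicit Types (x y w : PL R) (u v : PL R -> R) (f g h : PL R -> R[i]).

(** The cosine transform is even and the sine transform odd, so the reflection through the origin
    changes the sign of the integral. *)
Lemma ip_cosT_sinT u v : L1 u -> u \in L2 -> L1 v -> v \in L2 ->
  ip (cosT u) (sinT v) = 0.
Proof.
move=> hu hu2 hv hv2; have hi := L2_int (cosT_L2 hu hu2) (sinT_L2 hv hv2).
have n1 : -1 != 0 :> R by rewrite oppr_eq0 oner_eq0.
have := Rintegral_affine 0 0 0 n1 n1 hi.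
have -> : (fun x => cosT u (affine (-1) 0 0 (-1) 0 x) * sinT v (affine (-1) 0 0 (-1) 0 x))
    = (fun x => -1 * (cosT u x * sinT v x)).
  apply/funext => x.
  have dE y : dot y (affine (-1) 0 0 (-1) 0 x) = - dot y x.
    by rewrite /dot /affine/=; ring.
  have -> : cosT u (affine (-1) 0 0 (-1) 0 x) = cosT u x.
    by apply: eq_Rintegral => y _; rewrite dE mulrN cosN.
  have -> : sinT v (affine (-1) 0 0 (-1) 0 x) = -1 * sinT v x.
    rewrite -RintegralZl//; last exact: integrable_sinT.
    by apply: eq_Rintegral => y _; rewrite dE mulrN sinN mulrN mulN1r.
  by rewrite mulN1r mulrN mulN1r.
rewrite RintegralZl// mulrN1 normrN normrN1 mul1r mulN1r -/(ip _ _).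
by move: (ip _ _) => t; lra.
Qed.

Lemma ip_sinT_cosT u v : L1 u -> u \in L2 -> L1 v -> v \in L2 ->
  ip (sinT u) (cosT v) = 0.
Proof. by move=> hu hu2 hv hv2; rewrite ipC ip_cosT_sinT. Qed.

Lemma plancherel_polar u v : L1 u -> u \in L2 -> L1 v -> v \in L2 ->
  ip (cosT u) (cosT v) + ip (sinT u) (sinT v) = ip u v.
Proof.
move=> hu hu2 hv hv2.
have := plancherel_real (L1D hu hv) (L2D hu2 hv2).
have := plancherel_real hu hu2; have := plancherel_real hv hv2.
have cu := cosT_L2 hu hu2; have su := sinT_L2 hu hu2.
have cv := cosT_L2 hv hv2; have sv := sinT_L2 hv hv2.
rewrite /energy (cosTD hu hv) (sinTD hu hv).
rewrite (ip_sqrD hu2 hv2) (ip_sqrD cu cv) (ip_sqrD su sv).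
move: (ip u u) (ip u v) (ip v v) => a1 a2 a3.
move: (ip (cosT u) (cosT u)) (ip (cosT u) (cosT v)) (ip (cosT v) (cosT v)).
move: (ip (sinT u) (sinT u)) (ip (sinT u) (sinT v)) (ip (sinT v) (sinT v)).
by move=> s1 s2 s3 c1 c2 c3; lra.
Qed.

Definition re_ f : PL R -> R := fun x => complex.Re (f x).
Definition im_ f : PL R -> R := fun x => complex.Im (f x).

Lemma Re_mul (a b : R[i]) :
  complex.Re (a * b) = complex.Re a * complex.Re b - complex.Im a * complex.Im b.
Proof. by case: a => ? ?; case: b => ? ?. Qed.

Lemma Im_mul (a b : R[i]) :
  complex.Im (a * b) = complex.Re a * complex.Im b + complex.Im a * complex.Re b.
Proof. by case: a => ? ?; case: b => ? ?. Qed.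

Lemma Re_conj (a : R[i]) : complex.Re (conjc a) = complex.Re a.
Proof. by case: a. Qed.

Lemma Im_conj (a : R[i]) : complex.Im (conjc a) = - complex.Im a.
Proof. by case: a. Qed.

Lemma complex_ext (a b : R[i]) : complex.Re a = complex.Re b ->
  complex.Im a = complex.Im b -> a = b.
Proof. by case: a => ? ?; case: b => ? ? /= -> ->. Qed.

Lemma sqr_cabs (a : R[i]) : cabs a ^+ 2 = complex.Re a ^+ 2 + complex.Im a ^+ 2.
Proof.
by case: a => x y; rewrite sqr_sqrtr// addr_ge0// sqr_ge0.
Qed.

Lemma Re_fourier f w : L1 (re_ f) -> L1 (im_ f) ->
  complex.Re (fourier f w) = cosT (re_ f) w + sinT (im_ f) w.
Proof.
move=> hr hi; rewrite /= -RintegralD//.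
- by apply: eq_Rintegral => x _; rewrite Re_mul/= mulrN opprK.
- exact: integrable_cosT.
- exact: integrable_sinT.
Qed.

Lemma Im_fourier f w : L1 (re_ f) -> L1 (im_ f) ->
  complex.Im (fourier f w) = cosT (im_ f) w - sinT (re_ f) w.
Proof.
move=> hr hi; rewrite /= -RintegralB//.
- by apply: eq_Rintegral => x _; rewrite Im_mul/= mulrN addrC.
- exact: integrable_cosT.
- exact: integrable_sinT.
Qed.

(** The class on which [fourier] is an absolutely convergent integral and Parseval's identity holds
    at the same time. *)
Definition L12 f : Prop := [/\ L1 (re_ f), L1 (im_ f) & LpC 2%:E f].

Lemma re_fourier f : L12 f ->
  re_ (fourier f) = (fun w => cosT (re_ f) w + sinT (im_ f) w).
Proof. by move=> [hr hi _]; apply/funext => w; exact: Re_fourier. Qed.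

Lemma im_fourier f : L12 f ->
  im_ (fourier f) = (fun w => cosT (im_ f) w - sinT (re_ f) w).
Proof. by move=> [hr hi _]; apply/funext => w; exact: Im_fourier. Qed.

Lemma fourier_L2 f : L12 f -> LpC 2%:E (fourier f).
Proof.
move=> hf; have [hr hi [hr2 hi2]] := hf; split.
  rewrite -[X in X \in _]/(re_ (fourier f)) re_fourier//.
  by apply: L2D; [exact: cosT_L2|exact: sinT_L2].
rewrite -[X in X \in _]/(im_ (fourier f)) im_fourier//.
by apply: L2B; [exact: cosT_L2|exact: sinT_L2].
Qed.

Lemma Re_innerC f g : LpC 2%:E f -> LpC 2%:E g ->
  complex.Re (innerC f g) = ip (re_ f) (re_ g) + ip (im_ f) (im_ g).
Proof.
move=> [fr fi] [gr gi]; rewrite /= -RintegralD//; [|exact: L2_int..].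
by apply: eq_Rintegral => x _; rewrite Re_mul Re_conj Im_conj mulrN opprK.
Qed.

Lemma Im_innerC f g : LpC 2%:E f -> LpC 2%:E g ->
  complex.Im (innerC f g) = ip (im_ f) (re_ g) - ip (re_ f) (im_ g).
Proof.
move=> [fr fi] [gr gi]; rewrite /= -RintegralB//; [|exact: L2_int..].
by apply: eq_Rintegral => x _; rewrite Im_mul Re_conj Im_conj mulrN addrC.
Qed.

Lemma ip_combine (a b c d : PL R -> R) : a \in L2 -> b \in L2 -> c \in L2 -> d \in L2 ->
  ip (fun x => a x + b x) (fun x => c x + d x) = ip a c + ip a d + ip b c + ip b d.
Proof.
move=> ha hb hc hd; rewrite ipDl//; last exact: L2D.
by rewrite !(ipC mu2 _ (fun x => c x + d x)) !ipDl// !(ipC mu2 c) !(ipC mu2 d) !addrA.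
Qed.

Lemma ip_combineB (a b c d : PL R -> R) : a \in L2 -> b \in L2 -> c \in L2 -> d \in L2 ->
  ip (fun x => a x - b x) (fun x => c x - d x) = ip a c - ip a d - ip b c + ip b d.
Proof.
move=> ha hb hc hd; rewrite ipBl//; last exact: L2B.
rewrite !(ipC mu2 _ (fun x => c x - d x)) !ipBl// !(ipC mu2 c) !(ipC mu2 d).
by move: (ip a c) (ip a d) (ip b c) (ip b d) => *; ring.
Qed.

Lemma ip_combineDB (a b c d : PL R -> R) : a \in L2 -> b \in L2 -> c \in L2 -> d \in L2 ->
  ip (fun x => a x + b x) (fun x => c x - d x) = ip a c - ip a d + ip b c - ip b d.
Proof.
move=> ha hb hc hd; rewrite ipDl//; last exact: L2B.
rewrite !(ipC mu2 _ (fun x => c x - d x)) !ipBl// !(ipC mu2 c) !(ipC mu2 d).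
by move: (ip a c) (ip a d) (ip b c) (ip b d) => *; ring.
Qed.

(** Parity removes the products of a cosine with a sine transform; the remaining products are
    collected by the polarised real identity. *)
Lemma innerC_fourier f g : L12 f -> L12 g ->
  innerC (fourier f) (fourier g) = innerC f g.
Proof.
move=> hf hg; have Ff := fourier_L2 hf; have Fg := fourier_L2 hg.
have [fr fi [fr2 fi2]] := hf; have [gr gi [gr2 gi2]] := hg.
have cfr := cosT_L2 fr fr2; have sfr := sinT_L2 fr fr2.
have cfi := cosT_L2 fi fi2; have sfi := sinT_L2 fi fi2.
have cgr := cosT_L2 gr gr2; have sgr := sinT_L2 gr gr2.
have cgi := cosT_L2 gi gi2; have sgi := sinT_L2 gi gi2.
apply: complex_ext.
  rewrite !Re_innerC//.
  rewrite (re_fourier hf) (re_fourier hg) (im_fourier hf) (im_fourier hg).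
  rewrite (ip_combine cfr sfi cgr sgi) (ip_combineB cfi sfr cgi sgr).
  rewrite !ip_cosT_sinT// !ip_sinT_cosT//.
  rewrite -(plancherel_polar fr fr2 gr gr2) -(plancherel_polar fi fi2 gi gi2).
  by move: (ip _ _) (ip _ _) (ip _ _) (ip _ _) => *; ring.
rewrite !Im_innerC//.
rewrite (re_fourier hf) (re_fourier hg) (im_fourier hf) (im_fourier hg).
rewrite (ipC mu2 (fun w => cosT (im_ f) w - sinT (re_ f) w)).
rewrite (ip_combineDB cgr sgi cfi sfr) (ip_combineDB cfr sfi cgi sgr).
rewrite !ip_cosT_sinT// !ip_sinT_cosT// -(plancherel_polar fi fi2 gr gr2) -(plancherel_polar fr fr2 gi gi2).
rewrite (ipC mu2 (cosT (im_ f))) (ipC mu2 (sinT (im_ f)) (sinT (re_ g))).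
rewrite (ipC mu2 (sinT (im_ g))).
by move: (ip _ _) (ip _ _) (ip _ _) (ip _ _) => *; ring.
Qed.

End ComplexFourier.

(** * The Fourier transform of square-integrable functions *)

Section FourierL2.
Context {R : realType}.
Implicit Types (x y w : PL R) (u v : PL R -> R) (f g h : PL R -> R[i]).

Lemma enorm_ge0 (x : R * R) : 0 <= enorm x.
Proof. exact: sqrtr_ge0. Qed.

Lemma sqr_enorm (x : R * R) : enorm x ^+ 2 = x.1 ^+ 2 + x.2 ^+ 2.
Proof. by rewrite sqr_sqrtr// addr_ge0// sqr_ge0. Qed.

Lemma norm_fst_le_enorm (x : R * R) : `|x.1| <= enorm x.
Proof.
rewrite -(@ler_pXn2r _ 2)// ?nnegrE ?enorm_ge0// sqr_enorm real_normK ?num_real//.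
by rewrite lerDl sqr_ge0.
Qed.

Lemma norm_snd_le_enorm (x : R * R) : `|x.2| <= enorm x.
Proof.
rewrite -(@ler_pXn2r _ 2)// ?nnegrE ?enorm_ge0// sqr_enorm real_normK ?num_real//.
by rewrite lerDr sqr_ge0.
Qed.

Lemma measurable_enorm : measurable_fun setT (@enorm R : PL R -> R).
Proof.
apply: (@measurableT_comp _ _ _ _ _ _ (@Num.sqrt R)).
  by apply: continuous_measurable_fun => x; exact: sqrt_continuous.
by apply: measurable_funD; apply: measurable_funX;
  [exact: measurable_fst|exact: measurable_snd].
Qed.

Definition disk (r : R) : set (PL R) := [set x | enorm x <= r].

Lemma measurable_disk r : measurable (disk r).
Proof.
rewrite (_ : disk r = setT `&` enorm @^-1` `]-oo, r]%classic).
  by apply: measurable_enorm => //; exact: measurable_itv.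
by apply/seteqP; split => [x h|x [_]]; rewrite /= ?in_itv//=; split => //; rewrite /= in_itv.
Qed.

Lemma mu2_disk_fin r : (mu2 (disk r) < +oo)%E.
Proof.
apply: le_lt_trans (mu2_box_fin (- `|r| - 1) `|r| (- `|r| - 1) `|r|).
apply: le_measure; rewrite ?inE; [exact: measurable_disk|exact: measurable_box|].
move=> x /= xr; have xr' := le_trans xr (ler_norm r).
have := le_trans (norm_fst_le_enorm x) xr'.
have := le_trans (norm_snd_le_enorm x) xr'.
rewrite !ler_norml => /andP[h1 h2] /andP[h3 h4].
by split; rewrite /= in_itv/= ?h2 ?h4 andbT; [move: h3|move: h1];
  move: `|r| => t; lra.
Qed.

Lemma L2_indic_L1 u (A : set (PL R)) : measurable A -> (mu2 A < +oo)%E ->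
  u \in L2 -> L1 (fun x => u x * \1_A x).
Proof. by move=> mA Aoo hu; apply: L2_int => //; exact: indic_L2. Qed.

Lemma L2_indic u (A : set (PL R)) : measurable A -> u \in L2 ->
  (fun x => u x * \1_A x) \in L2.
Proof.
move=> mA hu; under eq_fun do rewrite mulrC.
apply: (L2_mul_bounded (c := 1) hu); first exact: measurable_indic.
by move=> x; rewrite indicE; case: (_ \in _); rewrite ?normr1 ?normr0.
Qed.

Lemma re_truncate n f : re_ (truncate n f) = (fun x => re_ f x * \1_(disk n%:R) x).
Proof.
apply/funext => x; rewrite /re_ /truncate indicE.
case: ifPn => h; first by rewrite mem_set// mulr1.
by rewrite memNset ?mulr0//=; exact/negP.
Qed.

Lemma im_truncate n f : im_ (truncate n f) = (fun x => im_ f x * \1_(disk n%:R) x).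
Proof.
apply/funext => x; rewrite /im_ /truncate indicE.
case: ifPn => h; first by rewrite mem_set// mulr1.
by rewrite memNset ?mulr0//=; exact/negP.
Qed.

Lemma truncate_L12 n f : LpC 2%:E f -> L12 (truncate n f).
Proof.
move=> [fr fi]; have md := measurable_disk n%:R; have dfin := mu2_disk_fin n%:R.
split; first by rewrite re_truncate; exact: L2_indic_L1.
  by rewrite im_truncate; exact: L2_indic_L1.
split.
  by rewrite -[X in X \in _]/(re_ (truncate n f)) re_truncate; exact: L2_indic.
by rewrite -[X in X \in _]/(im_ (truncate n f)) im_truncate; exact: L2_indic.
Qed.

Lemma L2cvg_disk u : u \in L2 -> L2cvg mu2 (fun n x => u x * \1_(disk n%:R) x) u.
Proof.
move=> hu; have mu_ := L2_measurable hu.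
apply: (@L2cvg_dominated _ _ _ _ _ _ (fun x => u x * u x)).
- move=> n; apply: measurable_funM => //.
  by apply: measurable_indic; exact: measurable_disk.
- by [].
- move=> x; apply: cvg_near_cst.
  exists (Num.bound (enorm x)) => // n /= hn.
  rewrite indicE mem_set ?mulr1//.
  apply: (le_trans (ltW (archi_boundP (enorm_ge0 x)))).
  by rewrite ler_nat.
- move=> n x; rewrite indicE; case: (_ \in _).
    by rewrite mulr1 subrr mulr0 -expr2 sqr_ge0.
  by rewrite mulr0 sub0r mulrNN.
- exact: L2_int.
Qed.

Lemma L2cvg_cauchy (un : nat -> PL R -> R) u : (forall n, un n \in L2) -> u \in L2 ->
  L2cvg mu2 un u -> forall e, 0 < e -> exists N, forall n m,
    (N <= n)%N -> (N <= m)%N ->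
    ip (fun x => un n x - un m x) (fun x => un n x - un m x) <= e.
Proof.
move=> hun hu /cvgr0Pnorm_le h e e0.
have e4 : 0 < e / 4 by rewrite divr_gt0.
have [N _ HN] := h _ e4; exists N => n m Nn Nm.
have := HN n Nn; have := HN m Nm; rewrite /= !ger0_norm ?ip_ge0// => hm hn.
have -> : (fun x => un n x - un m x) = (fun x => (un n x - u x) + - (un m x - u x)).
  by apply/funext => x; rewrite opprB addrA subrK.
apply: (le_trans (ip_sqrD_le (L2B (hun n) hu) (L2N (L2B (hun m) hu)))).
have -> : ip (fun x => - (un m x - u x)) (fun x => - (un m x - u x)) =
    ip (fun x => un m x - u x) (fun x => un m x - u x).
  by apply: eq_Rintegral => x _; rewrite mulrNN.
move: hm hn; move: (ip _ _) (ip _ _) => s t; lra.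
Qed.

(** By the isometry the transforms of the truncations are a Cauchy sequence along with the
    truncations, so completeness provides the limits. *)
Lemma cosT_sinT_limit u : u \in L2 -> exists C S : PL R -> R,
  [/\ C \in L2, S \in L2,
      L2cvg mu2 (fun n => cosT (fun x => u x * \1_(disk n%:R) x)) C &
      L2cvg mu2 (fun n => sinT (fun x => u x * \1_(disk n%:R) x)) S].
Proof.
move=> hu; pose un n x := u x * \1_(disk n%:R) x.
have h1 n : L1 (un n).
  by apply: L2_indic_L1 => //; [exact: measurable_disk|exact: mu2_disk_fin].
have h2 n : un n \in L2 by apply: L2_indic => //; exact: measurable_disk.
have cau := L2cvg_cauchy h2 hu (L2cvg_disk hu).
have key n m : ip (cosT (fun x => un n x - un m x)) (cosT (fun x => un n x - un m x)) +
    ip (sinT (fun x => un n x - un m x)) (sinT (fun x => un n x - un m x)) =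
    ip (fun x => un n x - un m x) (fun x => un n x - un m x).
  by apply: plancherel_real; [exact: L1B|exact: L2B].
have [C hC cC] : exists2 C, C \in L2 & L2cvg mu2 (fun n => cosT (un n)) C.
  apply: L2_complete; first by move=> n; exact: cosT_L2.
  move=> e e0; have [N HN] := cau e e0; exists N => n m Nn Nm.
  rewrite -(cosTB (h1 n) (h1 m)); apply: le_trans (HN n m Nn Nm).
  by rewrite -key lerDl ip_ge0.
have [S hS cS] : exists2 S, S \in L2 & L2cvg mu2 (fun n => sinT (un n)) S.
  apply: L2_complete; first by move=> n; exact: sinT_L2.
  move=> e e0; have [N HN] := cau e e0; exists N => n m Nn Nm.
  rewrite -(sinTB (h1 n) (h1 m)); apply: le_trans (HN n m Nn Nm).
  by rewrite -key lerDr ip_ge0.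
by exists C, S.
Qed.

Lemma L2cvgD (un vn : nat -> PL R -> R) u v : (forall n, un n \in L2) -> u \in L2 ->
    (forall n, vn n \in L2) -> v \in L2 -> L2cvg mu2 un u -> L2cvg mu2 vn v ->
  L2cvg mu2 (fun n x => un n x + vn n x) (fun x => u x + v x).
Proof.
move=> hun hu hvn hv cu cv; rewrite /L2cvg.
apply: (@squeeze_cvgr _ _ _ _ (fun=> 0) (fun n =>
  2 * ip (fun x => un n x - u x) (fun x => un n x - u x) +
  2 * ip (fun x => vn n x - v x) (fun x => vn n x - v x))).
- apply: nearW => n; rewrite ip_ge0/=.
  rewrite (_ : (fun x => un n x + vn n x - (u x + v x)) =
     (fun x => (un n x - u x) + (vn n x - v x))); last first.
    by apply/funext => x; ring.
  by apply: ip_sqrD_le; exact: L2B.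
- exact: cvg_cst.
- rewrite [X in _ --> X](_ : _ = 2 * 0 + 2 * 0); last by ring.
  by apply: cvgD; apply: cvgMl_tmp.
Qed.

Lemma L2cvgN (un : nat -> PL R -> R) u : L2cvg mu2 un u ->
  L2cvg mu2 (fun n x => - un n x) (fun x => - u x).
Proof.
rewrite /L2cvg => h; apply: cvg_trans h; apply: near_eq_cvg; apply: nearW => n.
by apply: eq_Rintegral => x _; rewrite -mulrNN; congr (_ * _); ring.
Qed.

Lemma integral_sqr_cabs f : LpC 2%:E f ->
  (\int[mu2]_x ((cabs (f x)) ^+ 2)%:E = (ip (re_ f) (re_ f) + ip (im_ f) (im_ f))%:E)%E.
Proof.
move=> [fr fi]; rewrite EFinD (ipE fr) (ipE fi) -ge0_integralD//.
- by apply: eq_integral => x _; rewrite sqr_cabs EFinD !expr2.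
- by move=> x _; rewrite lee_fin -expr2 sqr_ge0.
- by apply/measurable_EFinP; apply: measurable_funM; exact: (L2_measurable fr).
- by move=> x _; rewrite lee_fin -expr2 sqr_ge0.
- by apply/measurable_EFinP; apply: measurable_funM; exact: (L2_measurable fi).
Qed.

Lemma Re_sub (a b : R[i]) : complex.Re (a - b) = complex.Re a - complex.Re b.
Proof. by case: a => ? ?; case: b. Qed.

Lemma Im_sub (a b : R[i]) : complex.Im (a - b) = complex.Im a - complex.Im b.
Proof. by case: a => ? ?; case: b. Qed.

Lemma LpCB f g : LpC 2%:E f -> LpC 2%:E g -> LpC 2%:E (fun x => f x - g x).
Proof.
move=> [fr fi] [gr gi]; split.
  by under eq_fun do rewrite Re_sub; exact: L2B.
by under eq_fun do rewrite Im_sub; exact: L2B.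
Qed.

Lemma is_fourierL2P f g : LpC 2%:E f -> LpC 2%:E g -> is_fourierL2 f g <->
  L2cvg mu2 (fun n => re_ (fourier (truncate n f))) (re_ g) /\
  L2cvg mu2 (fun n => im_ (fourier (truncate n f))) (im_ g).
Proof.
move=> hf hg; have hF n := fourier_L2 (truncate_L12 n hf).
pose rn n := ip (fun w => re_ (fourier (truncate n f)) w - re_ g w)
  (fun w => re_ (fourier (truncate n f)) w - re_ g w).
pose in_ n := ip (fun w => im_ (fourier (truncate n f)) w - im_ g w)
  (fun w => im_ (fourier (truncate n f)) w - im_ g w).
have E : (fun n => \int[mu2]_w ((cabs (fourier (truncate n f) w - g w)) ^+ 2)%:E)%E =
    (fun n => (rn n + in_ n)%:E).
  apply/funext => n; rewrite integral_sqr_cabs; last exact: LpCB.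
  congr (_ + _)%:E; congr (ip _ _); apply/funext => w;
    by rewrite /re_ /im_ ?Re_sub ?Im_sub.
rewrite /is_fourierL2 E; split => [[_ h]|[hr hi]].
  have {}h : (fun n => rn n + in_ n) @ \oo --> (0 : R) by exact: (fine_cvg h).
  split; apply: (squeeze_cvgr _ (cvg_cst 0) h); apply: nearW => n;
    by rewrite ip_ge0/= ?lerDl ?lerDr ip_ge0.
split => //; apply: cvg_EFin; first exact: nearW.
by rewrite -[X in _ --> X]addr0; apply: cvgD.
Qed.

(** Existence of a limit is what makes [xget] return a transform of [f] rather than its default
    [0]. *)
Lemma fourierL2_spec f : LpC 2%:E f -> is_fourierL2 f (fourierL2 f).
Proof.
move=> hf; apply: xgetPex; have [fr fi] := hf.
have [Cr [Sr [hCr hSr cCr cSr]]] := cosT_sinT_limit fr.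
have [Ci [Si [hCi hSi cCi cSi]]] := cosT_sinT_limit fi.
pose g w : R[i] := (Cr w + Si w) +i* (Ci w - Sr w).
have hg : LpC 2%:E g by split; [exact: L2D|exact: L2B].
exists g; apply/is_fourierL2P => //.
have h1 n := L2_indic_L1 (measurable_disk n%:R) (mu2_disk_fin n%:R) fr.
have h2 n := L2_indic (measurable_disk n%:R) fr.
have h3 n := L2_indic_L1 (measurable_disk n%:R) (mu2_disk_fin n%:R) fi.
have h4 n := L2_indic (measurable_disk n%:R) fi.
split.
  have -> : (fun n => re_ (fourier (truncate n f))) = (fun n w =>
     cosT (fun x => re_ f x * \1_(disk n%:R) x) w +
     sinT (fun x => im_ f x * \1_(disk n%:R) x) w).
    by apply/funext => n; rewrite re_fourier ?re_truncate ?im_truncate//;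
      exact: truncate_L12.
  by apply: L2cvgD => // n; [exact: cosT_L2|exact: sinT_L2].
have -> : (fun n => im_ (fourier (truncate n f))) = (fun n w =>
   cosT (fun x => im_ f x * \1_(disk n%:R) x) w +
   - sinT (fun x => re_ f x * \1_(disk n%:R) x) w).
  by apply/funext => n; rewrite im_fourier ?re_truncate ?im_truncate//;
    exact: truncate_L12.
apply: L2cvgD => //.
- by move=> n; exact: cosT_L2.
- by move=> n; apply: L2N; exact: sinT_L2.
- exact: L2N.
- exact: L2cvgN.
Qed.

Lemma fourierL2_L2 f : LpC 2%:E f -> LpC 2%:E (fourierL2 f).
Proof. by move=> /fourierL2_spec[]. Qed.

(** Parseval holds for each truncation of [f], and both sides are continuous in [L^2]. This is the
    form in which [fourierL2] can be used without regard to its representative. *)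
Lemma innerC_fourierL2 g f : L12 g -> LpC 2%:E f ->
  innerC (fourier g) (fourierL2 f) = innerC g f.
Proof.
move=> hg hf; have hf' := fourierL2_L2 hf; have hg' := fourier_L2 hg.
have [cr ci] := (is_fourierL2P hf hf').1 (fourierL2_spec hf).
have ht n := truncate_L12 n hf; have hF n := fourier_L2 (ht n).
have [fr fi] := hf; have [gr gi hg2] := hg; have [gr2 gi2] := hg2.
have [f'r f'i] := hf'; have [g'r g'i] := hg'.
have tr : L2cvg mu2 (fun n => re_ (truncate n f)) (re_ f).
  by rewrite (_ : (fun n => re_ _) = (fun n x => re_ f x * \1_(disk n%:R) x));
    [exact: L2cvg_disk|apply/funext => n; exact: re_truncate].
have ti : L2cvg mu2 (fun n => im_ (truncate n f)) (im_ f).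
  by rewrite (_ : (fun n => im_ _) = (fun n x => im_ f x * \1_(disk n%:R) x));
    [exact: L2cvg_disk|apply/funext => n; exact: im_truncate].
have hFr n : re_ (fourier (truncate n f)) \in L2 by case: (hF n).
have hFi n : im_ (fourier (truncate n f)) \in L2 by case: (hF n).
have htr n : re_ (truncate n f) \in L2 by case: (ht n) => _ _ [].
have hti n : im_ (truncate n f) \in L2 by case: (ht n) => _ _ [].
have cvr (un : nat -> PL R -> R) u v : (forall n, un n \in L2) -> u \in L2 -> v \in L2 ->
    L2cvg mu2 un u -> (fun n => ip v (un n)) @ \oo --> ip v u.
  move=> hun hu hv c; under eq_cvg do rewrite ipC; rewrite ipC.
  exact: L2cvg_ip.
have lim_eq (s t : nat -> R) (a b : R) : s @ \oo --> a -> t @ \oo --> b ->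
    (forall n, s n = t n) -> a = b.
  move=> sa tb /funext st; rewrite st in sa.
  by rewrite -(cvg_lim (@Rhausdorff R) sa) -(cvg_lim (@Rhausdorff R) tb).
apply: complex_ext.
  rewrite !Re_innerC//.
  apply: (lim_eq
    (fun n => ip (re_ (fourier g)) (re_ (fourier (truncate n f))) +
              ip (im_ (fourier g)) (im_ (fourier (truncate n f))))
    (fun n => ip (re_ g) (re_ (truncate n f)) + ip (im_ g) (im_ (truncate n f)))).
  - by apply: cvgD; apply: cvr.
  - by apply: cvgD; apply: cvr.
  - by move=> n; rewrite -!Re_innerC ?innerC_fourier//; case: (ht n).
rewrite !Im_innerC//.
apply: (lim_eq
  (fun n => ip (im_ (fourier g)) (re_ (fourier (truncate n f))) -
            ip (re_ (fourier g)) (im_ (fourier (truncate n f))))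
  (fun n => ip (im_ g) (re_ (truncate n f)) - ip (re_ g) (im_ (truncate n f)))).
- by apply: cvgB; apply: cvr.
- by apply: cvgB; apply: cvr.
- by move=> n; rewrite -!Im_innerC ?innerC_fourier//; case: (ht n).
Qed.

End FourierL2.

(** * Smooth functions on the plane *)

Section SmoothFunctions.
Context {R : realType}.
Implicit Types (x y w : R * R) (phi chi : R * R -> R).
Local Notation e1 := ((1, 0) : R * R).
Local Notation e2 := ((0, 1) : R * R).

(** Difference quotients along an axis are those of a slice, so the one-variable rules apply to
    partial derivatives. *)
Let quotient1 phi x :
  (fun h => h^-1 *: ((phi \o shift x) (h *: e1) - phi x)) =
  (fun h => h^-1 *: (((fun s => phi (s, x.2)) \o shift x.1) (h *: 1) - phi (x.1, x.2))).
Proof.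
apply/funext => h /=; congr (_ *: (phi _ - phi _)); last by case: x.
by case: x => x1 x2; rewrite /shift/=; congr pair; rewrite /= ?scaler0 ?add0r.
Qed.

Lemma derivable_slice1 phi x :
  derivable phi x e1 = derivable (fun s => phi (s, x.2)) x.1 1.
Proof. by rewrite /derivable quotient1. Qed.

Lemma partial1_slice phi x : partial1 phi x = 'D_1 (fun s => phi (s, x.2)) x.1.
Proof. by rewrite /partial1 /derive quotient1. Qed.

Let quotient2 phi x :
  (fun h => h^-1 *: ((phi \o shift x) (h *: e2) - phi x)) =
  (fun h => h^-1 *: (((fun s => phi (x.1, s)) \o shift x.2) (h *: 1) - phi (x.1, x.2))).
Proof.
apply/funext => h /=; congr (_ *: (phi _ - phi _)); last by case: x.
by case: x => x1 x2; rewrite /shift/=; congr pair; rewrite /= ?scaler0 ?add0r.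
Qed.

Lemma derivable_slice2 phi x :
  derivable phi x e2 = derivable (fun s => phi (x.1, s)) x.2 1.
Proof. by rewrite /derivable quotient2. Qed.

Lemma partial2_slice phi x : partial2 phi x = 'D_1 (fun s => phi (x.1, s)) x.2.
Proof. by rewrite /partial2 /derive quotient2. Qed.

Lemma is_derive_slice1 phi x : derivable phi x e1 ->
  is_derive x.1 1 (fun s => phi (s, x.2)) (partial1 phi x).
Proof.
by rewrite derivable_slice1 partial1_slice => h; exact: DeriveDef.
Qed.

Lemma is_derive_slice2 phi x : derivable phi x e2 ->
  is_derive x.2 1 (fun s => phi (x.1, s)) (partial2 phi x).
Proof.
by rewrite derivable_slice2 partial2_slice => h; exact: DeriveDef.
Qed.

Lemma slice1_partial phi x d : is_derive x.1 1 (fun s => phi (s, x.2)) d ->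
  derivable phi x e1 /\ partial1 phi x = d.
Proof. by move=> [h1 h2]; rewrite derivable_slice1 partial1_slice. Qed.

Lemma slice2_partial phi x d : is_derive x.2 1 (fun s => phi (x.1, s)) d ->
  derivable phi x e2 /\ partial2 phi x = d.
Proof. by move=> [h1 h2]; rewrite derivable_slice2 partial2_slice. Qed.

Lemma CnW n phi : Cn n.+1 phi -> Cn n phi.
Proof.
elim: n phi => [|n IH] phi; first by move=> [].
move=> [c [d1 d2 h1 h2]]; split; first exact: c.
split; [exact d1|exact d2|exact (IH _ h1)|exact (IH _ h2)].
Qed.

Lemma CnD n phi chi : Cn n phi -> Cn n chi -> Cn n (fun x => phi x + chi x).
Proof.
elim: n phi chi => [|n IH] phi chi.
  by move=> [c _] [c' _]; split; [move=> x; apply: cvgD; [exact: c|exact: c']|].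
move=> [c [d1 d2 h1 h2]] [c' [d1' d2' h1' h2']].
have H1 x := @slice1_partial (fun y => phi y + chi y) x _ (is_derive_add (is_derive_slice1 (d1 x)) (is_derive_slice1 (d1' x))).
have H2 x := @slice2_partial (fun y => phi y + chi y) x _ (is_derive_add (is_derive_slice2 (d2 x)) (is_derive_slice2 (d2' x))).
split; first by move=> x; apply: cvgD; [exact: c|exact: c'].
split; [by move=> x; case: (H1 x)|by move=> x; case: (H2 x)| |].
  rewrite (_ : partial1 _ = fun x => partial1 phi x + partial1 chi x); first exact: IH.
  by apply/funext => x; case: (H1 x).
rewrite (_ : partial2 _ = fun x => partial2 phi x + partial2 chi x); first exact: IH.
by apply/funext => x; case: (H2 x).
Qed.

Lemma CnM n phi chi : Cn n phi -> Cn n chi -> Cn n (fun x => phi x * chi x).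
Proof.
elim: n phi chi => [|n IH] phi chi.
  by move=> [c _] [c' _]; split; [move=> x; apply: cvgM; [exact: c|exact: c']|].
(* The product rule also contains the undifferentiated factors, which the induction hypothesis takes
   at the lower order. *)
move=> hphi hchi; have hphiW := CnW hphi; have hchiW := CnW hchi.
move: hphi hchi => [c [d1 d2 h1 h2]] [c' [d1' d2' h1' h2']].
have xE x : (x.1, x.2) = x by case: x.
have H1 x := @slice1_partial (fun y => phi y * chi y) x _ (is_derive_mul (is_derive_slice1 (d1 x)) (is_derive_slice1 (d1' x))).
have H2 x := @slice2_partial (fun y => phi y * chi y) x _ (is_derive_mul (is_derive_slice2 (d2 x)) (is_derive_slice2 (d2' x))).
split; first by move=> x; apply: cvgM; [exact: c|exact: c'].
split; [by move=> x; case: (H1 x)|by move=> x; case: (H2 x)| |].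
  rewrite (_ : partial1 _ = fun x => partial1 phi x * chi x + phi x * partial1 chi x).
    by apply: CnD; exact: IH.
  by apply/funext => x; case: (H1 x) => _ ->; rewrite xE.
rewrite (_ : partial2 _ = fun x => partial2 phi x * chi x + phi x * partial2 chi x).
  by apply: CnD; exact: IH.
by apply/funext => x; case: (H2 x) => _ ->; rewrite xE.
Qed.

Definition dilate (c b1 b2 : R) x : R * R := (c * x.1 + b1, c * x.2 + b2).

Lemma continuous_dilate c b1 b2 : continuous (dilate c b1 b2).
Proof.
move=> x.
have h1 : c * y.1 + b1 @[y --> x] --> c * x.1 + b1.
  by apply: cvgD; [apply: cvgMl_tmp; exact: cvg_fst|exact: cvg_cst].
have h2 : c * y.2 + b2 @[y --> x] --> c * x.2 + b2.
  by apply: cvgD; [apply: cvgMl_tmp; exact: cvg_snd|exact: cvg_cst].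
exact (cvg_pair h1 h2).
Qed.

Lemma partial1_dilate c b1 b2 phi x : derivable phi (dilate c b1 b2 x) e1 ->
  derivable (fun y => phi (dilate c b1 b2 y)) x e1 /\
  partial1 (fun y => phi (dilate c b1 b2 y)) x = c * partial1 phi (dilate c b1 b2 x).
Proof.
move=> /is_derive_slice1 h.
exact (@slice1_partial (fun y => phi (dilate c b1 b2 y)) x _ (is_derive_aff h)).
Qed.

Lemma partial2_dilate c b1 b2 phi x : derivable phi (dilate c b1 b2 x) e2 ->
  derivable (fun y => phi (dilate c b1 b2 y)) x e2 /\
  partial2 (fun y => phi (dilate c b1 b2 y)) x = c * partial2 phi (dilate c b1 b2 x).
Proof.
move=> /is_derive_slice2 h.
exact (@slice2_partial (fun y => phi (dilate c b1 b2 y)) x _ (is_derive_aff h)).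
Qed.

(** The factor [k] makes the family stable under differentiation: each chain rule replaces [k] by
    [k * c]. *)
Lemma Cn_dilate n k c b1 b2 phi : Cn n phi ->
  Cn n (fun x => k * phi (dilate c b1 b2 x)).
Proof.
have cont chi : continuous chi -> continuous (fun x => k * chi (dilate c b1 b2 x)).
  move=> h x; apply: cvgMl_tmp.
  exact: (continuous_comp (@continuous_dilate c b1 b2 x) (h _)).
elim: n phi k cont => [|n IH] phi k cont; first by move=> [h _]; split; [exact: cont|].
move=> [h [d1 d2 h1 h2]].
have H1 x := @slice1_partial (fun y => k * phi (dilate c b1 b2 y)) x _ (is_derive_scalel k (is_derive_slice1 (partial1_dilate (d1 (dilate c b1 b2 x))).1)).
have H2 x := @slice2_partial (fun y => k * phi (dilate c b1 b2 y)) x _ (is_derive_scalel k (is_derive_slice2 (partial2_dilate (d2 (dilate c b1 b2 x))).1)).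
split; first exact: cont.
have cont' chi : continuous chi -> continuous (fun x => k * c * chi (dilate c b1 b2 x)).
  move=> hc x; apply: cvgMl_tmp.
  exact: (continuous_comp (@continuous_dilate c b1 b2 x) (hc _)).
split; [by move=> x; case: (H1 x)|by move=> x; case: (H2 x)| |].
  rewrite (_ : partial1 _ = fun x => k * c * partial1 phi (dilate c b1 b2 x)); first exact: IH.
  by apply/funext => x; case: (H1 x) => _ ->; rewrite (partial1_dilate (d1 _)).2 mulrA.
rewrite (_ : partial2 _ = fun x => k * c * partial2 phi (dilate c b1 b2 x)); first exact: IH.
by apply/funext => x; case: (H2 x) => _ ->; rewrite (partial2_dilate (d2 _)).2 mulrA.
Qed.

Lemma smooth_dilate c b1 b2 phi : smooth phi ->
  smooth (fun x => phi (dilate c b1 b2 x)).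
Proof.
move=> h n; have := Cn_dilate 1 c b1 b2 (h n).
by under eq_fun do rewrite mul1r.
Qed.

Lemma smoothM phi chi : smooth phi -> smooth chi -> smooth (fun x => phi x * chi x).
Proof. by move=> h h' n; exact: CnM. Qed.

Lemma smooth_continuous phi : smooth phi -> continuous phi.
Proof. by move=> /(_ 0%N)[]. Qed.

Lemma smooth_derivable2 phi x : smooth phi -> derivable phi x e2.
Proof. by move=> /(_ 1%N)[_ []]. Qed.

Lemma smooth_partial2 phi : smooth phi -> smooth (partial2 phi).
Proof. by move=> h n; case: (h n.+1) => _ []. Qed.

Lemma smooth_iter_partial2 n phi : smooth phi -> smooth (iter n partial2 phi).
Proof. by move=> h; elim: n => //= n IH; exact: smooth_partial2. Qed.

Lemma iter_partial2_shift n b1 b2 phi : smooth phi ->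
  iter n partial2 (fun x => phi (dilate 1 b1 b2 x)) =
  (fun x => iter n partial2 phi (dilate 1 b1 b2 x)).
Proof.
move=> h; elim: n => //= n ->; apply/funext => x.
by have d := @smooth_derivable2 _ (dilate 1 b1 b2 x) (smooth_iter_partial2 n h); rewrite (partial2_dilate d).2 mul1r.
Qed.

(** Equivalent to compact support in the plane, but passed on to products, derivatives and dilations
    without any closure. *)
Definition bounded_support phi : Prop :=
  exists K : R, forall x, phi x != 0 -> `|x.1| <= K /\ `|x.2| <= K.

Lemma compactly_supported_bounded phi :
  compactly_supported phi -> bounded_support phi.
Proof.
move=> /compact_bounded[M [_ HM]]; exists (M + 1) => x px.
have : `|x| <= M + 1.
  by apply: HM; [rewrite ltrDl|exact: subset_closure].
by rewrite prod_normE /= ge_max => /andP[].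
Qed.

Lemma bounded_compactly_supported phi :
  bounded_support phi -> compactly_supported phi.
Proof.
move=> [K HK].
have cK : compact (`[- K, K]%classic `*` `[- K, K]%classic : set (R * R)).
  by apply: compact_setX; exact: segment_compact.
apply: (subclosed_compact _ cK); first exact: closed_closure.
rewrite closureEbigcap; apply: bigcap_inf; split.
  apply: compact_closed; last exact cK.
  exact: norm_hausdorff.
by move=> x /= /HK[]; rewrite !ler_norml !in_itv.
Qed.

(** At a point off the box the function vanishes along a vertical neighbourhood, hence so does its
    derivative. If the first coordinate is already too large, the entire vertical line is off the
    box. *)
Lemma bounded_support_partial2 phi : bounded_support phi ->
  bounded_support (partial2 phi).
Proof.
move=> [K HK]; exists K => x px; apply: contrapT => out; move/eqP: px; apply.
have z y : (K < `|y.1|) || (K < `|y.2|) -> phi y = 0.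
  move=> h; apply/eqP; apply/negP => /negP /HK[].
  by rewrite !leNgt => /negPf h1 /negPf h2; move: h; rewrite h1 h2.
suff nz : \forall s \near x.2, phi (x.1, s) = 0.
  rewrite partial2_slice.
  rewrite (@near_eq_derive _ _ _ (fun s => phi (x.1, s)) (cst 0) _ 1 nz).
  exact (derive_cst _ _ _).
have /orP[h|h] : (K < `|x.1|) || (K < `|x.2|).
  by rewrite !ltNge -negb_and; apply/negP => /andP h; exact: out.
- by near=> s; rewrite z//= h.
have nc : `|s| @[s --> x.2] --> `|x.2| by exact: norm_continuous.
have hn : \forall s \near x.2, K < `|s|.
  exact (cvgr_gt _ nc _ h).
near=> s; apply: z; apply/orP; right; near: s; exact hn.
Unshelve. all: by end_near. Qed.

Lemma bounded_support_iter_partial2 n phi : bounded_support phi ->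
  bounded_support (iter n partial2 phi).
Proof. by move=> h; elim: n => //= n; exact: bounded_support_partial2. Qed.

Lemma bounded_support_dilate c b1 b2 phi : 0 < c -> bounded_support phi ->
  bounded_support (fun x => phi (dilate c b1 b2 x)).
Proof.
move=> c0 [K HK]; exists ((K + `|b1| + `|b2|) / c) => x /HK[]/=.
have bound b t : `|c * t + b| <= K -> `|t| <= (K + `|b|) / c.
  move=> h; rewrite ler_pdivlMr//.
  have -> : `|t| * c = `|(c * t + b) - b|.
    by rewrite addrK normrM (gtr0_norm c0) mulrC.
  by apply: (le_trans (ler_normB _ _)); rewrite lerD2r.
move=> /bound h1 /bound h2; split; [apply: (le_trans h1)|apply: (le_trans h2)].
all: rewrite ler_pM2r ?invr_gt0//.
  by rewrite -addrA lerD2l lerDl.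
by rewrite lerD2r lerDl.
Qed.

(** The plane carries the product sigma-algebra, so an open set is exhibited as a countable union of
    products of balls with rational centres and radii [1/(k+1)]. *)
Lemma measurable_open2 (O : set (R * R)) : open O -> measurable (O : set (PL R)).
Proof.
move=> oO.
pose B (p : rat * rat * nat) : set (PL R) :=
  ball (ratr p.1.1 : R) (p.2.+1%:R^-1) `*` ball (ratr p.1.2 : R) (p.2.+1%:R^-1).
rewrite (_ : O = \bigcup_(p in setT) (if `[< B p `<=` O >] then B p else set0)).
  apply: countable_bigcupT_measurable; first exact: countableP.
  by move=> p; case: ifP => // _; apply: measurableX; exact: measurable_ball.
apply/seteqP; split; last first.
  by move=> x [p _]; case: asboolP => // h /h.
move=> x Ox; have /nbhs_ballP[e /= e0 eO] := open_nbhs_nbhs (conj oO Ox).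
(* Two points of a ball of radius below [e / 2] are less than [e] apart, so a rational ball around
   the coordinate stays in the given one. *)
have [k ke] : exists k, k.+1%:R^-1 < e / 2.
  by have [k _ /(_ k (leqnn _))] := near_infty_natSinv_lt (PosNum (divr_gt0 e0 (ltr0Sn R 1))); exists k.
have k0 : 0 < (k.+1%:R^-1 : R) by rewrite invr_gt0.
have ex (t : R) : exists q : rat, ball (ratr q : R) k.+1%:R^-1 t /\
    ball (ratr q : R) k.+1%:R^-1 `<=` ball t e.
  move: k0 ke; set d := _^-1 => d0 ke.
  have /rat_in_itvoo[q] : t - d < t + d by lra.
  rewrite in_itv /= => /andP[h1 h2]; exists q; split.
    by rewrite /ball/= ltr_norml; apply/andP; split; lra.
  by move=> y; rewrite /ball/= !ltr_norml => /andP[? ?]; apply/andP; split; lra.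
have [q1 [h1 g1]] := ex x.1; have [q2 [h2 g2]] := ex x.2.
exists ((q1, q2), k) => //; rewrite asboolT; first by split.
by move=> y [/= /g1 y1 /g2 y2]; apply: eO; split.
Qed.

Lemma continuous_measurable2 phi : continuous phi ->
  measurable_fun setT (phi : PL R -> R).
Proof.
move=> c; apply: (measurability _ (RGenOInfty.measurableE R)).
move=> _ [_ [y ->] <-]; rewrite setTI; apply: measurable_open2.
apply: open_comp; first by move=> x _; exact: c.
by rewrite set_itvoy; exact: open_gt.
Qed.

Lemma bounded_support_bound phi : continuous phi -> bounded_support phi ->
  exists M, forall x, `|phi x| <= M.
Proof.
move=> c [K HK].
have cK : compact (`[- K, K]%classic `*` `[- K, K]%classic : set (R * R)).
  by apply: compact_setX; exact: segment_compact.
have := continuous_compact (continuous_subspaceT c) cK.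
move=> /compact_bounded[M [_ HM]]; exists (Num.max (M + 1) 0) => x.
have [->|/HK[h1 h2]] := eqVneq (phi x) 0.
  by rewrite normr0 le_max lexx orbT.
rewrite le_max HM ?ltrDl//; exists x => //=.
by rewrite !in_itv /= -!ler_norml.
Qed.
End SmoothFunctions.

(** * Integration by parts against characters *)

Section IntegrationByParts.
Context {R : realType}.
Implicit Types (x y w : R * R) (phi chi : R * R -> R).

Lemma bounded_box_L12 (u : PL R -> R) (K M : R) : measurable_fun setT u ->
    (forall x, `|u x| <= M) -> (forall x, u x != 0 -> `|x.1| <= K /\ `|x.2| <= K) ->
  L1 u /\ u \in L2.
Proof.
move=> mu uM uK.
have M0 : 0 <= M by apply: le_trans (uM (0, 0)); exact: normr_ge0.
(* Boxes are open on the left, so starting at [- K] would lose the points with a coordinate equal to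
   [- K]. *)
pose B := box (- K - 1) K (- K - 1) K : set (PL R).
have mB : measurable B by exact: measurable_box.
have B1 := indic_L1 mB (mu2_box_fin _ _ _ _).
have B2 := indic_L2 mB (mu2_box_fin _ _ _ _).
have uB x : `|u x| <= M * \1_B x.
  have [->|/uK[h1 h2]] := eqVneq (u x) 0.
    by rewrite normr0; apply: mulr_ge0.
  rewrite indicE mem_set ?mulr1//.
  move: h1 h2; rewrite !ler_norml => /andP[? ?] /andP[? ?].
  by split; rewrite /= in_itv /=; apply/andP; split; lra.
have uB' x : `|u x| <= `|M * \1_B x| := le_trans (uB x) (ler_norm _).
split; last exact: (L2_le mu (L2Z M B2)).
apply: (le_integrable _ _ _ (L1Z M B1)) => //; first exact/measurable_EFinP.
by move=> x _; rewrite /= lee_fin; exact: uB'.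
Qed.

Lemma bump_L12 phi : continuous phi -> bounded_support phi ->
  L1 phi /\ (phi : PL R -> R) \in L2.
Proof.
move=> c b; have [M HM] := bounded_support_bound c b; have [K HK] := b.
exact: (@bounded_box_L12 phi K M (continuous_measurable2 c) HM HK).
Qed.

Lemma Rintegral_derive0 (f F : R -> R) (K : R) : continuous f ->
    (forall t : R, is_derive t 1 F (f t)) -> (forall t, K < `|t| -> F t = 0) ->
    (forall t, K < `|t| -> f t = 0) ->
  \int[leb]_t f t = 0.
Proof.
(* [K] has no known sign; [|K| + 1] is positive and beyond the support. *)
move=> cf dF F0 f0; pose b : R := `|K| + 1.
have Kb : K < b by rewrite /b; apply: (le_lt_trans (ler_norm K)); rewrite ltrDl.
have b0 : 0 < b by rewrite /b ltr_wpDl.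
rewrite /Rintegral (_ : integral _ _ _ = (\int[leb]_(t in `[(- b)%R, b]) (f t)%:E)%E); last first.
  rewrite [RHS]integral_mkcond; apply: eq_integral => t _.
  rewrite patchE; case: ifPn => // /negP tb; rewrite f0//.
  rewrite ltNge; apply/negP => tK; apply: tb; rewrite inE /= in_itv /= -ler_norml.
  exact: (le_trans tK (ltW Kb)).
have cF := is_derive_continuous dF.
rewrite (@continuous_FTC2 _ f F).
- by rewrite !F0 ?normrN ?(gtr0_norm b0)// subee.
- by rewrite gtrN.
- exact: continuous_subspaceT.
- split; first by move=> t _; have [] := dF t.
  + exact: cvg_at_right_filter (cF _).
  + exact: cvg_at_left_filter (cF _).
- by move=> t _; rewrite derive1E; have [] := dF t.
Qed.

(** Fubini reduces the claim to vertical lines, on each of which the primitive vanishes at both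
    ends. *)
Lemma Rintegral_partial0 phi dphi : continuous dphi ->
    (forall x, is_derive x.2 1 (fun s => phi (x.1, s)) (dphi x)) ->
    bounded_support phi -> bounded_support dphi ->
  \int[mu2]_x dphi x = 0.
Proof.
move=> c d [K HK] bd; have [i1 _] := bump_L12 c bd; have [K' HK'] := bd.
rewrite (@Rintegral_fubini _ _ _ _ R leb leb dphi i1).
transitivity (\int[leb]_(x in [set: R]) (0 : R)); last first.
  by rewrite /Rintegral integral0.
apply: eq_Rintegral => t _.
apply: (@Rintegral_derive0 _ (fun s => phi (t, s)) (Num.max K K')).
- move=> s; apply: (@continuous_comp _ _ _ (fun s => (t, s)) dphi); last exact (c _).
  have h1 : t @[_ --> s] --> t by exact: cvg_cst.
  have h2 : r @[r --> s] --> s by exact: cvg_id.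
  exact (cvg_pair h1 h2).
- by move=> s; exact (d (t, s)).
- move=> s; rewrite gt_max => /andP[h _]; apply/eqP/negP => /negP/HK[_ /=].
  by rewrite leNgt h.
- move=> s; rewrite gt_max => /andP[_ h]; apply/eqP/negP => /negP/HK'[_ /=].
  by rewrite leNgt h.
Qed.

Lemma continuous_dot w : continuous (fun x => 2 * pi * dot x w).
Proof.
move=> x; apply: cvgMl_tmp; apply: cvgD; apply: cvgMr_tmp.
  exact: cvg_fst.
exact: cvg_snd.
Qed.

Lemma is_derive_dot w x (f : R -> R) df : is_derive (2 * pi * dot x w) 1 f df ->
  is_derive x.2 1 (fun s => f (2 * pi * dot (x.1, s) w)) (2 * pi * w.2 * df).
Proof.
have E s : 2 * pi * dot (x.1, s) w = 2 * pi * w.2 * s + 2 * pi * (x.1 * w.1).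
  by rewrite /dot /=; move: (@pi R) => p; ring.
rewrite (_ : dot x w = dot (x.1, x.2) w)// E => /is_derive_aff.
by under eq_fun do rewrite -E.
Qed.

Lemma bounded_supportMr phi chi : bounded_support phi ->
  bounded_support (fun x => phi x * chi x).
Proof. by move=> [K HK]; exists K => x; rewrite mulf_eq0 => /norP[/HK]. Qed.

Lemma bounded_supportD phi chi : bounded_support phi -> bounded_support chi ->
  bounded_support (fun x => phi x + chi x).
Proof.
move=> [K HK] [K' HK']; exists (Num.max K K') => x xn.
have [px|/HK[h1 h2]] := eqVneq (phi x) 0; last by rewrite !le_max h1 h2.
have [|h1 h2] := HK' x; last by rewrite !le_max h1 h2 !orbT.
by move: xn; rewrite px add0r.
Qed.

Section Bump.
Variables (phi : R * R -> R) (w : R * R).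
Hypotheses (sphi : smooth phi) (bphi : bounded_support phi).

Let dphi x := is_derive_slice2 (@smooth_derivable2 R phi x sphi).
Let cphi := smooth_continuous sphi.
Let cdphi := smooth_continuous (smooth_partial2 sphi).
Let bdphi := bounded_support_partial2 bphi.
Let k := 2 * pi * w.2.

(* [0] is the integral of the derivative of [phi x * f (2 pi (x . w))]. *)
Let by_parts (f df : R -> R) : continuous f -> continuous df ->
    (forall t : R, is_derive t 1 f (df t)) ->
  \int[mu2]_x (partial2 phi x * f (2 * pi * dot x w)
               + phi x * (k * df (2 * pi * dot x w))) = 0.
Proof.
move=> cf cdf d.
have cT (g : R -> R) : continuous g -> continuous (fun x => g (2 * pi * dot x w)).
  move=> cg x; exact (continuous_comp (@continuous_dot w x) (cg _)).
apply: (@Rintegral_partial0 (fun x => phi x * f (2 * pi * dot x w))).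
- move=> x; apply: cvgD; apply: cvgM; [exact (@cdphi x)|exact (@cT _ cf x)|exact (@cphi x)|].
  by apply: cvgMl_tmp; exact (@cT _ cdf x).
- move=> x; have := is_derive_mul (dphi x) (is_derive_dot (d (2 * pi * dot x w))).
  by case: x.
- exact: bounded_supportMr.
- by apply: bounded_supportD; exact: bounded_supportMr.
Qed.

Lemma cosT_partial2 : cosT (partial2 phi) w = k * sinT phi w.
Proof.
have [i1 _] := bump_L12 cphi bphi; have [i2 _] := bump_L12 cdphi bdphi.
have csin : continuous (fun t : R => - sin t).
  by move=> t; apply: cvgN; exact: continuous_sin.
have := @by_parts cos (fun t => - sin t) (@continuous_cos R) csin (@is_derive_cos R).
rewrite /cosT /sinT -RintegralZl//; last exact: integrable_sinT.
rewrite (_ : (fun x => _ + _) = (fun x => partial2 phi x * cos (2 * pi * dot x w)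
    - k * (phi x * sin (2 * pi * dot x w)))); last first.
  by apply/funext => x; move: (cos _) (sin _) => c s; ring.
rewrite RintegralB//; first by move=> /eqP; rewrite subr_eq0 => /eqP.
- exact: integrable_cosT.
- by apply: L1Z; exact: integrable_sinT.
Qed.

Lemma sinT_partial2 : sinT (partial2 phi) w = - k * cosT phi w.
Proof.
have [i1 _] := bump_L12 cphi bphi; have [i2 _] := bump_L12 cdphi bdphi.
have := @by_parts sin cos (@continuous_sin R) (@continuous_cos R) (@is_derive_sin R).
rewrite /cosT /sinT mulNr -RintegralZl//; last exact: integrable_cosT.
rewrite (_ : (fun x => _ + _) = (fun x => partial2 phi x * sin (2 * pi * dot x w)
    + k * (phi x * cos (2 * pi * dot x w)))); last first.
  by apply/funext => x; move: (cos _) (sin _) => c s; ring.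
rewrite RintegralD//; first by move=> /eqP; rewrite addr_eq0 => /eqP.
- exact: integrable_sinT.
- by apply: L1Z; exact: integrable_cosT.
Qed.
End Bump.
End IntegrationByParts.

(** * Affine changes of variables and weak derivatives *)

Section FourierAffine.
Context {R : realType}.
Implicit Types (x y w : PL R) (u v : PL R -> R) (f g h : PL R -> R[i]).

Lemma cabs_real (r : R) : cabs r%:C = `|r|.
Proof. by rewrite /= expr0n/= addr0 sqrtr_sqr. Qed.

Lemma cabs_conj (a : R[i]) : cabs (conjc a) = cabs a.
Proof. by case: a => a b /=; rewrite sqrrN. Qed.

Lemma cabs_ge0 (a : R[i]) : 0 <= cabs a.
Proof. by case: a => a b; exact: sqrtr_ge0. Qed.

Lemma cabsX (a : R[i]) n : cabs (a ^+ n) = cabs a ^+ n.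
Proof.
elim: n => [|n IH]; first by rewrite !expr0 -[1]/(1%:C) cabs_real normr1.
by rewrite !exprS cabsM IH.
Qed.

Lemma norm_Re_le_cabs (a : R[i]) : `|complex.Re a| <= cabs a.
Proof.
by case: a => a b; rewrite -sqrtr_sqr ler_wsqrtr// lerDl sqr_ge0.
Qed.

Section Affine.
Variables (c1 s d1 c2 d2 : R).
Hypotheses (c10 : c1 != 0) (c20 : c2 != 0).
Local Notation A := (affine c1 s d1 c2 d2).

(* The inverse transpose of the linear part of the affine map. *)
Definition dual_affine (w : R * R) : R * R :=
  (w.1 / c1, (w.2 - s * (w.1 / c1)) / c2).

Let dot_affine x w : dot x w = dot (A x) (dual_affine w) - dot (d1, d2) (dual_affine w).
Proof. by rewrite /dot /affine /dual_affine /=; field; rewrite ?c10 ?c20. Qed.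

Let angle w : R := 2 * pi * dot (d1, d2) (dual_affine w).

Let angleB x w : 2 * pi * dot x w = 2 * pi * dot (A x) (dual_affine w) - angle w.
Proof. by rewrite dot_affine mulrBr. Qed.

Lemma cosT_affine u w : L1 u -> `|c1 * c2| * cosT (fun x => u (A x)) w =
  cos (angle w) * cosT u (dual_affine w) + sin (angle w) * sinT u (dual_affine w).
Proof.
move=> hu; rewrite /cosT /sinT.
have i1 := integrable_cosT (dual_affine w) hu.
have i2 := integrable_sinT (dual_affine w) hu.
rewrite -[X in _ = X + _]RintegralZl// -[X in _ = _ + X]RintegralZl// -RintegralD//; [|exact: L1Z..].
have i3 := L1D (L1Z (cos (angle w)) i1) (L1Z (sin (angle w)) i2).
rewrite [RHS](Rintegral_affine s d1 d2 c10 c20 i3); congr (_ * _).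
apply: eq_Rintegral => x _; rewrite angleB cosB.
rewrite /=; move: (u _) (angle w) (2 * pi * _) => a b c.
by move: (cos b) (cos c) (sin b) (sin c) => *; ring.
Qed.

Lemma sinT_affine u w : L1 u -> `|c1 * c2| * sinT (fun x => u (A x)) w =
  cos (angle w) * sinT u (dual_affine w) - sin (angle w) * cosT u (dual_affine w).
Proof.
move=> hu; rewrite /cosT /sinT.
have i1 := integrable_cosT (dual_affine w) hu.
have i2 := integrable_sinT (dual_affine w) hu.
rewrite -[X in _ = X - _]RintegralZl// -[X in _ = _ - X]RintegralZl// -RintegralB//; [|exact: L1Z..].
have i3 := L1B (L1Z (cos (angle w)) i2) (L1Z (sin (angle w)) i1).
rewrite [RHS](Rintegral_affine s d1 d2 c10 c20 i3); congr (_ * _).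
apply: eq_Rintegral => x _; rewrite angleB sinB.
rewrite /=; move: (u _) (angle w) (2 * pi * _) => a b c.
by move: (cos b) (cos c) (sin b) (sin c) => *; ring.
Qed.

Lemma L1_affine u : L1 u -> L1 (fun x => u (A x)).
Proof. by move=> hu; exact (integrable_affine s d1 d2 c10 c20 hu). Qed.

Lemma fourier_affine f w : L1 (re_ f) -> L1 (im_ f) ->
  `|c1 * c2|%:C * fourier (fun x => f (A x)) w =
  (cos (angle w) +i* sin (angle w)) * fourier f (dual_affine w).
Proof.
move=> hr hi; have hr' := L1_affine hr; have hi' := L1_affine hi.
have h1 := cosT_affine w hr; have h2 := sinT_affine w hr.
have h3 := cosT_affine w hi; have h4 := sinT_affine w hi.
apply: complex_ext; rewrite ?Re_mul ?Im_mul !Re_fourier// !Im_fourier//= !mul0r.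
  rewrite subr0 mulrDr; apply: (etrans (congr2 +%R h1 h4)).
  by move: (cosT _ _) (sinT _ _) (cosT _ _) (sinT _ _) (cos _) (sin _) => *; ring.
rewrite addr0 mulrBr; apply: (etrans (congr2 (fun a b => a - b) h3 h2)).
by move: (cosT _ _) (sinT _ _) (cosT _ _) (sinT _ _) (cos _) (sin _) => *; ring.
Qed.

(** The translation contributes only a phase, which the modulus forgets. *)
Lemma cabs_fourier_affine f w : L1 (re_ f) -> L1 (im_ f) ->
  cabs (fourier (fun x => f (A x)) w) = cabs (fourier f (dual_affine w)) / `|c1 * c2|.
Proof.
move=> hr hi; have := congr1 (@cabs R) (fourier_affine w hr hi).
have n0 : `|c1 * c2| != 0 by rewrite normr_eq0 mulf_neq0.
rewrite !cabsM cabs_real normr_id => h; apply: (mulfI n0); rewrite h.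
by rewrite /= cos2Dsin2 sqrtr1 mul1r mulrCA divff// mulr1.
Qed.

End Affine.
End FourierAffine.

(** * Multiplier identities from translates *)

Section Multiplier.
Context {R : realType}.
Implicit Types (x y w : PL R) (u v : PL R -> R) (f g h p q : PL R -> R[i]).

Let mulrB_eq (a b c d e : R[i]) : a * c = d -> b * c = e -> (a - b) * c = d - e.
Proof. by move=> <- <-; rewrite mulrBl. Qed.

Lemma innerCC f g : LpC 2%:E f -> LpC 2%:E g -> innerC f g = conjc (innerC g f).
Proof.
move=> hf hg; apply: complex_ext; rewrite ?Re_conj ?Im_conj.
  by rewrite !Re_innerC// (ipC mu2 (re_ f)) (ipC mu2 (im_ f)).
by rewrite !Im_innerC// opprB (ipC mu2 (re_ g)) (ipC mu2 (im_ g)).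
Qed.

Lemma cintegralB f g : L1 (re_ f) -> L1 (im_ f) -> L1 (re_ g) -> L1 (im_ g) ->
  cintegral (fun x => f x - g x) = cintegral f - cintegral g.
Proof.
move=> fr fi gr gi; apply: complex_ext; rewrite ?Re_sub ?Im_sub /= -RintegralB//.
  by apply: eq_Rintegral => x _; rewrite Re_sub.
by apply: eq_Rintegral => x _; rewrite Im_sub.
Qed.

Lemma innerC_eq0 f : LpC 2%:E f -> innerC f f = 0 -> {ae mu2, forall x, f x = 0}.
Proof.
move=> hf h; have [fr fi] := hf.
have mf : measurable_fun setT (fun x => (cabs (f x) ^+ 2)%:E).
  apply/measurable_EFinP; rewrite (_ : (fun x => _) = fun x => re_ f x ^+ 2 + im_ f x ^+ 2).
    apply: measurable_funD; apply: measurable_funX.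
      exact: (L2_measurable fr).
    exact: (L2_measurable fi).
  by apply/funext => x; rewrite sqr_cabs.
have : (\int[mu2]_x `|(cabs (f x) ^+ 2)%:E| = 0)%E.
  rewrite -[RHS](_ : ((ip (re_ f) (re_ f) + ip (im_ f) (im_ f))%:E = 0)%E).
    rewrite -integral_sqr_cabs//; apply: eq_integral => x _.
    by rewrite gee0_abs// lee_fin sqr_ge0.
  by rewrite -Re_innerC// h.
move=> /(ae_eq_integral_abs mu2 measurableT mf).
apply: filterS => x /= /(_ I)[] /eqP; rewrite sqrf_eq0 => /eqP.
exact: ComplexField.Normc.eq0_normc.
Qed.

Lemma fourier_bounded f : L12 f ->
  exists c, forall w, `|re_ (fourier f) w| <= c /\ `|im_ (fourier f) w| <= c.
Proof.
move=> hf; have [hr hi _] := hf.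
exists (\int[mu2]_x `|re_ f x| + \int[mu2]_x `|im_ f x|) => w.
rewrite re_fourier// im_fourier//; split.
  by apply: (le_trans (ler_normD _ _)); apply: lerD; [exact: cosT_bound|exact: sinT_bound].
by apply: (le_trans (ler_normB _ _)); rewrite addrC; apply: lerD; [exact: sinT_bound|exact: cosT_bound].
Qed.

Lemma re_mul_conj f g : re_ (fun w => f w * conjc (g w)) =
  fun w => re_ f w * re_ g w + im_ f w * im_ g w.
Proof. by apply/funext => w; rewrite /re_ Re_mul Re_conj Im_conj mulrN opprK. Qed.

Lemma im_mul_conj f g : im_ (fun w => f w * conjc (g w)) =
  fun w => im_ f w * re_ g w - re_ f w * im_ g w.
Proof. by apply/funext => w; rewrite /im_ Im_mul Re_conj Im_conj mulrN [LHS]addrC. Qed.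

Lemma mul_conj_L1 f g : LpC 2%:E f -> LpC 2%:E g ->
  L1 (re_ (fun x => f x * conjc (g x))) /\ L1 (im_ (fun x => f x * conjc (g x))).
Proof.
move=> [fr fi] [gr gi]; rewrite re_mul_conj im_mul_conj.
by split; [apply: L1D|apply: L1B]; exact: L2_int.
Qed.

(** A product of two [L^2] functions is in [L^1], and a bounded function times an [L^2] function is
    in [L^2]. Thus Parseval applies to the product itself. *)
Lemma fourier_mul_L12 p f : L12 p -> LpC 2%:E f ->
  L12 (fun w => fourier p w * conjc (f w)).
Proof.
move=> hp hf; have [fr fi] := hf; have [c hc] := fourier_bounded hp.
have [i1 i2] := mul_conj_L1 (fourier_L2 hp) hf.
have [pr pi] := fourier_L2 hp.
have cr w : `|re_ (fourier p) w| <= c by case: (hc w).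
have ci w : `|im_ (fourier p) w| <= c by case: (hc w).
split; [exact i1|exact i2|split].
  rewrite -/(re_ _) re_mul_conj; apply: L2D.
    exact: (L2_mul_bounded fr (L2_measurable pr) cr).
  exact: (L2_mul_bounded fi (L2_measurable pi) ci).
rewrite -/(im_ _) im_mul_conj; apply: L2B.
  exact: (L2_mul_bounded fr (L2_measurable pi) ci).
exact: (L2_mul_bounded fi (L2_measurable pr) cr).
Qed.

Definition translate y f x : R[i] := f (affine 1 0 y.1 1 y.2 x).

Lemma L2_affine u c1 s d1 c2 d2 : c1 != 0 -> c2 != 0 -> u \in L2 ->
  (fun x => u (affine c1 s d1 c2 d2 x)) \in L2.
Proof.
move=> c10 c20 hu.
have m := measurableT_comp (L2_measurable hu) (measurable_affine c1 s d1 c2 d2).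
apply: L2P; first exact m.
have := L1_affine s d1 d2 c10 c20 (L2_int hu hu).
move=> /integrableP[mm]; apply: le_lt_trans; apply: ge0_le_integral => //.
- by move=> x _; rewrite lee_fin -expr2 sqr_ge0.
- by apply: measurableT_comp.
- by move=> x _; exact: lee_abs.
Qed.

Lemma L12_affine f c1 s d1 c2 d2 : c1 != 0 -> c2 != 0 -> L12 f ->
  L12 (fun x => f (affine c1 s d1 c2 d2 x)).
Proof.
move=> c10 c20 [hr hi [hr2 hi2]].
split; [exact (L1_affine s d1 d2 c10 c20 hr)|exact (L1_affine s d1 d2 c10 c20 hi)|].
by split; [exact (L2_affine s d1 d2 c10 c20 hr2)|exact (L2_affine s d1 d2 c10 c20 hi2)].
Qed.

Lemma fourier_translate y f w : L12 f -> fourier (translate y f) w =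
  (cos (2 * pi * dot y w) +i* sin (2 * pi * dot y w)) * fourier f w.
Proof.
move=> [hr hi _]; have := fourier_affine 0 y.1 y.2 (oner_neq0 R) (oner_neq0 R) w hr hi.
rewrite mulr1 normr1 mul1r => ->.
have -> : dual_affine 1 0 1 w = w.
  by case: w => a b; rewrite /dual_affine /= mul0r subr0 !divr1.
by case: y.
Qed.

(* The difference of the two sides is a function in [L^1 \cap L^2] whose Fourier
   transform at [- y] is the difference of the two inner products. *)
Lemma fourier_multiplier_eq p q f g : L12 p -> L12 q -> LpC 2%:E f -> LpC 2%:E g ->
    (forall y, innerC (translate y q) f = innerC (translate y p) g) ->
  {ae mu2, forall w, fourier q w * conjc (fourierL2 f w) =
                     fourier p w * conjc (fourierL2 g w)}.
Proof.
move=> hp hq hf hg H.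
pose a w := fourier q w * conjc (fourierL2 f w).
pose b w := fourier p w * conjc (fourierL2 g w).
have La : L12 a by apply: fourier_mul_L12 => //; exact: fourierL2_L2.
have Lb : L12 b by apply: fourier_mul_L12 => //; exact: fourierL2_L2.
have [ar ai a2] := La; have [br bi b2] := Lb.
have ab2 : LpC 2%:E (fun w => a w - b w) by exact: LpCB.
have rE : re_ (fun w => a w - b w) = fun w => re_ a w - re_ b w.
  by apply/funext => w; rewrite /re_ Re_sub.
have iE : im_ (fun w => a w - b w) = fun w => im_ a w - im_ b w.
  by apply/funext => w; rewrite /im_ Im_sub.
have ab : L12 (fun w => a w - b w).
  by split; [rewrite rE; exact: L1B|rewrite iE; exact: L1B|].
have tr r y : L12 r -> L12 (translate y r) by move=> hr; apply: L12_affine.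
have F0 : fourier (fun w => a w - b w) = fun=> 0.
  apply/funext => y'; pose y : PL R := - y'.
  have [Pr Pi _] := fourier_mul_L12 (tr q y hq) (fourierL2_L2 hf).
  have [Qr Qi _] := fourier_mul_L12 (tr p y hp) (fourierL2_L2 hg).
  have E r f' w : L12 r -> fourier r w * conjc (fourierL2 f' w) *
      (cos (2 * pi * dot w y') -i* sin (2 * pi * dot w y')) =
      fourier (translate y r) w * conjc (fourierL2 f' w).
    move=> hr.
    rewrite fourier_translate// mulrAC; congr (_ * _); rewrite mulrC; congr (_ * _).
    have -> : dot y w = - dot w y'.
      by rewrite /dot /= !mulNr -opprD ![w.1 * _]mulrC ![w.2 * _]mulrC.
    by rewrite mulrN cosN sinN.
  rewrite /fourier (_ : (fun w => _) = fun w =>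
      (fourier (translate y q) w * conjc (fourierL2 f w)) -
      (fourier (translate y p) w * conjc (fourierL2 g w))).
    rewrite (cintegralB Pr Pi Qr Qi).
    have E1 := innerC_fourierL2 (tr q y hq) hf.
    have E2 := innerC_fourierL2 (tr p y hp) hg.
    by rewrite -H -E1 in E2; rewrite [X in _ - X]E2 subrr.
  apply/funext => w.
  exact (mulrB_eq (E q f w hq) (E p g w hp)).
(* Injectivity of the transform on [L12]: Parseval for the difference with itself gives it norm
   zero. *)
have := innerC_eq0 ab2; rewrite -(innerC_fourier ab ab) F0.
have -> : innerC (fun _ : R * R => 0) (fun=> 0) = 0 :> R[i].
  rewrite /innerC (_ : (fun x => _) = fun=> 0); last first.
    by apply/funext => x; rewrite mul0r.
  by rewrite /cintegral /Rintegral integral0.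
move=> /(_ erefl); apply: filterS => w /eqP; rewrite subr_eq0 => /eqP.
by [].
Qed.
End Multiplier.

(** * Weak derivatives on the Fourier side *)

Section Sobolev.
Context {R : realType}.
Implicit Types (x y w : PL R) (u v : PL R -> R) (f g h p q : PL R -> R[i]) (phi eta : R * R -> R).

Definition realC u x : R[i] := (u x)%:C.

Lemma L1_0 : L1 (fun _ : PL R => 0 : R).
Proof. exact: integrable0. Qed.

Lemma realC_L12 u : L1 u -> u \in L2 -> L12 (realC u).
Proof. by move=> h1 h2; split; [exact h1|exact L1_0|split; [exact h2|exact: L2_0]]. Qed.

Lemma fourier_real u w : L1 u -> fourier (realC u) w = cosT u w -i* sinT u w.
Proof.
move=> hu; apply: complex_ext; rewrite ?Re_fourier ?Im_fourier//=; try exact: L1_0.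
  rewrite [X in _ + X](_ : _ = 0) ?addr0//.
  by rewrite /sinT /Rintegral (eq_integral (fun=> 0%E)) ?integral0// => x _; rewrite mul0r.
rewrite [X in X - _](_ : _ = 0) ?sub0r//.
by rewrite /cosT /Rintegral (eq_integral (fun=> 0%E)) ?integral0// => x _; rewrite mul0r.
Qed.

Lemma fourier_realZ (c : R) u w : L1 u ->
  fourier (realC (fun x => c * u x)) w = c%:C * fourier (realC u) w.
Proof.
move=> hu; rewrite !fourier_real//; last exact: L1Z.
by rewrite cosTZ// sinTZ//; apply: complex_ext; rewrite ?Re_mul ?Im_mul /= !mul0r ?subr0 ?addr0 ?mulrN.
Qed.

Lemma fourier_partial2 phi w : smooth phi -> bounded_support phi ->
  fourier (realC (partial2 phi)) w = (0 +i* (2 * pi * w.2)) * fourier (realC phi) w.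
Proof.
move=> sp bp.
have [i1 _] := bump_L12 (smooth_continuous sp) bp.
have [i2 _] := bump_L12 (smooth_continuous (smooth_partial2 sp)) (bounded_support_partial2 bp).
rewrite !fourier_real// cosT_partial2// sinT_partial2//.
by apply: complex_ext; rewrite ?Re_mul ?Im_mul /=; move: (cosT _ _) (sinT _ _) (2 * pi * _) => *; ring.
Qed.

Lemma fourier_iter_partial2 n phi w : smooth phi -> bounded_support phi ->
  fourier (realC (iter n partial2 phi)) w =
  (0 +i* (2 * pi * w.2)) ^+ n * fourier (realC phi) w.
Proof.
move=> sp bp; elim: n => [|n IH]; first by rewrite expr0 mul1r.
rewrite /= fourier_partial2; last 2 first.
- exact: smooth_iter_partial2.
- exact: bounded_support_iter_partial2.
by rewrite IH exprS mulrA.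
Qed.

Lemma cintegralZ (c : R) f : L1 (re_ f) -> L1 (im_ f) ->
  cintegral (fun x => c%:C * f x) = c%:C * cintegral f.
Proof.
move=> fr fi; apply: complex_ext; rewrite ?Re_mul ?Im_mul /= mul0r ?subr0 ?addr0 -RintegralZl//.
  by apply: eq_Rintegral => x _; rewrite Re_mul /= mul0r subr0.
by apply: eq_Rintegral => x _; rewrite Im_mul /= mul0r addr0.
Qed.

Lemma conjc_real (r : R) : conjc r%:C = r%:C.
Proof. by rewrite /= oppr0. Qed.

Lemma innerC_real f u : innerC f (realC u) = cintegral (fun x => f x * (u x)%:C).
Proof. by congr cintegral; apply/funext => x; rewrite conjc_real. Qed.

Lemma mul_realC_L1 f u : LpC 2%:E f -> u \in L2 ->
  L1 (re_ (fun x => f x * (u x)%:C)) /\ L1 (im_ (fun x => f x * (u x)%:C)).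
Proof.
move=> [fr fi] hu.
have -> : re_ (fun x => f x * (u x)%:C) = fun x => re_ f x * u x.
  by apply/funext => x; rewrite /re_ Re_mul /= mulr0 subr0.
have -> : im_ (fun x => f x * (u x)%:C) = fun x => im_ f x * u x.
  by apply/funext => x; rewrite /im_ Im_mul /= mulr0 add0r.
by split; exact: L2_int.
Qed.

Lemma Rintegral_gt0 phi (x0 : R * R) : L1 phi -> continuous phi ->
  (forall x, 0 <= phi x) -> 0 < phi x0 -> 0 < \int[mu2]_x phi x.
Proof.
move=> i c p0 px0; pose k := phi x0 / 2.
have k0 : 0 < k by rewrite divr_gt0.
have : \forall x \near x0, k < phi x.
  by apply: (cvgr_gt _ (c x0)); rewrite /k ltr_pdivrMr// mulr_natr mulr2n ltrDl.
move=> /nbhs_ballP[e /= e0 He].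
pose B := box (x0.1 - e / 2) (x0.1 + e / 2) (x0.2 - e / 2) (x0.2 + e / 2).
have mB : measurable B by exact: measurable_box.
have mBE : mu2 B = (e * e)%:E.
  by rewrite mu2_box; [congr EFin; field|lra|lra].
have iB : L1 (\1_B : PL R -> R) by apply: indic_L1 => //; rewrite mBE ltry.
apply: (@lt_le_trans _ _ (\int[mu2]_x (k * \1_B x))).
  rewrite RintegralZl//; apply: mulr_gt0 => //.
  have -> : \int[mu2]_x (\1_B x) = ip \1_B \1_B.
    apply: eq_Rintegral => x _; rewrite indicE.
    by case: (_ \in _); rewrite ?mulr1 ?mulr0.
  by rewrite ip_indic// mBE /= mulr_gt0.
apply: le_Rintegral => //; first exact: L1Z.
move=> x _; rewrite indicE; have [|] := boolP (x \in B); last by rewrite mulr0.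
rewrite mulr1 inE => -[/=]; rewrite !in_itv /= => /andP[h1 h2] /andP[h3 h4].
apply/ltW; apply: He; split; rewrite /ball/= ltr_norml; apply/andP; split; lra.
Qed.

(** Once the support is shrunk enough, every angle [2 pi x . w] on it lies where the cosine is
    positive, so the integrand is nonnegative and not identically zero. The threshold for [n]
    depends on [w]. *)
Lemma cosT_bump_gt0 eta (x0 : R * R) w : continuous eta -> bounded_support eta ->
    (forall x, 0 <= eta x) -> 0 < eta x0 ->
  \forall n \near \oo, 0 < cosT (fun x => eta (dilate n.+1%:R 0 0 x)) w.
Proof.
move=> c [K HK] p0 px0.
have : \forall t \near (0 : R), 0 < cos t.
  by apply: (cvgr_gt _ (@continuous_cos R 0)); rewrite cos0.
move=> /nbhs_ballP[e /= e0 He].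
(* On the support, [n + 1] times the angle is at most [S]. The sign of [K] is unknown, hence [|S|]
   below. *)
pose S := 2 * pi * (K * (`|w.1| + `|w.2|)).
have [N _ HN] : \forall n \near \oo, n.+1%:R^-1 < e / (1 + `|S|).
  have d0 : 0 < e / (1 + `|S|) by rewrite divr_gt0// ltr_wpDr.
  exact: (near_infty_natSinv_lt (PosNum d0)).
exists N => // n /HN Sn.
have n0 : 0 < (n.+1%:R : R) by [].
have {}Sn : `|S| < e * n.+1%:R.
  move: Sn; rewrite ltr_pdivlMr; last by rewrite ltr_wpDr.
  rewrite mulrC ltr_pdivrMr// => Sn; apply: le_lt_trans Sn; lra.
pose eta' x := eta (dilate n.+1%:R 0 0 x).
have ceta' : continuous eta'.
  move=> x; exact (continuous_comp (@continuous_dilate R n.+1%:R 0 0 x) (c _)).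
have beta' : bounded_support eta' by apply: bounded_support_dilate => //; exists K.
pose u (x : R * R) := eta' x * cos (2 * pi * dot x w).
have cu : continuous u.
  move=> x; apply: cvgM; first exact (ceta' x).
  exact (continuous_comp (@continuous_dot R w x) (@continuous_cos R _)).
have cpos x : eta' x != 0 -> 0 < cos (2 * pi * dot x w).
  move=> /HK[/= h1 h2]; apply: He; rewrite /ball/= sub0r normrN.
  rewrite -(ltr_pM2r n0); apply: le_lt_trans Sn; apply: le_trans (ler_norm _).
  have pi0 : 0 <= (2 * pi : R) by rewrite mulr_ge0// pi_ge0.
  have -> : `|2 * pi * dot x w| * n.+1%:R = 2 * pi * `|dot x w * n.+1%:R|.
    by rewrite (normrM (2 * pi)) (ger0_norm pi0) (normrM (dot x w)) (gtr0_norm n0) mulrA.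
  rewrite /S; apply: ler_wpM2l => //; rewrite mulrDr.
  have -> : dot x w * n.+1%:R = (n.+1%:R * x.1 + 0) * w.1 + (n.+1%:R * x.2 + 0) * w.2.
    by rewrite /dot; ring.
  apply: (le_trans (ler_normD _ _)); rewrite !normrM.
  by apply: lerD; apply: ler_wpM2r.
apply: (@Rintegral_gt0 u (dilate n.+1%:R^-1 0 0 x0)) => //.
- by apply: (bump_L12 cu _).1; exact: bounded_supportMr.
- move=> x; have [h|/cpos/ltW h] := eqVneq (eta' x) 0; first by rewrite /u h mul0r.
  by apply: mulr_ge0 => //; exact: p0.
have E : eta' (dilate n.+1%:R^-1 0 0 x0) = eta x0.
  rewrite /eta' /dilate /= !addr0 !mulrA divff ?gt_eqF// !mul1r.
  by case: (x0).
by apply: mulr_gt0; [rewrite E|apply: cpos; rewrite E gt_eqF].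
Qed.
End Sobolev.

Section SobolevBound.
Context {R : realType}.
Implicit Types (x y w : PL R) (u v : PL R -> R) (f g h psi : PL R -> R[i]) (phi eta : R * R -> R).

Lemma measurable_cabs f : measurable_fun setT (re_ f) -> measurable_fun setT (im_ f) ->
  measurable_fun setT (fun x => cabs (f x)).
Proof.
move=> mr mi; rewrite (_ : (fun x => _) = fun x => Num.sqrt (re_ f x ^+ 2 + im_ f x ^+ 2)).
  apply: (@measurableT_comp _ _ _ _ _ _ (@Num.sqrt R)).
    by apply: continuous_measurable_fun => x; exact: sqrt_continuous.
  by apply: measurable_funD; exact: measurable_funX.
by apply/funext => x; rewrite /re_ /im_; case: (f x).
Qed.

Lemma LpC_measurable_cabs f : LpC 2%:E f -> measurable_fun setT (fun x => cabs (f x)).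
Proof.
by move=> [fr fi]; apply: measurable_cabs; [exact: (L2_measurable fr)|exact: (L2_measurable fi)].
Qed.

Let cabs_multiplier (q k p r a b : R[i]) (c : R) n : q = k ^+ n * r -> p = c%:C * r ->
  `|c| = 1 -> q * conjc a = p * conjc b ->
  cabs r * (cabs k ^+ n * cabs a) = cabs r * cabs b.
Proof.
move=> -> -> c1 /(congr1 (@cabs R)).
rewrite !cabsM !cabs_conj cabsX cabs_real c1 mul1r => <-.
by rewrite mulrA [cabs r * _]mulrC.
Qed.

(** The transform of [eta] stays on both sides because it may vanish at [w]; it is cancelled later,
    by a dilation of [eta] that depends on [w]. Moduli suffice and dispose of signs and
    conjugates. *)
Lemma fourierL2_weak_partial L psi g eta : LpC 2%:E psi -> LpC 2%:E g ->
    weak_partial 0 L psi g -> smooth eta -> bounded_support eta ->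
  {ae mu2, forall w, cabs (fourier (realC eta) w) *
     ((2 * pi * `|w.2|) ^+ L * cabs (fourierL2 psi w)) =
   cabs (fourier (realC eta) w) * cabs (fourierL2 g w)}.
Proof.
move=> hpsi hg wp sp bp.
have [e1 e2] := bump_L12 (smooth_continuous sp) bp.
have sd := smooth_iter_partial2 L sp; have bd := bounded_support_iter_partial2 L bp.
have [d1 d2] := bump_L12 (smooth_continuous sd) bd.
pose c : R := (-1) ^+ L.
have Lq : L12 (realC (iter L partial2 eta)) by exact: realC_L12.
have Lp : L12 (realC (fun x => c * eta x)).
  by apply: realC_L12; [exact: L1Z|exact: L2Z].
have H y : innerC (translate y (realC (iter L partial2 eta))) psi =
           innerC (translate y (realC (fun x => c * eta x))) g.
  pose ey x := eta (dilate 1 y.1 y.2 x).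
  have sy : smooth ey by exact: smooth_dilate.
  have by_ : bounded_support ey by apply: bounded_support_dilate.
  have [y1 y2] := bump_L12 (smooth_continuous sy) by_.
  have aE x : affine 1 0 y.1 1 y.2 x = dilate 1 y.1 y.2 x.
    by rewrite /affine /dilate mul0r addr0.
  have qE : translate y (realC (iter L partial2 eta)) = realC (iter L partial2 ey).
    by rewrite iter_partial2_shift//; apply/funext => x; rewrite /translate aE.
  have pE : translate y (realC (fun x => c * eta x)) = realC (fun x => c * ey x).
    by apply/funext => x; rewrite /translate aE.
  have Ly1 : L12 (realC (iter L partial2 ey)) by rewrite -qE; apply: L12_affine.
  have Ly2 : L12 (realC (fun x => c * ey x)) by rewrite -pE; apply: L12_affine.
  (* [weak_partial] has the test function in the second place and no conjugate on [psi], so both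
     inner products are swapped at the price of a common conjugation. *)
  rewrite qE pE (innerCC _ hpsi); last by case: Ly1.
  rewrite (innerCC _ hg); last by case: Ly2.
  congr conjc; rewrite !innerC_real.
  have := wp ey sy (bounded_compactly_supported by_); rewrite add0n /= => ->.
  have [m1 m2] := mul_realC_L1 hg y2.
  have -> : (fun x => g x * (c * ey x)%:C) = (fun x => c%:C * (g x * (ey x)%:C)).
    by apply/funext => x; rewrite rmorphM/= mulrCA.
  rewrite cintegralZ//; congr (_ * _); rewrite /c.
  by rewrite -[-1]/((-1)%R) rmorphXn rmorphN1.
have := fourier_multiplier_eq Lp Lq hpsi hg H.
apply: filterS => w E.
have kE : cabs (0 +i* (2 * pi * w.2)) = 2 * pi * `|w.2|.
  rewrite /= expr0n/= add0r sqrtr_sqr normrM ger0_norm//.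
  by rewrite mulr_ge0// pi_ge0.
have c1 : `|c| = 1 by rewrite /c normrX normrN1 expr1n.
rewrite -kE.
exact (cabs_multiplier (fourier_iter_partial2 L w sp bp) (fourier_realZ c w e1) c1 E).
Qed.

Let sqr_multiplier_le (a b t : R) n : 0 <= a -> 0 <= t -> (2 * pi * t) ^+ n * a = b ->
  (t ^+ n * a) ^+ 2 <= b ^+ 2.
Proof.
move=> a0 t0 <-.
have pi1 : 1 <= 2 * (pi : R) by have := pi_ge2 R; lra.
have tt : t <= 2 * pi * t by rewrite ler_peMl.
have tt0 := le_trans t0 tt.
apply: lerXn2r; rewrite ?nnegrE; try (by apply: mulr_ge0 => //; apply: exprn_ge0).
by apply: ler_wpM2r => //; apply: lerXn2r; rewrite ?nnegrE.
Qed.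

(** Any bump that is nonzero somewhere will do: its square is nonnegative, and the dilations of the
    square have a transform that is eventually nonzero at each [w]. *)
Lemma sobolev_fourierL2 L psi phi (x0 : R * R) : sobolevH 0 L psi ->
    smooth phi -> bounded_support phi -> phi x0 != 0 ->
  (\int[mu2]_w ((`|w.2| ^+ L * cabs (fourierL2 psi w)) ^+ 2)%:E < +oo)%E.
Proof.
move=> [hpsi [g hg wp]] sp bp px0.
pose eta x := phi x * phi x.
have seta : smooth eta by exact: smoothM.
have beta : bounded_support eta by exact: bounded_supportMr.
pose en n x := eta (dilate n.+1%:R 0 0 x).
have sn n : smooth (en n) by exact: smooth_dilate.
have bn n : bounded_support (en n) by exact: bounded_support_dilate.
(* The useful dilation varies with [w], so all of them must hold off one null set; countably many
   dilations make this possible. *)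
have all_n : {ae mu2, forall w, forall n, cabs (fourier (realC (en n)) w) *
     ((2 * pi * `|w.2|) ^+ L * cabs (fourierL2 psi w)) =
   cabs (fourier (realC (en n)) w) * cabs (fourierL2 g w)}.
  by apply: ae_foralln => n; exact: fourierL2_weak_partial.
have fin := integral_sqr_cabs (fourierL2_L2 hg).
have mpsi := LpC_measurable_cabs (fourierL2_L2 hpsi).
have mw : measurable_fun setT (fun w : PL R => `|w.2| ^+ L).
  by apply: measurable_funX; apply: measurableT_comp; [exact: normr_measurable|exact: measurable_snd].
have mg := LpC_measurable_cabs (fourierL2_L2 hg).
apply: (@le_lt_trans _ _ (\int[mu2]_w (cabs (fourierL2 g w) ^+ 2)%:E)%E); last first.
  by rewrite fin ltry.
apply: ae_ge0_le_integral => //.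
- by move=> x _; rewrite lee_fin sqr_ge0.
- apply/measurable_EFinP; exact (measurable_funX 2 (measurable_funM mw mpsi)).
- by move=> x _; rewrite lee_fin sqr_ge0.
- apply/measurable_EFinP; exact (measurable_funX 2 mg).
apply: filterS all_n => w hw _.
have eta0 : 0 < eta x0 by rewrite /eta -expr2 exprn_even_gt0.
have eta_ge0 x : 0 <= eta x by rewrite /eta -expr2 sqr_ge0.
have [N _ HN] := cosT_bump_gt0 w (smooth_continuous seta) beta eta_ge0 eta0.
have k0 : 0 < cabs (fourier (realC (en N)) w).
  have [i1 _] := bump_L12 (smooth_continuous (sn N)) (bn N).
  apply: lt_le_trans (norm_Re_le_cabs _); rewrite fourier_real//=.
  by rewrite gtr0_norm; exact: (HN N (leqnn N)).
have E := mulfI (lt0r_neq0 k0) (hw N).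
rewrite lee_fin.
exact (sqr_multiplier_le (cabs_ge0 _) (normr_ge0 _) E).
Qed.
End SobolevBound.

(** * Estimates of the shearlet coefficients *)

Section Modulus.
Context {R : realType}.
Implicit Types (x y w : PL R) (u v : PL R -> R) (f g h psi : PL R -> R[i]).

Definition modulus f x : R := cabs (f x).

(** Passing to the real function [modulus f] makes the real Cauchy-Schwarz inequality available
    against real weights. *)
Definition nrm f : R := Num.sqrt (ip (modulus f) (modulus f)).

Lemma modulus_ge0 f x : 0 <= modulus f x. Proof. exact: cabs_ge0. Qed.

Lemma modulus_L2 f : LpC 2%:E f -> modulus f \in L2.
Proof.
move=> hf; apply: L2P; first exact: LpC_measurable_cabs.
have := integral_sqr_cabs hf; rewrite (eq_integral (fun x => (modulus f x * modulus f x)%:E)).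
  by move=> ->; rewrite ltry.
by move=> x _; rewrite -expr2.
Qed.

Lemma sqr_nrm f : LpC 2%:E f ->
  ip (modulus f) (modulus f) = complex.Re (innerC f f).
Proof.
move=> hf; rewrite Re_innerC//; apply: EFin_inj.
rewrite ipE; last exact: modulus_L2.
by rewrite -integral_sqr_cabs.
Qed.

Lemma nrm_fourier f : L12 f -> nrm (fourier f) = nrm f.
Proof.
move=> hf; have [_ _ hf2] := hf.
by rewrite /nrm !sqr_nrm ?innerC_fourier//; exact: fourier_L2.
Qed.

(** With [z] the integral, [|z|^2] is the integral of [Re (conj z F)], which is at most [|z| |F|]
    pointwise; then [|z|] is cancelled. *)
Lemma cabs_cintegral_le F : L1 (re_ F) -> L1 (im_ F) -> L1 (modulus F) ->
  cabs (cintegral F) <= \int[mu2]_x modulus F x.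
Proof.
move=> Fr Fi Fm.
have I0 : 0 <= \int[mu2]_x modulus F x.
  by apply: Rintegral_ge0 => // x _; exact: modulus_ge0.
set z := cintegral F.
have zE : cabs z ^+ 2 = \int[mu2]_x (complex.Re z * re_ F x + complex.Im z * im_ F x).
  rewrite sqr_cabs (RintegralD measurableT (L1Z _ Fr) (L1Z _ Fi)).
  by rewrite !RintegralZl// !expr2.
have zle : cabs z ^+ 2 <= cabs z * \int[mu2]_x modulus F x.
  rewrite zE -RintegralZl//; apply: le_Rintegral => //.
  - by apply: L1D; exact: L1Z.
  - exact: L1Z.
  move=> x _; apply: le_trans (ler_norm _) _.
  rewrite /modulus -(cabs_conj z) -cabsM.
  have := norm_Re_le_cabs (conjc z * F x).
  by rewrite Re_mul Re_conj Im_conj mulNr opprK.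
have [z0|z0] := eqVneq (cabs z) 0; first by rewrite z0.
rewrite -(ler_pM2l (_ : 0 < cabs z)) -?expr2//.
by rewrite lt_neqAle eq_sym z0 cabs_ge0.
Qed.

Lemma cabs_innerC_le f g : LpC 2%:E f -> LpC 2%:E g ->
  cabs (innerC f g) <= ip (modulus f) (modulus g).
Proof.
move=> hf hg; pose F x := f x * conjc (g x).
have [h1 h2] := mul_conj_L1 hf hg.
have mE : modulus F = fun x => modulus f x * modulus g x.
  by apply/funext => w; rewrite /modulus cabsM cabs_conj.
have h3 : L1 (modulus F) by rewrite mE; apply: L2_int; exact: modulus_L2.
by apply: (le_trans (cabs_cintegral_le h1 h2 h3)); rewrite mE.
Qed.

Lemma ip_le_ae u v W : u \in L2 -> v \in L2 -> L1 W -> (forall x, 0 <= u x) ->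
    (forall x, 0 <= v x) -> (forall x, 0 <= W x) ->
    {ae (@mu2 R), forall x : PL R, u x * v x <= W x} ->
  ip u v <= \int[mu2]_x W x.
Proof.
move=> hu hv hW u0 v0 W0 uvW; have huv := L2_int hu hv.
rewrite -lee_fin /ip /Rintegral !fineK; try exact: integrable_fin_num.
apply: ae_ge0_le_integral => //.
- by move=> x _; rewrite lee_fin mulr_ge0.
- by case/integrableP: huv.
- by move=> x _; rewrite lee_fin.
- by case/integrableP: hW.
- by apply: filterS uvW => x h _; rewrite lee_fin.
Qed.

Lemma ip_le_nrm f u : LpC 2%:E f -> u \in L2 ->
  ip (modulus f) u <= nrm f * Num.sqrt (ip u u).
Proof.
move=> hf hu; apply: (le_trans (ler_norm _)).
exact: (cauchy_schwarz (modulus_L2 hf) hu).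
Qed.

Lemma cabs_innerC_nrm f g : LpC 2%:E f -> LpC 2%:E g ->
  cabs (innerC f g) <= nrm f * nrm g.
Proof.
move=> hf hg; apply: (le_trans (cabs_innerC_le hf hg)).
by apply: ip_le_nrm => //; exact: modulus_L2.
Qed.

Lemma innerCB f g h : LpC 2%:E f -> LpC 2%:E g -> LpC 2%:E h ->
  innerC (fun x => f x - g x) h = innerC f h - innerC g h.
Proof.
move=> hf hg hh; have [f1 f2] := mul_conj_L1 hf hh; have [g1 g2] := mul_conj_L1 hg hh.
rewrite -(cintegralB f1 f2 g1 g2); congr cintegral.
by apply/funext => x; rewrite mulrBl.
Qed.

Lemma innerCZr (c : R) f g : LpC 2%:E f -> LpC 2%:E g ->
  innerC f (fun x => c%:C * g x) = c%:C * innerC f g.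
Proof.
move=> hf hg; have [f1 f2] := mul_conj_L1 hf hg.
rewrite -(cintegralZ c f1 f2); congr cintegral.
by apply/funext => x; rewrite rmorphM/= oppr0 mulrCA.
Qed.

Lemma LpCZ (c : R) f : LpC 2%:E f -> LpC 2%:E (fun x => c%:C * f x).
Proof.
move=> [fr fi]; split.
  rewrite (_ : (fun x => _) = fun x => c * re_ f x); first exact: L2Z.
  by apply/funext => x; rewrite Re_mul /= mul0r subr0.
rewrite (_ : (fun x => _) = fun x => c * im_ f x); first exact: L2Z.
by apply/funext => x; rewrite Im_mul /= mul0r addr0.
Qed.

Lemma LpC_affine f c1 s d1 c2 d2 : c1 != 0 -> c2 != 0 -> LpC 2%:E f ->
  LpC 2%:E (fun x => f (affine c1 s d1 c2 d2 x)).
Proof.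
move=> c10 c20 [fr fi]; split.
  exact (L2_affine s d1 d2 c10 c20 fr).
exact (L2_affine s d1 d2 c10 c20 fi).
Qed.

Lemma ip_affine u v c1 s d1 c2 d2 : c1 != 0 -> c2 != 0 -> u \in L2 -> v \in L2 ->
  ip u v = `|c1 * c2| * ip (fun x => u (affine c1 s d1 c2 d2 x))
                           (fun x => v (affine c1 s d1 c2 d2 x)).
Proof.
move=> c10 c20 hu hv.
exact (Rintegral_affine s d1 d2 c10 c20 (L2_int hu hv)).
Qed.

Lemma innerC_affine f g c1 s d1 c2 d2 : c1 != 0 -> c2 != 0 ->
    LpC 2%:E f -> LpC 2%:E g ->
  innerC f g = `|c1 * c2|%:C * innerC (fun x => f (affine c1 s d1 c2 d2 x))
                                      (fun x => g (affine c1 s d1 c2 d2 x)).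
Proof.
move=> c10 c20 hf hg; have [fr fi] := hf; have [gr gi] := hg.
have hf' := LpC_affine s d1 d2 c10 c20 hf; have hg' := LpC_affine s d1 d2 c10 c20 hg.
have E := ip_affine s d1 d2 c10 c20.
have reE r : complex.Re (r%:C : R[i]) = r by [].
have imE r : complex.Im (r%:C : R[i]) = 0 by [].
apply: complex_ext.
  rewrite Re_mul (Re_innerC hf hg) (Re_innerC hf' hg') (reE `|c1 * c2|) (imE `|c1 * c2|).
  rewrite mul0r subr0 mulrDr.
  exact (congr2 +%R (E _ _ fr gr) (E _ _ fi gi)).
rewrite Im_mul (Im_innerC hf hg) (Im_innerC hf' hg') (reE `|c1 * c2|) (imE `|c1 * c2|).
rewrite mul0r addr0 mulrBr.
exact (congr2 (fun a b => a - b) (E _ _ fi gr) (E _ _ fr gi)).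
Qed.

Lemma nrm_affine f c1 s d1 c2 d2 : c1 != 0 -> c2 != 0 -> LpC 2%:E f ->
  nrm f = Num.sqrt `|c1 * c2| * nrm (fun x => f (affine c1 s d1 c2 d2 x)).
Proof.
move=> c10 c20 hf; rewrite /nrm -sqrtrM ?normr_ge0//.
have m := modulus_L2 hf.
by congr Num.sqrt; exact (ip_affine s d1 d2 c10 c20 m m).
Qed.
End Modulus.

(** * A square-integrable weight on the plane *)

Section PowerTail.
Context {R : realType}.
Implicit Types (x y z w : PL R) (u v : PL R -> R).

Lemma powR_addr (a p q : R) : 0 < a -> a `^ (p + q) = a `^ p * a `^ q.
Proof. by move=> a0; rewrite powRD// (gt_eqF a0) implybT. Qed.

Lemma ler_powRN (a b p : R) : 0 < a -> a <= b -> 0 <= p -> b `^ (- p) <= a `^ (- p).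
Proof.
move=> a0 ab p0; rewrite !powRN lef_pV2 ?posrE ?powR_gt0//; last exact: lt_le_trans ab.
by apply: ge0_ler_powR; rewrite ?nnegrE// ?(ltW a0)//; apply: le_trans ab; exact: ltW.
Qed.

Lemma powR_ge1 (a p : R) : 0 < a -> a <= 1 -> p <= 0 -> 1 <= a `^ p.
Proof.
by move=> a0 a1 p0; rewrite -(powRr0 a); apply: ger_powR => //; rewrite a0 a1.
Qed.

Let tail (t : R) : R := (1 + `|t|) `^ (- (3 / 2)).

Let tail_base_gt0 (t : R) : 0 < 1 + `|t|.
Proof. by rewrite ltr_pwDl. Qed.

Let continuous_tail : continuous tail.
Proof.
move=> t.
have h1 : 1 + `|s| @[s --> t] --> 1 + `|t|.
  by apply: cvgD; [exact: cvg_cst|exact: norm_continuous].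
have h2 : {for 1 + `|t|, continuous (fun s : R => s `^ (- (3 / 2)))}.
  apply/differentiable_continuous/derivable1_diffP.
  by have [] := @is_derive1_powR R (- (3 / 2)) _ (tail_base_gt0 t).
exact: (continuous_cvg _ h2 h1).
Qed.

(** The shape [1 * t + 1] is the one on which [is_derive_aff] applies. *)
Let cvg_tail_primitive : -2 * (1 * t + 1 : R) `^ (- (1 / 2)) @[t --> +oo] --> (0 : R).
Proof.
rewrite -[X in _ --> X](mulr0 (-2)); apply: cvgMl_tmp.
apply/cvgrPdist_le => e e0; near=> t.
have t0 : 0 < t by near: t; exact: nbhs_pinfty_gt.
have d0 : 0 < 1 * t + 1 by rewrite mul1r addr_gt0.
rewrite sub0r normrN ger0_norm ?powR_ge0//.
rewrite powRN -[e]invrK lef_pV2 ?posrE ?powR_gt0 ?invr_gt0//.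
rewrite div1r powR12_sqrt; last exact: ltW.
rewrite -(ger0_norm (_ : 0 <= e^-1)); last by rewrite invr_ge0 ltW.
rewrite -sqrtr_sqr ler_wsqrtr// mul1r.
apply: (@le_trans _ _ t); last by rewrite lerDl.
near: t; apply: nbhs_pinfty_ge; exact: num_real.
Unshelve. all: by end_near. Qed.

Lemma integral_tail : (\int[leb]_t (tail t)%:E = 4%:E)%E.
Proof.
pose F (t : R) := -2 * (1 * t + 1) `^ (- (1 / 2)).
have -> : (4 : R) = 2 * (0 - F 0).
  have -> : F 0 = -2 by rewrite /F [1 * 0]mulr0 [0 + 1]add0r powR1 mulr1.
  by ring.
apply: (@integral_even_FTC _ _ (fun t => (1 + t) `^ (- (3 / 2)))).
- exact: continuous_tail.
- by move=> t; exact: powR_ge0.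
- by move=> t; rewrite /tail normrN.
- by move=> t t0; rewrite /tail ger0_norm.
- move=> t t0; have d0 : 0 < 1 * t + 1 by rewrite mul1r ltr_wpDl.
  apply: (is_derive_eq (is_derive_scalel _ (is_derive_aff
    (@is_derive1_powR R (- (1 / 2)) _ d0)))).
  rewrite mul1r mulrA [1 * t]mul1r [t + 1]addrC; have -> : -2 * - (1 / 2) = 1 :> R by field.
  by rewrite mul1r; congr (_ `^ _); field.
- exact: cvg_tail_primitive.
Qed.

(** Both coordinates are bounded by [enorm z], so the squared weight is at most a product of two
    one-dimensional tails, integrable because [3/2 > 1]. *)
Lemma weight_L2 : (fun z => (1 + enorm z) `^ (- (3 / 2))) \in L2.
Proof.
have mE : measurable_fun setT (fun z : PL R => (1 + enorm z) `^ (- (3 / 2))).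
  apply: (measurableT_comp (measurable_powR _)).
  by apply: measurable_funD; [exact: measurable_cst|exact: measurable_enorm].
apply: L2P => //.
have mt : measurable_fun setT tail by exact: continuous_measurable_fun continuous_tail.
have it : leb.-integrable setT (EFin \o tail).
  apply/integrableP; split; first exact/measurable_EFinP.
  rewrite (_ : integral _ _ _ = 4%:E) ?ltry// -integral_tail.
  by apply: eq_integral => t _; rewrite /= ger0_norm// powR_ge0.
have i2 := @integrable_tensor _ _ _ _ R leb leb tail tail it it.
move/integrableP: (i2) => [m2 fin2]; apply: le_lt_trans fin2.
apply: ge0_le_integral => //.
- by move=> z _; rewrite lee_fin -expr2 sqr_ge0.
- by apply/measurable_EFinP; exact: measurable_funM.
- exact: measurableT_comp.
move=> z _; apply: le_trans (lee_abs _); rewrite lee_fin.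
have le (t : R) : `|t| <= enorm z -> (1 + enorm z) `^ (- (3 / 2)) <= tail t.
  by move=> h; apply: ler_powRN; rewrite ?lerD2l// divr_ge0.
apply: ler_pM; rewrite ?powR_ge0//; apply: le.
  exact: norm_fst_le_enorm.
exact: norm_snd_le_enorm.
Qed.
End PowerTail.

(** * The part of the function away from the point *)

Section SpatialTail.
Context {R : realType}.
Implicit Types (x y z w t : PL R) (u v : PL R -> R) (f g h psi : PL R -> R[i]) (a s : R).
Local Notation rt a := (a `^ (1 / 2)).

(** The inverse of the map inside [psi] in the atom; undoing the shear after the dilation produces
    the entry [- s a^(1/2)]. *)
Definition atom_frame a s t : R * R -> R * R :=
  affine a (- (s * rt a)) t.1 (rt a) t.2.

Definition pulled f a s t z : R[i] := f (atom_frame a s t z).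

Lemma mul_rt a : 0 < a -> rt a * rt a = a.
Proof.
by move=> a0; rewrite -powR_addr// -[RHS]powRr1 ?(ltW a0)//; congr (_ `^ _); field.
Qed.

Lemma rt_gt0 a : 0 < a -> 0 < rt a. Proof. exact: powR_gt0. Qed.

Lemma norm_jacobian a : 0 < a -> `|a * rt a| = a `^ (3 / 2).
Proof.
move=> a0; rewrite gtr0_norm ?mulr_gt0 ?rt_gt0// -{1}[a]powRr1 ?(ltW a0)//.
by rewrite -powR_addr//; congr (_ `^ _); field.
Qed.

Lemma shearlet_atom_frame psi a s t z : 0 < a ->
  shearlet_atom psi a s t (atom_frame a s t z) = (a `^ (- (3 / 4)))%:C * psi z.
Proof.
move=> a0; rewrite /shearlet_atom; congr (_ * psi _).
have r0 := rt_gt0 a0.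
rewrite /atom_frame /affine /=; move: r0; set r := rt a => r0.
rewrite [RHS]surjective_pairing; congr pair; field; rewrite ?(gt_eqF a0) ?(gt_eqF r0)//.
Qed.

Lemma shearlet_atom_affine psi a s t : 0 < a -> shearlet_atom psi a s t =
  (fun x => (a `^ (- (3 / 4)))%:C * psi (affine a^-1 (s / a) (- (t.1 + s * t.2) / a)
                                     (rt a)^-1 (- t.2 / rt a) x)).
Proof.
move=> a0; apply/funext => x; rewrite /shearlet_atom; congr (_ * psi _).
have r0 := rt_gt0 a0; rewrite /affine; move: r0; set r := rt a => r0.
by congr pair; field; rewrite ?(gt_eqF a0) ?(gt_eqF r0).
Qed.

Lemma shearlet_atom_L2 psi a s t : 0 < a -> LpC 2%:E psi ->
  LpC 2%:E (shearlet_atom psi a s t).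
Proof.
move=> a0 hpsi; rewrite shearlet_atom_affine//; apply: LpCZ; apply: LpC_affine => //.
  by rewrite invr_neq0 ?gt_eqF.
by rewrite invr_neq0 ?gt_eqF ?rt_gt0.
Qed.

Lemma pulled_L2 f a s t : 0 < a -> LpC 2%:E f -> LpC 2%:E (pulled f a s t).
Proof. by move=> a0 hf; apply: LpC_affine; rewrite ?gt_eqF ?rt_gt0. Qed.

Lemma pulled_L12 f a s t : 0 < a -> L12 f -> L12 (pulled f a s t).
Proof. by move=> a0 hf; apply: L12_affine; rewrite ?gt_eqF ?rt_gt0. Qed.

(** The Jacobian [a^(3/2)] meets the normalisation [a^(-3/4)] of the atom. *)
Lemma cabs_innerC_atom f psi a s t : 0 < a -> LpC 2%:E f -> LpC 2%:E psi ->
  cabs (innerC f (shearlet_atom psi a s t)) =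
  a `^ (3 / 4) * cabs (innerC (pulled f a s t) psi).
Proof.
move=> a0 hf hpsi; have hat := shearlet_atom_L2 s t a0 hpsi.
have a00 : a != 0 by rewrite gt_eqF.
have r00 : rt a != 0 by rewrite gt_eqF ?rt_gt0.
rewrite (innerC_affine (- (s * rt a)) t.1 t.2 a00 r00 hf hat).
rewrite (_ : (fun x => shearlet_atom _ _ _ _ _) =
    (fun z => (a `^ (- (3 / 4)))%:C * psi z)); last first.
  by apply/funext => z; exact: shearlet_atom_frame.
rewrite innerCZr//; last exact: pulled_L2.
rewrite !cabsM !cabs_real normr_id norm_jacobian// (ger0_norm (powR_ge0 _ _)) mulrA.
by rewrite -powR_addr//; congr (_ `^ _ * _); field.
Qed.

(** The square root of the Jacobian is the very factor left over in the coefficient, so norm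
    estimates lose no power of [a]. *)
Lemma nrm_pulled f a s t : 0 < a -> LpC 2%:E f ->
  a `^ (3 / 4) * nrm (pulled f a s t) = nrm f.
Proof.
move=> a0 hf; have a00 : a != 0 by rewrite gt_eqF.
have r00 : rt a != 0 by rewrite gt_eqF ?rt_gt0.
rewrite (nrm_affine (- (s * rt a)) t.1 t.2 a00 r00 hf) norm_jacobian//.
congr (_ * _); rewrite -[LHS]ger0_norm ?powR_ge0// -sqrtr_sqr expr2 -powR_addr//.
by congr (Num.sqrt (_ `^ _)); field.
Qed.

Lemma nrm_ge0 f : 0 <= nrm f. Proof. exact: sqrtr_ge0. Qed.

(** This bound, uniform in [a], [s] and [t], settles the ranges of [P] and [N] in which the claim
    allows no decay. *)
Lemma cabs_innerC_atom_le f psi a s t : 0 < a -> LpC 2%:E f -> LpC 2%:E psi ->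
  cabs (innerC f (shearlet_atom psi a s t)) <= nrm f * nrm psi.
Proof.
move=> a0 hf hpsi; rewrite cabs_innerC_atom//.
rewrite -(nrm_pulled s t a0 hf) -mulrA ler_pM2l ?powR_gt0//.
by apply: cabs_innerC_nrm => //; exact: pulled_L2.
Qed.

(** For [a <= 1] the finer scale [a] is at most [a^(1/2)], so the coarser one controls both
    coordinates. *)
Lemma norm_atom_frame a s t z : 0 < a -> a <= 1 ->
  `|(atom_frame a s t z).1 - t.1| <= rt a * ((2 + `|s|) * enorm z) /\
  `|(atom_frame a s t z).2 - t.2| <= rt a * ((2 + `|s|) * enorm z).
Proof.
move=> a0 a1; have r0 := rt_gt0 a0.
have r1 : rt a <= 1.
  rewrite -[X in _ <= X](powRr0 a); apply: ger_powR; first by rewrite a0 a1.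
  by rewrite divr_ge0.
have ar : a <= rt a by rewrite -{1}(mul_rt a0) ler_piMr// ltW.
have := norm_fst_le_enorm z; have := norm_snd_le_enorm z.
rewrite /atom_frame /affine /=; move: r0 r1 ar; set r := rt a => r0 r1 ar z2 z1.
have e0 := enorm_ge0 z; have s0 := normr_ge0 s.
split; rewrite addrK.
  apply: (le_trans (ler_normD _ _)); rewrite !normrM normrN normrM (gtr0_norm a0) (gtr0_norm r0).
  have h1 : a * `|z.1| <= r * enorm z by apply: ler_pM => //; exact: ltW.
  have h2 : `|s| * r * `|z.2| <= r * (`|s| * enorm z).
    by rewrite mulrAC mulrC ler_pM2l// ler_wpM2l.
  apply: (le_trans (lerD h1 h2)); rewrite -mulrDr ler_pM2l//; lra.
rewrite normrM (gtr0_norm r0) ler_pM2l//; apply: (le_trans z2).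
by rewrite ler_peMl//; lra.
Qed.

Lemma spatial_tail h psi (P d S : R) : LpC 2%:E h -> LpC 2%:E psi -> decay P psi ->
    0 < d -> 0 <= S ->
  exists K : R, 0 <= K /\ forall a s t, 0 < a -> a <= 1 -> `|s| <= S ->
    (forall x, `|x.1 - t.1| < d -> `|x.2 - t.2| < d -> h x = 0) ->
    cabs (innerC h (shearlet_atom psi a s t)) <= K * a `^ (- (3 / 4) + P / 2).
Proof.
move=> hh hpsi [C dpsi] d0 S0; have [P32|P32] := leP P (3 / 2).
  (* Here [-3/4 + P/2 <= 0], so the power of [a <= 1] is at least [1]. *)
  exists (nrm h * nrm psi); split; first by rewrite mulr_ge0 ?nrm_ge0.
  move=> a s t a0 a1 _ _; apply: (le_trans (cabs_innerC_atom_le s t a0 hh hpsi)).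
  by rewrite ler_peMr ?mulr_ge0 ?nrm_ge0//; apply: powR_ge1 => //; lra.
pose p := P - 3 / 2; have p0 : 0 <= p by rewrite /p; lra.
(* [k] will bound [a^(1/2) (1 + |z|)] from below wherever the pulled back [h] does not vanish;
   [2 + S] bounds the distortion of the frame. *)
pose k := d / (2 + S); have k0 : 0 < k by rewrite divr_gt0//; lra.
pose q z : R := (1 + enorm z) `^ (- (3 / 2)).
have q2 : q \in L2 by exact: weight_L2.
pose K0 := `|C| * k `^ (- p); have K00 : 0 <= K0 by rewrite mulr_ge0 ?powR_ge0.
exists (K0 * (nrm h * Num.sqrt (ip q q))); split.
  by apply: mulr_ge0 => //; apply: mulr_ge0; [exact: nrm_ge0|exact: sqrtr_ge0].
move=> a s t a0 a1 sS hx; rewrite cabs_innerC_atom//.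
have hp := pulled_L2 s t a0 hh.
have r0 := rt_gt0 a0.
pose c := K0 * rt a `^ p.
have c0 : 0 <= c by rewrite mulr_ge0 ?powR_ge0.
have ptw : {ae (@mu2 R), forall z : PL R,
    modulus (pulled h a s t) z * modulus psi z <= modulus (pulled h a s t) z * (c * q z)}.
  have dpsi' : {ae mu2, forall z : PL R, cabs (psi z) <= C * (1 + enorm z) `^ (- P)}.
    exact dpsi.
  apply: filterS dpsi' => z hz.
  have [h0|h0] := eqVneq (pulled h a s t z) 0.
    have -> : modulus (pulled h a s t) z = 0.
      by rewrite /modulus h0 (cabs_real 0) normr0.
    by rewrite !mul0r.
  apply: ler_wpM2l; first exact: modulus_ge0.
  have z1 : 0 < 1 + enorm z by rewrite ltr_pwDl ?enorm_ge0.
  (* A smaller [z] would land within [d] of [t], where [h] vanishes. *)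
  have far : k <= rt a * (1 + enorm z).
    have [n1 n2] := norm_atom_frame s t z a0 a1.
    have : d <= rt a * ((2 + `|s|) * enorm z).
      rewrite leNgt; apply/negP => lt; move/eqP: h0; apply.
      by apply: hx; [exact: le_lt_trans lt|exact: le_lt_trans lt].
    move=> dle; rewrite /k ler_pdivrMr; last by lra.
    apply: (le_trans dle); rewrite -mulrA ler_pM2l// mulrC.
    by apply: ler_pM; rewrite ?enorm_ge0//; lra.
  apply: (le_trans hz).
  have -> : (1 + enorm z) `^ (- P) = (1 + enorm z) `^ (- p) * q z.
    by rewrite /q -powR_addr//; congr (_ `^ _); rewrite /p; lra.
  rewrite mulrA; apply: ler_wpM2r; first exact: powR_ge0.
  apply: (@le_trans _ _ (`|C| * (1 + enorm z) `^ (- p))).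
    by apply: ler_wpM2r; [exact: powR_ge0|exact: ler_norm].
  rewrite /c /K0 -mulrA; apply: ler_wpM2l => //.
  have := ler_powRN k0 far p0.
  rewrite powRM ?(ltW r0) ?(ltW z1)// powRN => le.
  rewrite -(ler_pM2l (_ : 0 < (rt a `^ p)^-1)) ?invr_gt0 ?powR_gt0//.
  apply: (le_trans le); rewrite [k `^ _ * _]mulrC mulrA mulVf ?mul1r//.
  by rewrite gt_eqF ?powR_gt0.
have cq : (fun z => c * q z) \in L2 by exact: L2Z.
have le : ip (modulus (pulled h a s t)) (modulus psi) <=
          ip (modulus (pulled h a s t)) (fun z => c * q z).
  apply: ip_le_ae ptw; try exact: modulus_ge0; try exact: modulus_L2.
    exact (L2_int (modulus_L2 hp) cq).
  by move=> z; rewrite !mulr_ge0 ?modulus_ge0 ?powR_ge0.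
apply: (@le_trans _ _ (a `^ (3 / 4) * (c * (nrm (pulled h a s t) * Num.sqrt (ip q q))))).
  rewrite ler_pM2l ?powR_gt0//; apply: (le_trans (cabs_innerC_le hp hpsi)).
  apply: (le_trans le); rewrite ipC ipZl//; last exact: modulus_L2.
  by rewrite ipC; apply: ler_wpM2l => //; exact: ip_le_nrm.
rewrite -(nrm_pulled s t a0 hh) /c -powRrM.
have -> : a `^ (- (3 / 4) + P / 2) = a `^ (1 / 2 * p) by congr (_ `^ _); rewrite /p; field.
by rewrite le_eqVlt; apply/orP; left; apply/eqP; ring.
Qed.
End SpatialTail.

(** * The localized part on the frequency side *)

Section FrequencyBound.
Context {R : realType}.
Implicit Types (x y z w t : PL R) (u v : PL R -> R) (f g h psi G : PL R -> R[i]) (a s : R).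
Local Notation rt a := (a `^ (1 / 2)).

(** On this line the slope and the division by [w.1] are meaningless; the pointwise estimate is made
    off it. *)
Lemma ae_fst_neq0 : {ae (@mu2 R), forall w : PL R, w.1 != 0}.
Proof.
exists ([set 0 : R] `*` [set: R]); split.
- by apply: measurableX; [exact: measurable_set1|exact: measurableT].
- rewrite mu2_setX; [|exact: measurable_set1|exact: measurableT].
  by rewrite lebesgue_measure_set1 mul0e.
- by move=> w /= /negP; rewrite negbK => /eqP.
Qed.

Lemma moment_weight_L2 psi M : LpC 2%:E psi -> vanishing_moments_x1 M psi ->
  (fun w => modulus (fourierL2 psi) w / `|w.1| ^+ M) \in L2.
Proof.
move=> hpsi hm; apply: L2P.
  apply: measurable_funM; first exact: LpC_measurable_cabs (fourierL2_L2 hpsi).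
  rewrite (_ : (fun w => _) = fun w : PL R => (`|w.1| ^+ M) `^ (-1)).
    apply: (measurableT_comp (measurable_powR _)).
    apply: measurable_funX; apply: measurableT_comp; first exact: normr_measurable.
    exact: measurable_fst.
  by apply/funext => w; rewrite powR_inv1// exprn_ge0.
apply: le_lt_trans hm; rewrite le_eqVlt; apply/orP; left; apply/eqP.
apply: eq_integral => w _; congr EFin.
by rewrite -expr2 expr_div_n -exprM mulnC.
Qed.

Lemma sobolev_weight_L2 psi L : LpC 2%:E psi ->
    (\int[mu2]_w ((`|w.2| ^+ L * cabs (fourierL2 psi w)) ^+ 2)%:E < +oo)%E ->
  (fun w => `|w.2| ^+ L * modulus (fourierL2 psi) w) \in L2.
Proof.
move=> hpsi hl; apply: L2P; last first.
  apply: le_lt_trans hl; rewrite le_eqVlt; apply/orP; left; apply/eqP.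
  by apply: eq_integral => w _; rewrite expr2.
apply: measurable_funM; last exact: LpC_measurable_cabs (fourierL2_L2 hpsi).
apply: measurable_funX; apply: measurableT_comp; first exact: normr_measurable.
exact: measurable_snd.
Qed.

Lemma modulus_L1 f : LpC 1%:E f -> L1 (modulus f).
Proof.
move=> [fr fi].
have /Lfun1_integrable r1 := fr; have /Lfun1_integrable i1 := fi.
have mf : measurable_fun setT (modulus f).
  by apply: measurable_cabs; apply/measurable_EFinP; [case/integrableP: r1|case/integrableP: i1].
have := L1D (integrable_norm r1) (integrable_norm i1).
apply: le_integrable => //; first exact/measurable_EFinP.
move=> w _; rewrite /= lee_fin (ger0_norm (modulus_ge0 f w)); apply: le_trans (ler_norm _).
rewrite /re_ /im_.
rewrite /modulus; case: (f w) => p q /=.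
rewrite -(@ler_pXn2r _ 2)// ?nnegrE ?addr_ge0 ?sqrtr_ge0//.
rewrite sqr_sqrtr ?addr_ge0 ?sqr_ge0// sqrrD !real_normK ?num_real//.
by rewrite -addrA lerD2l lerDr mulrn_wge0// mulr_ge0.
Qed.

(* With [u = a ^ (1 - alpha)] and [v = a ^ (alpha - 1/2)], so that [u v] is the
   square root [r] of [a], the frequency plane splits into [|w_1| <= u],
   [|w_2| >= d / v] and a remainder on which the slope is within [d] of [s]. *)
Lemma directed_remainder G (N C s0 d e alpha : R) a s t w : L12 G ->
    (forall w, w.1 != 0 -> `|w.2 / w.1 - s0| < e ->
       cabs (fourier G w) <= C * (1 + enorm w) `^ (- N)) ->
    0 <= N -> 0 < a -> 0 < d -> d + `|s - s0| < e ->
    a `^ (1 - alpha) < `|w.1| -> `|w.2| * a `^ (alpha - 1 / 2) < d ->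
  modulus (fourier (pulled G a s t)) w <=
    `|C| * (a `^ (- (3 / 2)) * a `^ (alpha * N)).
Proof.
move=> hG hdir N0 a0 d0 de w1 w2.
have a00 : a != 0 by rewrite gt_eqF.
have r0 := rt_gt0 a0; have r00 : rt a != 0 by rewrite gt_eqF.
have [Gr Gi _] := hG.
have u0 : 0 < a `^ (1 - alpha) by exact: powR_gt0.
have v0 : 0 < a `^ (alpha - 1 / 2) by exact: powR_gt0.
have w10 : w.1 != 0.
  by rewrite -normr_gt0; exact: lt_trans w1.
rewrite /modulus (cabs_fourier_affine (- (s * rt a)) t.1 t.2 a00 r00 w Gr Gi) norm_jacobian//.
set eta := dual_affine _ _ _ _.
have eta1 : eta.1 = w.1 / a by [].
have eta10 : eta.1 != 0 by rewrite eta1 mulf_neq0// invr_neq0.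
have slope : eta.2 / eta.1 = s + rt a * (w.2 / w.1).
  (* Parabolic scaling: with [a = r * r] the claim becomes an identity between rational functions of
     [r]. *)
  have rr := mul_rt a0.
  rewrite eta1 /eta /dual_affine /=; move: rr r00; set r := rt a => rr r00.
  rewrite -{1}rr -{1}rr; field; rewrite ?w10 ?r00//.
have le_slope : `|eta.2 / eta.1 - s0| < e.
  rewrite slope addrAC; apply: le_lt_trans (ler_normD _ _) _.
  apply: le_lt_trans de; rewrite [d + _]addrC lerD2l.
  rewrite normrM (gtr0_norm r0) normf_div mulrA ler_pdivrMr ?normr_gt0//.
  have uv : a `^ (1 - alpha) * a `^ (alpha - 1 / 2) = rt a.
    by rewrite -powR_addr//; congr (_ `^ _); field.
  rewrite -uv; apply: (@le_trans _ _ (a `^ (1 - alpha) * d)).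
    by rewrite -mulrA ler_pM2l// mulrC ltW.
  by rewrite mulrC ler_pM2l// ltW.
have := hdir eta eta10 le_slope => le.
have eta_ge : a `^ (- alpha) <= 1 + enorm eta.
  apply: (@le_trans _ _ (enorm eta)); last by rewrite lerDr.
  apply: le_trans (norm_fst_le_enorm eta).
  rewrite eta1 normf_div (gtr0_norm a0) ler_pdivlMr//.
  rewrite -{2}[a]powRr1 ?(ltW a0)// -powR_addr// addrC.
  exact: ltW.
have pw : (1 + enorm eta) `^ (- N) <= a `^ (alpha * N).
  have := ler_powRN (powR_gt0 (- alpha) a0) eta_ge N0.
  by rewrite -powRrM mulrNN.
rewrite ler_pdivrMr ?powR_gt0//; apply: (le_trans le).
have -> : `|C| * (a `^ (- (3 / 2)) * a `^ (alpha * N)) * a `^ (3 / 2) = `|C| * a `^ (alpha * N).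
  rewrite -mulrA; congr (_ * _); rewrite mulrAC -powR_addr// addNr powRr0 mul1r; done.
apply: (le_trans (ler_wpM2r (powR_ge0 _ _) (ler_norm C))).
exact: ler_wpM2l.
Qed.
End FrequencyBound.

Section FrequencyMain.
Context {R : realType}.
Implicit Types (x y z w t : PL R) (u v : PL R -> R) (f g h psi G : PL R -> R[i]) (a s : R).

(** A sum of three nonnegative majorants replaces a partition of the plane: on its own region each
    one exceeds [F * p], the ratio raised to [M] or [L] being at least [1] there. No integral has to
    be restricted. *)
Lemma three_region_bound (F p w1 w2 U V d E : R) (M L : nat) :
    0 <= F -> 0 <= p -> 0 <= w2 -> 0 < w1 -> 0 < d -> 0 <= U -> 0 <= V -> 0 <= E ->
    (U < w1 -> w2 * V < d -> F <= E) ->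
  F * p <= U ^+ M * (F * (p / w1 ^+ M)) + (d ^- L * V ^+ L) * (F * (w2 ^+ L * p)) + E * p.
Proof.
move=> F0 p0 w20 w10 d0 U0 V0 E0 H.
have w1M : 0 < w1 ^+ M by exact: exprn_gt0.
have dL : 0 < d ^+ L by exact: exprn_gt0.
have A0 : 0 <= U ^+ M * (F * (p / w1 ^+ M)).
  by apply: mulr_ge0; [exact: exprn_ge0|apply: mulr_ge0 => //; apply: divr_ge0 => //; exact: ltW].
have B0 : 0 <= (d ^- L * V ^+ L) * (F * (w2 ^+ L * p)).
  apply: mulr_ge0; apply: mulr_ge0 => //; rewrite ?invr_ge0 ?exprn_ge0//; first exact: ltW.
  by apply: mulr_ge0 => //; exact: exprn_ge0.
have C0 : 0 <= E * p by exact: mulr_ge0.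
have Fp0 : 0 <= F * p by exact: mulr_ge0.
have [h|h1] := leP w1 U.
  have : F * p <= U ^+ M * (F * (p / w1 ^+ M)); last by lra.
  have -> : U ^+ M * (F * (p / w1 ^+ M)) = U ^+ M / w1 ^+ M * (F * p) by ring.
  apply: ler_peMl => //; rewrite ler_pdivlMr// mul1r; apply: lerXn2r => //; rewrite nnegrE//.
  exact: ltW.
have [h|h2] := leP d (w2 * V).
  have : F * p <= (d ^- L * V ^+ L) * (F * (w2 ^+ L * p)); last by lra.
  have -> : (d ^- L * V ^+ L) * (F * (w2 ^+ L * p)) = (w2 * V) ^+ L / d ^+ L * (F * p).
    by rewrite exprMn; ring.
  apply: ler_peMl => //; rewrite ler_pdivlMr// mul1r; apply: lerXn2r => //; rewrite nnegrE.
    exact: ltW.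
  exact: mulr_ge0.
have := ler_wpM2r p0 (H h1 h2); lra.
Qed.

(** [K] is fixed before [alpha], [a], [s] and [t]: it involves only [e], norms of [G], weighted
    norms of the transform of [psi], and [C]. *)
Lemma frequency_bound G psi (N C s0 e : R) (M L : nat) :
    L12 G -> LpC 2%:E psi -> LpC 1%:E (fourierL2 psi) ->
    vanishing_moments_x1 M psi ->
    (\int[mu2]_w ((`|w.2| ^+ L * cabs (fourierL2 psi w)) ^+ 2)%:E < +oo)%E ->
    0 < e ->
    (forall w, w.1 != 0 -> `|w.2 / w.1 - s0| < e ->
       cabs (fourier G w) <= C * (1 + enorm w) `^ (- N)) ->
  exists K : R, 0 <= K /\ forall alpha a s t, 0 < alpha -> 0 < a -> a <= 1 ->
    `|s - s0| < e / 2 ->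
    cabs (innerC G (shearlet_atom psi a s t)) <=
      K * (a `^ ((1 - alpha) * M%:R) + a `^ (- (3 / 4) + alpha * N)
           + a `^ ((alpha - 1 / 2) * L%:R)).
Proof.
move=> hG hpsi hpsi1 hm hl e0 hdir; have [_ _ hG2] := hG.
have [N0|N0] := ltP N 0.
  (* Here [-3/4 + alpha * N] is negative, so that term alone is at least [1]. *)
  exists (nrm G * nrm psi); split; first by rewrite mulr_ge0 ?nrm_ge0.
  move=> alpha a s t al0 a0 a1 _; apply: (le_trans (cabs_innerC_atom_le s t a0 hG2 hpsi)).
  apply: ler_peMr; first by rewrite mulr_ge0 ?nrm_ge0.
  have h : 1 <= a `^ (- (3 / 4) + alpha * N).
    have aN : alpha * N < 0 by rewrite pmulr_rlt0.
    by apply: powR_ge1 => //; lra.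
  have := powR_ge0 a ((1 - alpha) * M%:R); have := powR_ge0 a ((alpha - 1 / 2) * L%:R); lra.
(* The slope deviates from [s0] by less than [d + |s - s0| < e / 4 + e / 2], which stays below
   [e]. *)
pose d := e / 4; have d0 : 0 < d by rewrite /d; lra.
pose p := modulus (fourierL2 psi).
pose m w := p w / `|w.1| ^+ M.
pose l w := `|w.2| ^+ L * p w.
have m2 : m \in L2 by exact: moment_weight_L2.
have l2 : l \in L2 by exact: sobolev_weight_L2.
have p1 : L1 p by exact: modulus_L1.
have p2 : p \in L2 by apply: modulus_L2; exact: fourierL2_L2.
pose P1 := \int[mu2]_w p w.
have P10 : 0 <= P1 by apply: Rintegral_ge0 => // w _; exact: modulus_ge0.
pose K1 := nrm G * Num.sqrt (ip m m).
pose K2 := d ^- L * (nrm G * Num.sqrt (ip l l)).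
pose K3 := `|C| * P1.
have dL : 0 <= d ^- L by rewrite invr_ge0 exprn_ge0// ltW.
have K10 : 0 <= K1 by apply: mulr_ge0; [exact: nrm_ge0|exact: sqrtr_ge0].
have K20 : 0 <= K2.
  by apply: mulr_ge0 => //; apply: mulr_ge0; [exact: nrm_ge0|exact: sqrtr_ge0].
have K30 : 0 <= K3 by apply: mulr_ge0.
exists (K1 + K2 + K3); split; first by rewrite !addr_ge0.
move=> alpha a s t al0 a0 a1 ss0.
pose U := a `^ (1 - alpha); pose V := a `^ (alpha - 1 / 2).
have U0 : 0 <= U by exact: powR_ge0.
have V0 : 0 <= V by exact: powR_ge0.
pose E := `|C| * (a `^ (- (3 / 2)) * a `^ (alpha * N)).
have E0 : 0 <= E by rewrite !mulr_ge0 ?powR_ge0.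
pose F := modulus (fourier (pulled G a s t)).
have hp := pulled_L12 s t a0 hG; have [_ _ hp2] := hp.
have hF := fourier_L2 hp.
have F2 : F \in L2 by exact: modulus_L2.
pose W w := U ^+ M * (F w * m w) + (d ^- L * V ^+ L) * (F w * l w) + E * p w.
have iFm : L1 (fun w => F w * m w) by exact: L2_int.
have iFl : L1 (fun w => F w * l w) by exact: L2_int.
have iW1 : L1 (fun w => U ^+ M * (F w * m w)) by exact (L1Z _ iFm).
have iW2 : L1 (fun w => (d ^- L * V ^+ L) * (F w * l w)) by exact (L1Z _ iFl).
have iW3 : L1 (fun w => E * p w) by exact (L1Z _ p1).
have iW12 := L1D iW1 iW2.
have iW : L1 W by exact (L1D iW12 iW3).
have WE : \int[mu2]_w W w = U ^+ M * ip F m + (d ^- L * V ^+ L) * ip F l + E * P1.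
  rewrite (RintegralD measurableT iW12 iW3) (RintegralD measurableT iW1 iW2).
  by congr (_ + _ + _); apply: RintegralZl.
have W0 w : 0 <= W w.
  have Fw := modulus_ge0 (fourier (pulled G a s t)) w.
  have pw := modulus_ge0 (fourierL2 psi) w.
  rewrite /W; apply: addr_ge0; [apply: addr_ge0|exact: mulr_ge0].
    apply: mulr_ge0; first exact: exprn_ge0.
    by apply: mulr_ge0 => //; apply: divr_ge0.
  apply: mulr_ge0; first by apply: mulr_ge0 => //; exact: exprn_ge0.
  by apply: mulr_ge0 => //; apply: mulr_ge0.
have ptw : {ae (@mu2 R), forall w : PL R, F w * p w <= W w}.
  apply: filterS ae_fst_neq0 => w w0.
  apply: three_region_bound => //; rewrite ?modulus_ge0 ?normr_gt0//.
  move=> h1 h2; apply: (directed_remainder t hG hdir N0 a0 d0 _ h1 h2).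
  by rewrite /d; lra.
have FpW : ip F p <= \int[mu2]_w W w.
  by apply: ip_le_ae ptw => // w; exact: modulus_ge0.
have key : cabs (innerC (pulled G a s t) psi) <= \int[mu2]_w W w.
  rewrite -(innerC_fourierL2 hp hpsi); apply: le_trans FpW.
  by apply: cabs_innerC_le => //; exact: fourierL2_L2.
rewrite (cabs_innerC_atom _ _ a0 hG2 hpsi).
have a34 : 0 < a `^ (3 / 4) by exact: powR_gt0.
(* The factor [a^(3/4)] is spent on turning the norm of the pulled back [G] into that of [G],
   through Plancherel. *)
have Fm : a `^ (3 / 4) * ip F m <= K1.
  rewrite /K1 -(nrm_pulled s t a0 hG2) -mulrA ler_pM2l// -(nrm_fourier hp).
  exact: ip_le_nrm.
have Fl : a `^ (3 / 4) * ip F l <= nrm G * Num.sqrt (ip l l).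
  rewrite -(nrm_pulled s t a0 hG2) -mulrA ler_pM2l// -(nrm_fourier hp).
  exact: ip_le_nrm.
have UM : U ^+ M = a `^ ((1 - alpha) * M%:R) by rewrite powRrM powR_mulrn.
have VL : V ^+ L = a `^ ((alpha - 1 / 2) * L%:R) by rewrite powRrM powR_mulrn.
have EN : a `^ (3 / 4) * E = `|C| * a `^ (- (3 / 4) + alpha * N).
  by rewrite /E mulrCA; congr (_ * _); rewrite mulrA -!powR_addr//; congr (_ `^ _); field.
have UM0 : 0 <= U ^+ M by exact: exprn_ge0.
have VL0 : 0 <= V ^+ L by exact: exprn_ge0.
have AN0 : 0 <= a `^ (- (3 / 4) + alpha * N) by exact: powR_ge0.
apply: (@le_trans _ _ (a `^ (3 / 4) * \int[mu2]_w W w)); first by rewrite ler_pM2l.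
rewrite WE -UM -VL.
have H1 : a `^ (3 / 4) * (U ^+ M * ip F m) <= U ^+ M * K1.
  by rewrite mulrCA; apply: ler_wpM2l.
have H2 : a `^ (3 / 4) * (d ^- L * V ^+ L * ip F l) <= V ^+ L * K2.
  have -> : a `^ (3 / 4) * (d ^- L * V ^+ L * ip F l) = V ^+ L * (d ^- L * (a `^ (3 / 4) * ip F l)).
    by move: (ip F l) (a `^ _) (V ^+ L) (d ^- L) => *; ring.
  by apply: ler_wpM2l => //; apply: ler_wpM2l.
have H3 : a `^ (3 / 4) * (E * P1) = a `^ (- (3 / 4) + alpha * N) * K3.
  by rewrite mulrA EN /K3 mulrAC mulrC.
rewrite !mulrDr H3; clear H3 Fm; move: H1 H2 UM0 VL0 AN0 K10 K20 K30.
move: (a `^ (3 / 4) * (U ^+ M * ip F m)) (a `^ (3 / 4) * (d ^- L * V ^+ L * ip F l)).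
move: (U ^+ M) (V ^+ L) (a `^ (- (3 / 4) + alpha * N)) K1 K2 K3.
move=> A B D k1 k2 k3 x1 x2 h1 h2 A0 B0 D0 k10 k20 k30.
have := mulr_ge0 A0 k20; have := mulr_ge0 A0 k30; have := mulr_ge0 B0 k10.
have := mulr_ge0 B0 k30; have := mulr_ge0 D0 k10; have := mulr_ge0 D0 k20.
lra.
Qed.
End FrequencyMain.

(** * Localization and conclusion *)

Section Localization.
Context {R : realType}.
Implicit Types (x : PL R) (f : PL R -> R[i]) (phi : R * R -> R).

Lemma bump_mul_L12 phi f : continuous phi -> bounded_support phi -> LpC 2%:E f ->
  L12 (fun x => (phi x)%:C * f x).
Proof.
move=> c b [fr fi]; have [_ p2] := bump_L12 c b; have [B HB] := bounded_support_bound c b.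
have m := L2_measurable p2.
have rE : re_ (fun x => (phi x)%:C * f x) = fun x => phi x * re_ f x.
  by apply/funext => x; rewrite /re_ Re_mul /= mul0r subr0.
have iE : im_ (fun x => (phi x)%:C * f x) = fun x => phi x * im_ f x.
  by apply/funext => x; rewrite /im_ Im_mul /= mul0r addr0.
split; [rewrite rE; exact: L2_int|rewrite iE; exact: L2_int|split].
  rewrite -/(re_ _) rE; exact: (L2_mul_bounded fr m HB).
rewrite -/(im_ _) iE; exact: (L2_mul_bounded fi m HB).
Qed.
End Localization.

Theorem theorem3p1 (R : realType) (f psi : R * R -> R[i])
    (t0 : R * R) (s0 : R) (N P : R) (M L : nat)
    (f_L2 : LpC 2%:E f)
    (f_regular : regular_directed_point N f t0 s0)
    (psi_shearlet : shearlet psi)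
    (psi_sobolev : sobolevH 0 L psi)
    (psihat_L1 : LpC 1%:E (fourierL2 psi))
    (psi_moments : vanishing_moments_x1 M psi)
    (psi_decay : decay P psi) :
  exists (U : set (R * R)) (V : set R),
    [/\ nbhs t0 U, nbhs s0 V &
        forall alpha : R, 1 / 2 < alpha < 1 ->
        exists C : R, \forall a \near 0^'+,
        forall (t : R * R) (s : R), U t -> V s ->
          cabs (shearlet_transform psi f a s t) <=
            C * (a `^ (- (3 / 4) + P / 2) + a `^ ((1 - alpha) * M%:R)
                 + a `^ (- (3 / 4) + alpha * N)
                 + a `^ ((alpha - 1 / 2) * L%:R))].
Proof.
have [hpsi _] := psi_shearlet.
have [U0 [phi [V0 [C [/nbhs_ballP[r /= r0 rU] /nbhs_ballP[e /= e0 eV] [sphi kphi] phi1 hdir]]]]] := f_regular.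
have bphi := compactly_supported_bounded kphi.
have cphi := smooth_continuous sphi.
have phi_t0 : phi t0 != 0 by rewrite phi1 ?oner_neq0//; apply: rU; exact: ballxx.
have hsob := sobolev_fourierL2 psi_sobolev sphi bphi phi_t0.
pose G x : R[i] := (phi x)%:C * f x.
have hG : L12 G by exact: bump_mul_L12.
have [_ _ hG2] := hG.
pose h x : R[i] := f x - G x.
have hh : LpC 2%:E h by exact: LpCB.
have hdir' w : w.1 != 0 -> `|w.2 / w.1 - s0| < e ->
    cabs (fourier G w) <= C * (1 + enorm w) `^ (- N).
  by move=> w1 w2; apply: hdir => //; apply: eV; rewrite /ball/= distrC.
have [K2 [K20 freq]] := frequency_bound hG hpsi psihat_L1 psi_moments hsob e0 hdir'.
(* A bound for [|s|] on the whole neighbourhood makes the spatial constant uniform in [s]. *)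
pose S := `|s0| + e / 2.
have S0 : 0 <= S by rewrite addr_ge0// divr_ge0// ltW.
(* Half the radius: [t] near [t0] and [x] near [t] keep [x] where [phi] is [1]. Balls are those of
   the max norm, as the coordinatewise hypothesis of the tail estimate asks. *)
have r20 : 0 < r / 2 by rewrite divr_gt0.
have [K1 [K10 tail]] := spatial_tail hh hpsi psi_decay r20 S0.
exists (ball t0 (r / 2)), (ball s0 (e / 2)); split.
- exact: nbhsx_ballx.
- by apply: nbhsx_ballx; rewrite divr_gt0.
(* Neither constant depends on [alpha]; their sum lets each estimate be completed by the nonnegative
   terms that it lacks. *)
move=> alpha /andP[al1 al2]; exists (K1 + K2).
near=> a => t s Ut Vs; rewrite -[leLHS]/(cabs (shearlet_transform psi f a s t)).
have a0 : 0 < a by near: a; exact: nbhs_right_gt.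
have a1 : a <= 1 by near: a; apply: nbhs_right_le; exact: ltr01.
have al0 : 0 < alpha by apply: lt_trans al1; rewrite divr_gt0.
have ss0 : `|s - s0| < e / 2 by rewrite distrC.
have sS : `|s| <= S.
  have := ler_normD (s - s0) s0; rewrite subrK => /le_trans; apply.
  by rewrite /S addrC lerD2l ltW.
have h0 x : `|x.1 - t.1| < r / 2 -> `|x.2 - t.2| < r / 2 -> h x = 0.
  move=> x1 x2; rewrite /h /G phi1 ?mul1r ?subrr//; apply: rU.
  have -> : r = r / 2 + r / 2 by field.
  by apply: (ball_triangle Ut); split; rewrite /ball/= distrC.
have b1 := tail a s t a0 a1 sS h0.
have b2 := freq alpha a s t al0 a0 a1 ss0.
have hat := shearlet_atom_L2 s t a0 hpsi.
have -> : shearlet_transform psi f a s t =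
    innerC h (shearlet_atom psi a s t) + innerC G (shearlet_atom psi a s t).
  by rewrite [X in X + _](innerCB f_L2 hG2 hat) subrK.
apply: (le_trans (@le_normcD R _ _)); apply: (le_trans (lerD b1 b2)).
have := powR_ge0 a (- (3 / 4) + P / 2).
have := powR_ge0 a ((1 - alpha) * M%:R).
have := powR_ge0 a (- (3 / 4) + alpha * N).
have := powR_ge0 a ((alpha - 1 / 2) * L%:R).
move: (a `^ _) (a `^ _) (a `^ _) (a `^ _) => A4 A3 A2 A1 p4 p3 p2 p1.
have := mulr_ge0 K10 p2; have := mulr_ge0 K10 p3; have := mulr_ge0 K10 p4.
have := mulr_ge0 K20 p1; lra.
Unshelve. all: by end_near. Qed.
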